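(* Let $E \subset \mathbb{C}$ be a compact set with $\mathrm{cap}(E)>0$, where $\mathrm{cap}(E)$ denotes the logarithmic capacity of $E$ and $\mu_E$ its equilibrium measure. Let $d_E(z):=\max_{t\in E}|z-t|$ for $z\in\mathbb{C}$. Suppose that $\nu_j$, $j=1,\ldots,m$, are positive compactly supported Borel measures with potentials $p_j(z)=\int\log|z-t|\,d\nu_j(t)$, such that the total mass of $\sum_{j=1}^m \nu_j$ equals $1$. Then \[ \sum_{j=1}^m \sup_E p_j \le C_E + \sup_E \sum_{j=1}^m p_j, \] where \[ C_E := \int \log d_E(z)\, d\mu_E(z) - \log\mathrm{cap}(E), \] and $C_E$ cannot be replaced by a smaller constant. *)

(* Defs.v *)
(* The complex plane is modelled as R * R
   (product topology = usual topology, product sigma-algebra of the Borel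
   sigma-algebras = Borel sigma-algebra of C), with the Euclidean modulus. *)
From HB Require Import structures.
From mathcomp Require Import all_boot all_order all_algebra.
From mathcomp Require Import all_classical all_reals all_analysis.
Set Implicit Arguments. Unset Strict Implicit. Unset Printing Implicit Defensive.
Import Order.TTheory GRing.Theory Num.Theory.
Import numFieldNormedType.Exports.
Local Open Scope classical_set_scope.
Local Open Scope ring_scope.

Section Defs.
Context {R : realType}.

Local Notation cpt := (R * R)%type.

Definition cdist (z t : cpt) : R :=
  Num.sqrt ((z.1 - t.1) ^+ 2 + (z.2 - t.2) ^+ 2).

Definition elog (x : R) : \bar R := if x == 0 then -oo%E else (ln x)%:E.

Definition cmeasure := {measure set cpt -> \bar R}.

Definition compactly_supported (nu : cmeasure) : Prop :=
  exists K : set cpt, compact K /\ nu (~` K) = 0%E.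

Definition potential (nu : cmeasure) (z : cpt) : \bar R :=
  (\int[nu]_(t in [set: cpt]) elog (cdist z t))%E.

Definition prob_on (E : set cpt) (mu : cmeasure) : Prop :=
  mu [set: cpt] = 1%E /\ mu (~` E) = 0%E.

Definition energy (mu : cmeasure) : \bar R :=
  (\int[mu]_(z in [set: cpt]) - potential mu z)%E.

Definition robin (E : set cpt) : \bar R :=
  ereal_inf [set energy mu | mu in [set mu : cmeasure | prob_on E mu]].

Definition cap (E : set cpt) : R :=
  match robin E with
  | EFin v => expR (- v)
  | _ => 0
  end.

(* mu is the equilibrium measure of E: a probability measure on E
   minimizing the energy (unique when cap(E) > 0) *)
Definition equilibrium_measure (E : set cpt) (mu : cmeasure) : Prop :=
  prob_on E mu /\ energy mu = robin E.

Definition dE (E : set cpt) (z : cpt) : R := sup [set cdist z t | t in E].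

Definition CE (E : set cpt) (muE : cmeasure) : \bar R :=
  ((\int[muE]_(z in [set: cpt]) elog (dE E z)) - (ln (cap E))%:E)%E.

Definition supE (E : set cpt) (f : cpt -> \bar R) : \bar R :=
  ereal_sup [set f z | z in E].

Definition admissible_family (m : nat) (nu : 'I_m -> cmeasure) : Prop :=
  (forall j, compactly_supported (nu j)) /\
  (\sum_(j < m) nu j [set: cpt])%E = 1%E.

Definition sup_ineq (E : set cpt) (C : \bar R) (m : nat)
    (nu : 'I_m -> cmeasure) : Prop :=
  (\sum_(j < m) supE E (potential (nu j))
     <= C + supE E (fun z => \sum_(j < m) potential (nu j) z))%E.

End Defs.

(* Main.v *)
(* Write p_nu for the potential of a measure nu, and let mu be the equilibrium
   measure of E.

   Upper bound.  Let nu be the sum of the nu_j.  Integrating |z - t| <= d_E(t)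
   gives sum_j sup_E p_j <= \int log d_E dnu, so it suffices to show
   \int log d_E d(nu - mu) <= s, where s = sup_E p_nu - log cap(E) >= 0.  The
   Bernstein-Walsh inequality p_nu <= p_mu + s holds in the whole plane; summed
   over the roots of a polynomial P of degree n it gives
   \int log |P| d(nu - mu) <= n s.  Replacing two polynomials P, Q by P + w Q and
   averaging over w in [0, 1] extends this to the logarithm of a maximum of K
   polynomials of degree n, up to an error O(K) independent of n.  For the powers
   (X - t_k)^n, with t_1, ..., t_K a fine net in E, dividing by n and letting n
   tend to infinity gives the claim.  The Bernstein-Walsh inequality and the lower
   bound p_mu >= log cap(E) come from a maximum principle, in which the mean value
   property is only used in the form of sums over four points z +- r, z +- i r.

   Sharpness.  Cut (1 - eta) mu into pieces of small diameter: the supremum over E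
   of the potential of a piece is close to the integral of log d_E over it.  However,
   p_mu may exceed log cap(E) + eps on a compact set K in E.  By minimality of mu,
   K carries no measure of finite energy, and then K carries probability measures
   lambda whose potential is as negative as desired on K; the family is completed by
   eta lambda.  If there were no such lambda, one could choose points z_0, z_1, ... of
   K such that sum_(i < n) log |z_n - z_i| >= - M n, and a limit of the empirical
   measures of this sequence would have finite energy. *)
Require Import Defs.
From HB Require Import structures.
From mathcomp Require Import all_boot all_order all_algebra.
From mathcomp Require Import all_classical all_reals all_analysis.
From mathcomp Require Import measurable_realfun complex ring lra.
Set Implicit Arguments.
Unset Strict Implicit.
Unset Printing Implicit Defensive.
Import Order.TTheory GRing.Theory Num.Theory.
Import numFieldNormedType.Exports.
Local Open Scope classical_set_scope.
Local Open Scope ring_scope.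

(** If log d_E were known to be the potential of a unit measure sigma, the upper bound would be
    immediate: \int log d_E d(nu - mu) = \int (p_nu - p_mu) dsigma <= s. The polynomials stand in
    for this representation, with normalized counting measures of roots in the place of sigma. The
    cost of averaging is additive whereas the degree multiplies all the rest, so it vanishes after
    division by n. Potentials take the value -oo and are only upper semicontinuous. Kernels are
    therefore written as ln B minus a logarithm truncated at B: the integrands are nonnegative, and
    Tonelli and monotone convergence apply. A height d > 0 above the plane makes the kernels
    continuous, and they increase as d decreases to 0; this serves wherever continuity is needed, as
    in the maximum principle and Dini's argument. The limit of the empirical measures does not come
    from weak compactness: limit frequencies of nested codes cut [0, 1) into intervals, a map from
    [0, 1) to K is read off, and the measure is the image of Lebesgue measure. *)

Section plane.
Context {R : realType}.
Local Notation cpt := (R * R)%type.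
Implicit Types (z t w : cpt) (d e r : R).

Definition rho d z t : R := Num.sqrt ((z.1 - t.1) ^+ 2 + (z.2 - t.2) ^+ 2 + d ^+ 2).

Lemma rho0 z t : rho 0 z t = cdist z t.
Proof. by rewrite /rho /cdist expr0n addr0. Qed.

Lemma rhoC d z t : rho d z t = rho d t z.
Proof. by rewrite /rho -sqrrN opprB -(sqrrN (z.2 - _)) opprB. Qed.

Lemma rho_ge0 d z t : 0 <= rho d z t.
Proof. exact: sqrtr_ge0. Qed.

Lemma rho_sqr d z t :
  rho d z t ^+ 2 = (z.1 - t.1) ^+ 2 + (z.2 - t.2) ^+ 2 + d ^+ 2.
Proof. by rewrite sqr_sqrtr// !addr_ge0// sqr_ge0. Qed.

Lemma rho_ge d z t : d <= rho d z t.
Proof.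
rewrite (le_trans (ler_norm _))// -sqrtr_sqr ler_wsqrtr//.
by rewrite lerDr addr_ge0 ?sqr_ge0.
Qed.

Lemma le_rho d e z t : 0 <= d -> d <= e -> rho d z t <= rho e z t.
Proof.
move=> d0 de; rewrite ler_wsqrtr// lerD2l lerXn2r// nnegrE//.
exact: le_trans de.
Qed.

Lemma cdist_ge0 z t : 0 <= cdist z t.
Proof. exact: sqrtr_ge0. Qed.

Lemma cdistC z t : cdist z t = cdist t z.
Proof. by rewrite -!rho0 rhoC. Qed.

Lemma cdist_sqr z t : cdist z t ^+ 2 = (z.1 - t.1) ^+ 2 + (z.2 - t.2) ^+ 2.
Proof. by rewrite -rho0 rho_sqr expr0n addr0. Qed.

Lemma cdistxx z : cdist z z = 0.
Proof. by rewrite /cdist !subrr expr0n addr0 sqrtr0. Qed.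

Lemma cdist_eq0 z t : cdist z t = 0 -> z = t.
Proof.
move=> h; have := cdist_sqr z t; rewrite h expr0n/= => /esym/eqP.
rewrite paddr_eq0 ?sqr_ge0// !sqrf_eq0 !subr_eq0 => /andP[/eqP h1 /eqP h2].
by case: z t h h1 h2 => [? ?] [? ?] /= _ -> ->.
Qed.

(** The triangle inequality of three-space for a horizontal displacement. After squaring it is
    Cauchy-Schwarz, whose defect is a sum of three squares. *)
Lemma rho_triangle d z w t : rho d z t <= cdist z w + rho d w t.
Proof.
have r0 := rho_ge0 d w t; have c0 := cdist_ge0 z w.
have H : (z.1 - w.1) * (w.1 - t.1) + (z.2 - w.2) * (w.2 - t.2)
    <= cdist z w * rho d w t.
  rewrite (le_trans (ler_norm _))// -sqrtr_sqr.
  rewrite -[leRHS]ger0_norm ?mulr_ge0// -[leRHS]sqrtr_sqr ler_wsqrtr//.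
  rewrite exprMn cdist_sqr rho_sqr.
  move: (z.1 - w.1) (z.2 - w.2) (w.1 - t.1) (w.2 - t.2) => u v x y.
  rewrite -subr_ge0.
  have -> : (u ^+ 2 + v ^+ 2) * (x ^+ 2 + y ^+ 2 + d ^+ 2) - (u * x + v * y) ^+ 2
    = (u * y - v * x) ^+ 2 + (u * d) ^+ 2 + (v * d) ^+ 2 by ring.
  by rewrite !addr_ge0// sqr_ge0.
rewrite -(ler_pXn2r (n := 2))// ?nnegrE ?rho_ge0 ?addr_ge0//.
rewrite rho_sqr (sqrrD (cdist _ _)) rho_sqr cdist_sqr.
rewrite -(subrKA w.1 z.1) -(subrKA w.2 z.2).
move: (z.1 - w.1) (z.2 - w.2) (w.1 - t.1) (w.2 - t.2) (cdist _ _ * _) H => u v x y q H.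
by rewrite !sqrrD mulr2n; lra.
Qed.

Lemma cdist_triangle z w t : cdist z t <= cdist z w + cdist w t.
Proof. by rewrite -rho0 (le_trans (rho_triangle _ _ w _))// rho0. Qed.

Lemma cdist_ge_abs1 z w : `|z.1 - w.1| <= cdist z w.
Proof. by rewrite -sqrtr_sqr ler_wsqrtr// lerDl sqr_ge0. Qed.

Lemma cdist_ge_abs2 z w : `|z.2 - w.2| <= cdist z w.
Proof. by rewrite -sqrtr_sqr ler_wsqrtr// lerDr sqr_ge0. Qed.

Lemma cdist_le_abs z w : cdist z w <= `|z.1 - w.1| + `|z.2 - w.2|.
Proof.
rewrite -(ler_pXn2r (n := 2))// ?nnegrE ?cdist_ge0 ?addr_ge0//.
rewrite cdist_sqr (sqrrD `|_|).
have := mulr_ge0 (normr_ge0 (z.1 - w.1)) (normr_ge0 (z.2 - w.2)).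
have -> (x : R) : `|x| ^+ 2 = x ^+ 2 by rewrite real_normK ?num_real.
have -> (x : R) : `|x| ^+ 2 = x ^+ 2 by rewrite real_normK ?num_real.
by move: (`|_| * _) => q q0; rewrite mulr2n; lra.
Qed.

Definition disk z r : set cpt := [set w | cdist z w < r].

Lemma nbhs_disk z (A : set cpt) :
  nbhs z A <-> exists2 r, 0 < r & disk z r `<=` A.
Proof.
split=> [/nbhs_ballP[r /= r0 rA]|[r r0 rA]].
  exists r => // w zw; apply: rA; split => /=.
  - exact: le_lt_trans (cdist_ge_abs1 z w) zw.
  - exact: le_lt_trans (cdist_ge_abs2 z w) zw.
apply/nbhs_ballP; exists (r / 2); first by rewrite /= divr_gt0.
move=> w [h1 h2]; apply: rA; apply: (le_lt_trans (cdist_le_abs _ _)).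
by rewrite (splitr r) ltrD.
Qed.

Lemma open_disk z r : open (disk z r).
Proof.
rewrite openE => w /= zw; apply/nbhs_disk; exists (r - cdist z w).
  by rewrite subr_gt0.
move=> t /= wt; apply: le_lt_trans (cdist_triangle z w t) _.
by rewrite -ltrBrDl.
Qed.

(** Only an upper bound is assumed: exchanging [z] and [w] gives the lower one, as [cdist] is
    symmetric. The sign of [k] is arbitrary, hence the radius with [|k| + 1]. *)
Lemma lip_continuous (f : cpt -> R) (k : R) :
  (forall z w, f w <= f z + k * cdist z w) -> continuous f.
Proof.
move=> H z; apply/cvgrPdist_lt => /= e e0.
apply/nbhs_disk; exists (e / (`|k| + 1)); first by rewrite divr_gt0// ltr_wpDl.
move=> w /= zw.
have : (`|k| + 1) * cdist z w < e by rewrite mulrC -ltr_pdivlMr// ltr_wpDl.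
have c0 := cdist_ge0 z w.
have : k * cdist z w <= `|k| * cdist z w by rewrite ler_wpM2r// ler_norm.
have := H z w; have := H w z; rewrite (cdistC w z) => ? ? ? ?.
by rewrite ltr_norml; apply/andP; split; nra.
Qed.

Lemma cdist_continuousr z : continuous (cdist z).
Proof. by apply: (@lip_continuous _ 1) => w t; rewrite mul1r cdist_triangle. Qed.

Lemma closed_ler (f : cpt -> R) (a : R) : continuous f -> closed [set z | f z <= a].
Proof.
move=> cf; apply: (closed_comp (D := [set x | x <= a])) => //.
Qed.

Lemma compact_bounded_disk (K : set cpt) : compact K ->
  exists2 r, 0 < r & forall z, K z -> cdist (0, 0) z <= r.
Proof.
move=> cK; have [->|/set0P K0] := eqVneq K set0; first by exists 1.
have [|c _ Hc] := @compact_EVT_max _ R (cdist (0, 0)) K K0 cK.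
  by apply: continuous_subspaceT; exact: cdist_continuousr.
exists (cdist (0, 0) c + 1); first by rewrite ltr_wpDl ?cdist_ge0.
by move=> z Kz; rewrite (le_trans (Hc _ (mem_set Kz)))// lerDl.
Qed.

Lemma compact_disk (z : cpt) r : compact [set w | cdist z w <= r].
Proof.
have sub : [set w | cdist z w <= r] `<=`
    [set` `[z.1 - r, z.1 + r]] `*` [set` `[z.2 - r, z.2 + r]].
  move=> w /= zw; split => /=; rewrite in_itv/= -ler_distlC.
  - exact: le_trans (cdist_ge_abs1 z w) zw.
  - exact: le_trans (cdist_ge_abs2 z w) zw.
apply: subclosed_compact sub.
  exact/closed_ler/cdist_continuousr.
by apply: compact_setX; exact: segment_compact.
Qed.

Lemma cpt_hausdorff : hausdorff_space cpt.
Proof. exact: norm_hausdorff. Qed.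

(** The sigma-algebra of the plane is a product of Borel sigma-algebras, so an open set has to be
    displayed as a countable union of measurable rectangles: the squares with rational centre and
    radius 1/(n+1) that it contains. *)
Lemma open_measurable2 (G : set cpt) : open G -> measurable G.
Proof.
move=> oG.
pose D (i : rat * rat * nat) : set cpt :=
  ball (ratr i.1.1 : R) (i.2.+1%:R^-1) `*` ball (ratr i.1.2 : R) (i.2.+1%:R^-1).
pose F i := if `[< D i `<=` G >] then D i else set0.
have -> : G = \bigcup_i F i.
  apply/seteqP; split; last first.
    by move=> z [i _]; rewrite /F; case: asboolP => // h; exact: h.
  move=> z Gz; have : nbhs z G by apply: open_nbhs_nbhs.
  move=> /nbhs_ballP[e /= e0 eG].
  have [n ne] : exists n, n.+1%:R^-1 < e / 2 :> R.
    have e20 : 0 < e / 2 by rewrite divr_gt0.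
    have [N _ /(_ N (leqnn N)) /=] := near_infty_natSinv_lt (PosNum e20).
    by exists N.
  have n0 : 0 < n.+1%:R^-1 :> R by rewrite invr_gt0.
  have q_ (x : R) : exists q : rat, `|ratr q - x| < n.+1%:R^-1.
    have [|q] := @rat_in_itvoo _ (x - n.+1%:R^-1) (x + n.+1%:R^-1).
      by rewrite ltrBlDr -addrA ltrDl addr_gt0.
    by rewrite in_itv/= -ltr_distl => h; exists q.
  have [q1 h1] := q_ z.1; have [q2 h2] := q_ z.2.
  exists (q1, q2, n) => //; rewrite /F; case: asboolP; first by split.
  move=> abs; exfalso; apply: abs => w [/= w1 w2]; apply: eG; split => /=.
  - rewrite /ball/= -(subrKA (ratr q1)) (le_lt_trans (ler_normD _ _))//.
    by rewrite distrC (splitr e) ltrD// (lt_trans _ ne).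
  - rewrite /ball/= -(subrKA (ratr q2)) (le_lt_trans (ler_normD _ _))//.
    by rewrite distrC (splitr e) ltrD// (lt_trans _ ne).
apply: countable_bigcupT_measurable; first exact: countableP.
move=> i; rewrite /F; case: asboolP => // _.
by apply: measurableX; apply: open_measurable; exact: ball_open.
Qed.

Lemma closed_measurable2 (G : set cpt) : closed G -> measurable G.
Proof.
move=> cG; rewrite -[G]setCK; apply: measurableC; apply: open_measurable2.
exact: closed_openC.
Qed.

Lemma compact_measurable2 (G : set cpt) : compact G -> measurable G.
Proof.
by move=> cG; apply: closed_measurable2; apply: compact_closed cG; exact: cpt_hausdorff.
Qed.

Lemma continuous_measurable2 (f : cpt -> R) : continuous f -> measurable_fun setT f.
Proof.
move=> cf; apply: (measurability _ (RGenOInfty.measurableE R)).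
move=> _ [_ [a ->] <-]; rewrite setTI preimage_itvoy; apply: open_measurable2.
apply: (open_comp (D := [set x | a < x])); first by move=> x _; exact: cf.
exact: open_gt.
Qed.

Lemma measurable_rho d : measurable_fun setT (fun x : cpt * cpt => rho d x.1 x.2).
Proof.
apply: measurableT_comp; first by apply: continuous_measurable_fun; exact: sqrt_continuous.
apply: measurable_funD => //; apply: measurable_funD; apply: measurable_funX.
  apply: measurable_funB.
    exact: (measurableT_comp measurable_fst measurable_fst).
  exact: (measurableT_comp measurable_fst measurable_snd).
apply: measurable_funB.
  exact: (measurableT_comp measurable_snd measurable_fst).
exact: (measurableT_comp measurable_snd measurable_snd).
Qed.

Lemma measurable_elog : measurable_fun [set: R] (elog : R -> \bar R).
Proof.
rewrite /elog; apply: measurable_fun_ifT => //=.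
  exact: measurable_fun_eqr.
by apply/measurable_EFinP; exact: measurable_ln.
Qed.

End plane.

(** * Integration *)

Section upper_integral.
Local Open Scope ereal_scope.
Context d (T : measurableType d) (R : realType).
Variable mu : {measure set T -> \bar R}.
Implicit Types f g : T -> \bar R.

(** Measures are localized by null complements rather than by supports; estimates that hold only on
    a carrier enter the integrals through this lemma. *)
Lemma ae_of_null (K : set T) (P : T -> Prop) : measurable K -> mu (~` K) = 0 ->
  (forall x, K x -> P x) -> {ae mu, forall x, P x}.
Proof.
move=> mK K0 KP; exists (~` K); split => //; first exact: measurableC.
by move=> x /= nP Kx; apply: nP; exact: KP.
Qed.

Lemma ae_le_integral f g : measurable_fun setT f -> measurable_fun setT g ->
  {ae mu, forall x, f x <= g x} -> \int[mu]_x f x <= \int[mu]_x g x.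
Proof.
move=> mf mg fg; rewrite integralE [leRHS]integralE; apply: leeB.
- apply: ae_ge0_le_integral => //.
  + exact: measurable_funepos.
  + exact: measurable_funepos.
  + apply: filterS fg => x fg _; rewrite !funeposE.
    by rewrite ge_max le_max fg/= le_max lexx orbT.
- apply: ae_ge0_le_integral => //.
  + exact: measurable_funeneg.
  + exact: measurable_funeneg.
  + apply: filterS fg => x fg _; rewrite !funenegE.
    by rewrite ge_max le_max leeN2 fg/= le_max lexx orbT.
Qed.

(* The integral of such a function may be [-oo], but it is additive. *)
Definition ubi f := measurable_fun setT f /\ \int[mu]_x f^\+ x < +oo.

Lemma ubi_le f g : measurable_fun setT f -> ubi g ->
  {ae mu, forall x, f x <= g x} -> ubi f.
Proof.
move=> mf [mg g0] fg; split => //; apply: le_lt_trans g0.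
apply: ae_ge0_le_integral => //.
  exact: measurable_funepos.
  exact: measurable_funepos.
apply: filterS fg => x fg _; rewrite !funeposE.
by rewrite ge_max le_max fg/= le_max lexx orbT.
Qed.

Lemma ubiD f g : ubi f -> ubi g -> ubi (f \+ g).
Proof.
move=> [mf f0] [mg g0]; split; first exact: emeasurable_funD.
apply: (@le_lt_trans _ _ (\int[mu]_x (f^\+ x + g^\+ x))).
  apply: ge0_le_integral => //.
  + by apply: measurable_funepos; exact: emeasurable_funD.
  + by apply: emeasurable_funD; exact: measurable_funepos.
  + by move=> x _; rewrite !funeposE ge_max adde_ge0 ?le_max ?lexx ?orbT//= leeD// le_max lexx.
rewrite ge0_integralD//; [|exact: measurable_funepos|exact: measurable_funepos].
exact: lte_add_pinfty.
Qed.

Lemma ubi_cst (r : R) : mu setT < +oo -> ubi (fun=> r%:E).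
Proof.
move=> muT; split => //; rewrite (eq_integral (fun=> (Num.max r 0)%:E)); last first.
  by move=> x _; rewrite funeposE EFin_max.
rewrite integral_cst//= lte_mul_pinfty// lee_fin le_max lexx orbT//.
Qed.

(** The identity [E] needs additivity for nonnegative functions only. It holds even at points where
    [f] and [g] are infinite with opposite signs: the sum is then [-oo], and both sides are [+oo].
    The integrals of the positive parts are finite and can be moved across; if a negative part has
    infinite integral, both members are [-oo]. *)
Lemma integralD_ub f g : ubi f -> ubi g ->
  \int[mu]_x (f x + g x) = \int[mu]_x f x + \int[mu]_x g x.
Proof.
move=> uf ug; have [mh h0] := ubiD uf ug; case: uf ug => [mf f0] [mg g0].
have E : \int[mu]_x (f \+ g)^\+ x + (\int[mu]_x f^\- x + \int[mu]_x g^\- x) =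
         \int[mu]_x (f \+ g)^\- x + (\int[mu]_x f^\+ x + \int[mu]_x g^\+ x).
  rewrite -!ge0_integralD//=; try by
    [exact: measurable_funepos|exact: measurable_funeneg|
     move=> x _; exact: adde_ge0|
     by apply: emeasurable_funD; [exact: measurable_funeneg|exact: measurable_funeneg]|
     by apply: emeasurable_funD; [exact: measurable_funepos|exact: measurable_funepos]].
  apply: eq_integral => x _; rewrite !funeposE !funenegE/=.
  have max_fin (r : R) : maxe r%:E 0 = (Num.max r 0)%:E by rewrite EFin_max.
  have maxE (r : R) : Num.max r 0%R = (r + Num.max (- r) 0)%R.
    by rewrite addr_maxr subrr addr0 maxC.
  move: (f x) (g x) => [a| |] [b| |]//=;
    rewrite -?EFinD -?EFinN ?max_fin ?maxNye ?maxye ?maxey ?adde0 ?add0e ?addye ?addey//.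
  by rewrite -!EFinD (maxE a) (maxE b) (maxE (a + b)%R); congr EFin; ring.
rewrite integralE (integralE mu _ f) (integralE mu _ g).
have := integral_ge0 (D := setT) mu (f := (f \+ g)^\+) (fun x _ => funepos_ge0 _ x).
have := integral_ge0 (D := setT) mu (f := (f \+ g)^\-) (fun x _ => funeneg_ge0 _ x).
have := integral_ge0 (D := setT) mu (f := f^\+) (fun x _ => funepos_ge0 _ x).
have := integral_ge0 (D := setT) mu (f := f^\-) (fun x _ => funeneg_ge0 _ x).
have := integral_ge0 (D := setT) mu (f := g^\+) (fun x _ => funepos_ge0 _ x).
have := integral_ge0 (D := setT) mu (f := g^\-) (fun x _ => funeneg_ge0 _ x).
move: E f0 g0 h0.
move: (integral _ _ (f \+ g)^\+) (integral _ _ (f \+ g)^\-)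
 (integral _ _ f^\+) (integral _ _ f^\-) (integral _ _ g^\+) (integral _ _ g^\-).
move=> [a| |] [b| |] [c| |] [e| |] [k| |] [l| |]//=.
rewrite -!EFinD => -[ble] _ _ _ _ _ _ _ _ _; congr EFin.
have -> : a = (b + (c + k) - (e + l))%R by rewrite -ble; ring.
ring.
Qed.

Lemma ubi_bnd (L : R) f : mu setT < +oo -> measurable_fun setT f ->
  {ae mu, forall x, f x <= L%:E} -> ubi f.
Proof. by move=> muT mf fL; apply: ubi_le fL => //; exact: ubi_cst. Qed.

(** Reduction to a nonnegative integrand. The [maxe 0] changes it only on the null set where the
    bound fails. *)
Lemma integral_ubE (L : R) f : mu setT < +oo -> measurable_fun setT f ->
  {ae mu, forall x, f x <= L%:E} ->
  \int[mu]_x f x = L%:E * mu setT - \int[mu]_x maxe 0 (L%:E - f x).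
Proof.
move=> muT mf fL.
have mg : measurable_fun setT (fun x => maxe 0 (L%:E - f x)).
  by apply: measurable_maxe => //; exact: emeasurable_funB.
have mNg : measurable_fun setT (fun x => - maxe 0 (L%:E - f x)).
  exact: measurableT_comp.
have g0 x : 0 <= maxe 0 (L%:E - f x) by rewrite le_max lexx.
rewrite (ae_eq_integral (fun x => L%:E + - maxe 0 (L%:E - f x)))//; last 2 first.
- exact: emeasurable_funD.
- apply: filterS fL => x fL _; rewrite max_r ?sube_ge0//; first last.
    by rewrite orbT.
  by case: (f x) fL => [r _| |]//; rewrite -!EFinB subKr.
rewrite integralD_ub; [|exact: ubi_cst|]; last first.
  apply: (@ubi_bnd 0%R) => //; apply/aeW => x; rewrite oppe_le0//.
by rewrite integral_cst// integral_ge0N.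
Qed.

End upper_integral.

(** Tonelli's theorem is stated for bundled finite measures. An integral depends only on the values
    of the measure on sets, so the same set function may be bundled again. *)
Lemma finite_measure_pack (R : realType) d (T : measurableType d) (m : {measure set T -> \bar R}) :
  (m setT < +oo)%E -> exists m' : {finite_measure set T -> \bar R}, m = m' :> (set T -> \bar R).
Proof.
move=> mT.
have F : fin_num_fun m by exact: lty_fin_num_fun.
have m0 : (m set0 < +oo)%E by rewrite measure0.
pose H1 := isFinite.Build _ _ _ _ F.
pose H2 := isSFinite.Build _ _ _ _ (sfinite_measure_sigma_finite (fin_num_fun_sigma_finite m0 F)).
pose H3 := isSigmaFinite.Build _ _ _ _ (fin_num_fun_sigma_finite m0 F).
by exists (HB.pack_for (FiniteMeasure.type T R) (Measure.sort m) H1 H2 H3).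
Qed.

Section tonelli.
Local Open Scope ereal_scope.
Context d1 d2 (T1 : measurableType d1) (T2 : measurableType d2) (R : realType).
Variables (m1 : {measure set T1 -> \bar R}) (m2 : {measure set T2 -> \bar R}).
Variable f : T1 * T2 -> \bar R.
Hypotheses (mf : measurable_fun setT f).

Lemma tonelli : m1 setT < +oo -> m2 setT < +oo -> (forall z, 0 <= f z) ->
  \int[m1]_x \int[m2]_y f (x, y) = \int[m2]_y \int[m1]_x f (x, y).
Proof.
move=> /finite_measure_pack[m1' h1] /finite_measure_pack[m2' h2] f0.
transitivity (\int[m1']_x \int[m2']_y f (x, y)).
  rewrite (eq_measure_integral m1') => [|A mA _]; last by rewrite h1.
  by apply: eq_integral => x _; apply: eq_measure_integral => A mA _; rewrite h2.
rewrite fubini_tonelli//.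
rewrite [RHS](eq_measure_integral m2') => [|A mA _]; last by rewrite h2.
by apply: eq_integral => x _; apply: eq_measure_integral => A mA _; rewrite h1.
Qed.

End tonelli.

Section ub_tonelli.
Local Open Scope ereal_scope.
Context (R : realType).

Lemma measurable_integral_ge0 d1 d2 (T1 : measurableType d1) (T2 : measurableType d2)
    (m2 : {measure set T2 -> \bar R}) (f : T1 * T2 -> \bar R) :
  measurable_fun setT f -> m2 setT < +oo -> (forall z, 0 <= f z) ->
  measurable_fun setT (fun x => \int[m2]_y f (x, y)).
Proof.
move=> mf /finite_measure_pack[m' m2m'] f0.
rewrite (_ : (fun x => _) = fun x => \int[m']_y f (x, y)).
  exact: measurable_fun_fubini_tonelli_F.
by apply/funext => x; apply: eq_measure_integral => A mA _; rewrite m2m'.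
Qed.

Lemma measurable_integral2 d1 d2 (T1 : measurableType d1) (T2 : measurableType d2)
    (m2 : {measure set T2 -> \bar R}) (f : T1 * T2 -> \bar R) :
  measurable_fun setT f -> m2 setT < +oo ->
  measurable_fun setT (fun x => \int[m2]_y f (x, y)).
Proof.
move=> mf m2T.
rewrite (_ : (fun x => _) = fun x => \int[m2]_y f^\+ (x, y) - \int[m2]_y f^\- (x, y)).
  apply: emeasurable_funB; apply: measurable_integral_ge0 => //.
    exact: measurable_funepos.
  exact: measurable_funeneg.
apply/funext => x; rewrite integralE; congr (_ - _).
  by apply: eq_integral => y _; rewrite !funeposE.
by apply: eq_integral => y _; rewrite !funenegE.
Qed.

Let ub_tonelli_half d1 d2 (T1 : measurableType d1) (T2 : measurableType d2)
    (m1 : {measure set T1 -> \bar R}) (m2 : {measure set T2 -> \bar R})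
    (f : T1 * T2 -> \bar R) (K1 : set T1) (K2 : set T2) (L : R) :
  measurable_fun setT f -> m1 setT < +oo -> m2 setT < +oo ->
  measurable K1 -> measurable K2 -> m1 (~` K1) = 0 -> m2 (~` K2) = 0 ->
  (forall x y, K1 x -> K2 y -> f (x, y) <= L%:E) ->
  \int[m1]_x \int[m2]_y f (x, y) =
  L%:E * m2 setT * m1 setT - \int[m1]_x \int[m2]_y maxe 0 (L%:E - f (x, y)).
Proof.
move=> mf m1T m2T mK1 mK2 m1K1 m2K2 fL.
have /fineK E2 : m2 setT \is a fin_num by rewrite ge0_fin_numE.
pose g z := maxe 0 (L%:E - f z).
have g0 z : 0 <= g z by rewrite le_max lexx.
have mg : measurable_fun setT g.
  by apply: measurable_maxe => //; exact: emeasurable_funB.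
have mG : measurable_fun setT (fun x => \int[m2]_y g (x, y)).
  exact: measurable_integral2.
have mF := measurable_integral2 mf m2T.
rewrite (ae_eq_integral (fun x => L%:E * m2 setT - \int[m2]_y g (x, y)))//; last 2 first.
- by apply: emeasurable_funB => //; exact: measurable_cst.
- apply: (ae_of_null mK1 m1K1) => x K1x _; apply: integral_ubE => //.
    by apply: measurableT_comp => //; exact: measurable_pair1.
  by apply: (ae_of_null mK2 m2K2) => y; exact: fL.
rewrite -E2 -EFinM integralD_ub.
- by rewrite integral_cst// integral_ge0N// => x _; exact: integral_ge0.
- exact: ubi_cst.
- apply: (@ubi_bnd _ _ _ _ 0%R) => //; first exact: measurableT_comp.
  by apply/aeW => x; rewrite oppe_le0; exact: integral_ge0.
Qed.

(** Both iterated integrals equal the same product of [L] and the two masses, minus an iterated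
    integral of the nonnegative [maxe 0 (L - f)], to which Tonelli applies. The truncation at 0
    takes care of the points outside [K1] and [K2], where [f] is not bounded. *)
Lemma ub_tonelli d1 d2 (T1 : measurableType d1) (T2 : measurableType d2)
    (m1 : {measure set T1 -> \bar R}) (m2 : {measure set T2 -> \bar R})
    (f : T1 * T2 -> \bar R) (K1 : set T1) (K2 : set T2) (L : R) :
  measurable_fun setT f -> m1 setT < +oo -> m2 setT < +oo ->
  measurable K1 -> measurable K2 -> m1 (~` K1) = 0 -> m2 (~` K2) = 0 ->
  (forall x y, K1 x -> K2 y -> f (x, y) <= L%:E) ->
  \int[m1]_x \int[m2]_y f (x, y) = \int[m2]_y \int[m1]_x f (x, y).
Proof.
move=> mf m1T m2T mK1 mK2 m1K1 m2K2 fL.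
rewrite (ub_tonelli_half mf m1T m2T mK1 mK2 m1K1 m2K2 fL).
pose sf z := f (z.2, z.1).
have msf : measurable_fun setT sf by apply: measurableT_comp => //; exact: measurable_swap.
rewrite [RHS](@ub_tonelli_half _ _ _ _ m2 m1 sf K2 K1 L)//; last by move=> y x ? ?; exact: fL.
rewrite muleAC; congr (_ - _).
apply: (tonelli (f := fun z => maxe 0 (L%:E - f z))) => //.
- by apply: measurable_maxe => //; exact: emeasurable_funB.
- by move=> z; rewrite le_max lexx.
Qed.

End ub_tonelli.

Section measure_operations.
Local Open Scope ereal_scope.
Context d (T : measurableType d) (R : realType).
Implicit Types (f : T -> \bar R) (m : {measure set T -> \bar R}).

Lemma integral_msum_ub (m_ : {measure set T -> \bar R}^nat) n f :
  measurable_fun setT f -> (forall k, (k < n)%N -> ubi (m_ k) f) ->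
  ubi (msum m_ n) f /\ \int[msum m_ n]_x f x = \sum_(k < n) \int[m_ k]_x f x.
Proof.
move=> mf H.
have mfp := measurable_funepos mf; have mfn := measurable_funeneg mf.
split.
  split=> //; rewrite ge0_integral_measure_sum//.
  by apply: lte_sum_pinfty => k _; exact: (H k (ltn_ord k)).2.
rewrite integralE !ge0_integral_measure_sum//.
under [RHS]eq_bigr do rewrite integralE.
rewrite [RHS]big_split/= sumeN// => i j _ _.
by rewrite ge0_adde_def// inE integral_ge0.
Qed.

Lemma integral_mscale_gen (k : {nonneg R}) m f : measurable_fun setT f ->
  \int[mscale k m]_x f x = k%:num%:E * \int[m]_x f x.
Proof.
move=> mf; have mp := measurable_funepos mf; have mn := measurable_funeneg mf.
rewrite [LHS]integralE (integralE m _ f) !ge0_integral_mscale//.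
have [->|k0] := eqVneq k%:num 0%R; first by rewrite !mul0e sube0.
have {}k0 : (0 < k%:num)%R by rewrite lt_neqAle eq_sym k0/=.
have := integral_ge0 (D := setT) m (f := f^\+) (fun x _ => funepos_ge0 _ x).
have := integral_ge0 (D := setT) m (f := f^\-) (fun x _ => funeneg_ge0 _ x).
move: (integral _ _ f^\+) (integral _ _ f^\-) => [a| |] [b| |]// _ _.
all: try by rewrite ?gt0_muley ?lte_fin//= ?gt0_muleNy ?lte_fin.
by rewrite muleBr.
Qed.

Lemma integral_madd_ge0 (m1 m2 : {measure set T -> \bar R}) (a b : {nonneg R}) f :
  measurable_fun setT f -> (forall x, 0 <= f x) ->
  \int[measure_add (mscale a m1) (mscale b m2)]_x f x =
  a%:num%:E * \int[m1]_x f x + b%:num%:E * \int[m2]_x f x.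
Proof.
by move=> mf f0; rewrite ge0_integral_measure_add// !ge0_integral_mscale.
Qed.

Lemma integral_mrestr (m : {measure set T -> \bar R}) (D : set T) (mD : measurable D) f :
  measurable_fun setT f -> (forall x, 0 <= f x) ->
  \int[mrestr m mD]_x f x = \int[m]_(x in D) f x.
Proof.
move=> mf f0.
have : mrestr m mD (~` D) = 0 by rewrite /mrestr setICl measure0.
move=> D0; rewrite -(setUv D) ge0_integral_setU//; first last.
- by rewrite /disj_set setICr.
- by rewrite setUv.
- exact: measurableC.
rewrite [X in _ + X](_ : _ = 0) ?adde0.
  apply: eq_measure_integral => A mA AD; rewrite /mrestr; congr (m _).
  exact/setIidl.
apply: null_set_integral => //; first exact: measurableC.
exact: measurable_funTS.
Qed.

End measure_operations.

(** * Logarithmic potentials *)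

Section kernel.
Context {R : realType}.
Local Notation cpt := (R * R)%type.
Implicit Types (z t w : cpt) (d e r B : R) (nu mu : @cmeasure R).

Lemma elogE (x : R) : 0 < x -> elog x = (ln x)%:E.
Proof. by move=> x0; rewrite /elog gt_eqF. Qed.

Lemma elog0 : elog 0 = -oo%E :> \bar R.
Proof. by rewrite /elog eqxx. Qed.

Lemma le_elog (x y : R) : 0 <= x -> x <= y -> (elog x <= elog y)%E.
Proof.
rewrite le_eqVlt => /predU1P[<- _|x0 xy]; first by rewrite elog0 leNye.
by rewrite !elogE ?(lt_le_trans x0)// lee_fin ler_ln ?posrE ?(lt_le_trans x0).
Qed.

Lemma elogM (x y : R) : 0 <= x -> 0 <= y -> elog (x * y) = (elog x + elog y)%E.
Proof.
rewrite le_eqVlt => /predU1P[<- _|x0].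
  by rewrite mul0r elog0 addNye.
rewrite le_eqVlt => /predU1P[<-|y0]; first by rewrite mulr0 elog0 addeNy.
by rewrite !elogE ?mulr_gt0// lnM.
Qed.

(* [- ln |z - t|], truncated at [B] and shifted so as to be nonnegative; a positive [d]
   removes the singularity, [rho d z t] being the distance to a point at height [d]. *)
Definition logker B d z t : \bar R := ((ln B)%:E - elog (Num.min (rho d z t) B))%E.

Lemma logker_ge0 B d z t : 0 < B -> (0 <= logker B d z t)%E.
Proof.
move=> B0; rewrite /logker sube_ge0 -?elogE// ?le_elog ?ge_min ?lexx ?orbT//.
  by rewrite le_min rho_ge0 ltW.
by rewrite (elogE B0) orbT.
Qed.

Lemma logkerC B d z t : logker B d z t = logker B d t z.
Proof. by rewrite /logker rhoC. Qed.

Lemma logkerE B d z t : 0 < rho d z t -> rho d z t <= B ->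
  logker B d z t = (ln B - ln (rho d z t))%:E.
Proof. by move=> r0 rB; rewrite /logker min_l// elogE. Qed.

Lemma measurable_logker B d : measurable_fun setT (fun x : cpt * cpt => logker B d x.1 x.2).
Proof.
apply: emeasurable_funB => //.
apply: (measurableT_comp measurable_elog).
by apply: measurable_minr => //; exact: measurable_rho.
Qed.

Lemma measurable_logkerl B d z : measurable_fun setT (logker B d z).
Proof.
apply: emeasurable_funB => //; apply: (measurableT_comp measurable_elog).
apply: measurable_minr => //; apply: continuous_measurable2.
by apply: (@lip_continuous _ _ 1) => w t; rewrite mul1r !(rhoC d z) addrC cdistC rho_triangle.
Qed.

End kernel.

(* Locked: unification would otherwise unfold the integral. *)
HB.lock Definition logpot {R : realType} (B d : R) (nu : @cmeasure R) (z : R * R) : \bar R :=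
  (\int[nu]_t logker B d z t)%E.

Section logpot.
Context {R : realType}.
Local Notation cpt := (R * R)%type.
Implicit Types (z t w : cpt) (d e r B : R) (nu mu : @cmeasure R).

Lemma logpotE B d nu z : logpot B d nu z = (\int[nu]_t logker B d z t)%E.
Proof. by rewrite logpot.unlock. Qed.

Lemma logpot_ge0 B d nu z : 0 < B -> (0 <= logpot B d nu z)%E.
Proof. by move=> B0; rewrite logpotE; apply: integral_ge0 => t _; exact: logker_ge0. Qed.

Lemma measurable_logpot B d nu : 0 < B -> (nu setT < +oo)%E ->
  measurable_fun setT (logpot B d nu).
Proof.
move=> B0 nuT; rewrite (_ : logpot B d nu = fun z => (\int[nu]_t logker B d z t)%E).
  apply: (measurable_integral_ge0 (measurable_logker B d) nuT) => z.
  exact: logker_ge0.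
by apply/funext => z; rewrite logpotE.
Qed.

Lemma logpot_sym B d nu mu : 0 < B -> (nu setT < +oo)%E -> (mu setT < +oo)%E ->
  (\int[mu]_z logpot B d nu z = \int[nu]_z logpot B d mu z)%E.
Proof.
move=> B0 nuT muT.
under eq_integral do rewrite logpotE; under [RHS]eq_integral do rewrite logpotE.
rewrite (tonelli (measurable_logker B d) muT nuT) => [|z]; last exact: logker_ge0.
by apply: eq_integral => z _; apply: eq_integral => t _; rewrite logkerC.
Qed.

Lemma measurable_log_cdist z : measurable_fun setT (fun t => elog (cdist z t)).
Proof.
apply: (measurableT_comp measurable_elog).
by apply: continuous_measurable2; exact: cdist_continuousr.
Qed.

(** The bridge between potentials, of variable sign, and the nonnegative [logpot]: on the carrier
    all distances to [z] are at most [B], so the truncation is inactive. *)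
Lemma potentialE B nu (K : set cpt) z : 0 < B -> (nu setT < +oo)%E ->
  measurable K -> nu (~` K) = 0%E -> (forall t, K t -> cdist z t <= B) ->
  potential nu z = ((ln B)%:E * nu setT - logpot B 0 nu z)%E.
Proof.
move=> B0 nuT mK nuK zB.
rewrite /potential (@integral_ubE _ _ _ _ (ln B))//; first last.
- apply: (ae_of_null mK nuK) => t Kt.
  by rewrite -(elogE B0) le_elog ?cdist_ge0// zB.
- exact: measurable_log_cdist.
rewrite logpotE; congr (_ - _)%E; apply: ae_eq_integral => //.
- apply: measurable_maxe => //; apply: emeasurable_funB => //.
  exact: measurable_log_cdist.
- exact: measurable_logkerl.
- apply: (ae_of_null mK nuK) => t Kt _; rewrite /logker rho0 min_l ?zB// max_r//.
  by rewrite sube_ge0 ?orbT// -(elogE B0) le_elog ?cdist_ge0// zB.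
Qed.

End logpot.

(** * Regularization at positive height, and its limit at height zero *)

Section regularization.
Context {R : realType}.
Local Notation cpt := (R * R)%type.
Implicit Types (z t w : cpt) (d e r B : R) (nu mu : @cmeasure R).

(** From ln (1 + u) <= u with u = c / x. It is the source of the Lipschitz estimates for logarithms
    below, [d] being a lower bound for the distances involved. *)
Lemma ln_addr_le (x c d : R) : 0 < d -> d <= x -> 0 <= c -> ln (x + c) <= ln x + c / d.
Proof.
move=> d0 dx c0; have x0 : 0 < x by exact: lt_le_trans dx.
have -> : x + c = x * (1 + c / x) by rewrite mulrDr mulr1 mulrCA divff ?mulr1// gt_eqF.
have cx : 0 <= c / x by rewrite divr_ge0// ltW.
rewrite lnM ?posrE ?ltr_pwDl// lerD2l (le_trans (le_ln1Dx _))//.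
  by rewrite (lt_le_trans _ cx)// ltrN10.
by rewrite ler_wpM2l// lef_pV2// posrE.
Qed.

Lemma logker_fin B d z t : 0 < d -> 0 < B ->
  logker B d z t = (ln B - ln (Num.min (rho d z t) B))%:E.
Proof.
move=> d0 B0; rewrite /logker elogE ?EFinB// lt_min B0 andbT.
exact: lt_le_trans (rho_ge _ _ _).
Qed.

Lemma logker_le B d z t : 0 < d -> d <= B -> (logker B d z t <= (ln B - ln d)%:E)%E.
Proof.
move=> d0 dB; have B0 := lt_le_trans d0 dB.
rewrite logker_fin// lee_fin lerD2l lerN2 ler_ln ?posrE// ?lt_min ?le_min ?rho_ge ?dB ?B0 ?andbT//.
exact: lt_le_trans (rho_ge _ _ _).
Qed.

(** The logarithm is Lipschitz with constant 1 / d on arguments at least [d]; the condition [d <= B]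
    keeps the truncated distance in that range. *)
Lemma logker_lip B d z w t : 0 < d -> d <= B ->
  (logker B d w t <= logker B d z t + (cdist z w / d)%:E)%E.
Proof.
move=> d0 dB; have B0 := lt_le_trans d0 dB.
rewrite !logker_fin// -EFinD lee_fin -addrA lerD2l lerNl opprD opprK lerBlDr.
set x := Num.min (rho d w t) B; set y := Num.min (rho d z t) B.
have dx : d <= x by rewrite le_min rho_ge.
have dy : d <= y by rewrite le_min rho_ge.
apply: (@le_trans _ _ (ln (x + cdist z w))); last by rewrite ln_addr_le ?cdist_ge0.
rewrite ler_ln ?posrE ?(lt_le_trans d0)//; last by rewrite (le_trans dx)// lerDl cdist_ge0.
rewrite /x addr_minl le_min /y !ge_min lerDl cdist_ge0 orbT andbT.
by rewrite addrC rho_triangle.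
Qed.

Lemma logpot_fin_num B d nu z : 0 < d -> d <= B -> (nu setT < +oo)%E ->
  logpot B d nu z \is a fin_num.
Proof.
move=> d0 dB nuT; have B0 := lt_le_trans d0 dB.
rewrite ge0_fin_numE ?logpot_ge0// logpotE.
apply: (@le_lt_trans _ _ (\int[nu]_t (ln B - ln d)%:E)%E).
  apply: ge0_le_integral => //.
  - by move=> t _; exact: logker_ge0.
  - exact: measurable_logkerl.
  - by move=> t _; exact: logker_le.
rewrite integral_cst// lte_mul_pinfty// lee_fin subr_ge0 ler_ln// posrE//.
Qed.

Lemma logpot_lip B d nu z w : 0 < d -> d <= B -> (nu setT < +oo)%E ->
  (logpot B d nu w <= logpot B d nu z + (cdist z w / d)%:E * nu setT)%E.
Proof.
move=> d0 dB nuT; have B0 := lt_le_trans d0 dB.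
have c0 : 0 <= cdist z w / d by rewrite divr_ge0 ?cdist_ge0 ?ltW.
rewrite !logpotE -(integral_cst nu measurableT) -ge0_integralD//; first last.
- exact: measurable_logkerl.
- by move=> t _; exact: logker_ge0.
apply: ge0_le_integral => //.
- by move=> t _; exact: logker_ge0.
- exact: measurable_logkerl.
- by apply: emeasurable_funD => //; exact: measurable_logkerl.
- by move=> t _; exact: logker_lip.
Qed.

Lemma logpot_continuous B d nu : 0 < d -> d <= B -> (nu setT < +oo)%E ->
  continuous (fun z => fine (logpot B d nu z)).
Proof.
move=> d0 dB nuT.
have nuf : nu setT \is a fin_num by rewrite ge0_fin_numE.
apply: (@lip_continuous _ _ (fine (nu setT) / d)) => z w.
rewrite -lee_fin EFinD fineK ?logpot_fin_num//.
apply: le_trans (logpot_lip z w d0 dB nuT) _.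
rewrite fineK ?logpot_fin_num// -(fineK nuf) -EFinM.
by rewrite leeD2l// lee_fin/= mulrC mulrA mulrAC.
Qed.

Definition dseq (n : nat) : R := n.+1%:R^-1.

Lemma dseq_gt0 n : 0 < dseq n. Proof. by rewrite invr_gt0. Qed.

Lemma dseq_le1 n : dseq n <= 1.
Proof. by rewrite invf_le1// ler1n. Qed.

Lemma dseq_dec m n : (m <= n)%N -> dseq n <= dseq m.
Proof. by move=> mn; rewrite lef_pV2 ?posrE// ler_nat ltnS. Qed.

Lemma dseq_small e : 0 < e -> exists n, dseq n < e.
Proof.
move=> e0; have [N _ /(_ N (leqnn N)) /=] := near_infty_natSinv_lt (PosNum e0).
by exists N.
Qed.

Lemma logker_dec B d e z t : 0 <= d -> d <= e -> 0 < B -> (logker B e z t <= logker B d z t)%E.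
Proof.
move=> d0 de B0; apply: leeB => //; apply: le_elog.
  by rewrite le_min rho_ge0 ltW.
by rewrite le_min !ge_min le_rho// lexx orbT.
Qed.

Lemma logpot_dec B d e nu z : 0 <= d -> d <= e -> 0 < B ->
  (logpot B e nu z <= logpot B d nu z)%E.
Proof.
move=> d0 de B0; rewrite !logpotE; apply: ge0_le_integral => //.
- by move=> t _; exact: logker_ge0.
- exact: measurable_logkerl.
- exact: measurable_logkerl.
- by move=> t _; exact: logker_dec.
Qed.

Lemma rho_add d z t : 0 <= d -> rho d z t <= rho 0 z t + d.
Proof.
move=> d0; have r0 := rho_ge0 0 z t.
rewrite -[leRHS]ger0_norm ?addr_ge0// -sqrtr_sqr ler_wsqrtr//.
rewrite (sqrrD (rho _ _ _)) rho_sqr expr0n/= addr0 lerD2r lerDl.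
by rewrite mulrn_wge0// mulr_ge0.
Qed.

(** Together with the monotonicity in [logker_dec], this says that the singular kernel is the
    supremum of the regularized ones, also at [z = t] where it is [+oo]. *)
Lemma logker_sup B z t (M : R) : 0 < B -> (M%:E < logker B 0 z t)%E ->
  exists n, (M%:E < logker B (dseq n) z t)%E.
Proof.
move=> B0; have [r0|] := ltP 0 (rho 0 z t); last first.
  move=> r0 _; have {r0}r0 : rho 0 z t = 0 by apply/eqP; rewrite eq_le r0 rho_ge0.
  (* At [z = t] the regularized distance is the height itself, and a height below exp (ln B - M)
     lifts the kernel above [M]. *)
  have [n ne] := dseq_small (expR_gt0 (ln B - M)).
  have d0 := dseq_gt0 n.
  exists n; rewrite logker_fin// lte_fin ltrBrDl -ltrBrDr.
  rewrite -[ltRHS]expRK ltr_ln ?posrE ?expR_gt0// ?lt_min ?B0 ?(lt_le_trans d0 (rho_ge _ _ _))//.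
  rewrite gt_min; apply/orP; left; apply: le_lt_trans ne.
  have := rho_sqr 0 z t; rewrite r0 expr0n/= addr0 => /esym/eqP.
  rewrite paddr_eq0 ?sqr_ge0// => /andP[/eqP E1 /eqP E2].
  by rewrite /rho E1 E2 !add0r sqrtr_sqr gtr0_norm.
set x := Num.min (rho 0 z t) B.
have x0 : 0 < x by rewrite lt_min r0.
rewrite /logker elogE// -/x -EFinB lte_fin => ML.
have e0 : 0 < x * (ln B - ln x - M) by rewrite mulr_gt0// subr_gt0.
have [n ne] := dseq_small e0; have d0 := dseq_gt0 n.
exists n; rewrite -/(logker _ _ _ _) logker_fin// lte_fin ltrBrDl -ltrBrDr.
apply: (@le_lt_trans _ _ (ln (x + dseq n))).
  rewrite ler_ln ?posrE ?addr_gt0 ?lt_min ?B0 ?(lt_le_trans d0 (rho_ge _ _ _))//.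
  rewrite /x addr_minl le_min !ge_min lerDl (ltW d0) orbT andbT.
    by rewrite rho_add// ltW.
  by rewrite r0.
apply: (le_lt_trans (@ln_addr_le x (dseq n) x x0 (lexx _) (ltW d0))).
by rewrite -ltrBrDl ltr_pdivrMr// (lt_le_trans ne)// mulrC ler_wpM2r ?(ltW x0)//; lra.
Qed.

(** Monotone convergence: a bound that is uniform in the height survives at height zero. The
    supremum is described by its approximation property, the form in which [logker_sup] delivers
    it. *)
Lemma integral_sup_le disp (T : measurableType disp) (nu : {measure set T -> \bar R})
    (f_ : nat -> T -> \bar R) (f : T -> \bar R) (w : R) :
  (forall n, measurable_fun setT (f_ n)) -> (forall n x, 0 <= f_ n x)%E ->
  (forall x, {homo f_ ^~ x : m n / (m <= n)%N >-> (m <= n)%E}) ->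
  (forall n x, f_ n x <= f x)%E ->
  (forall x (M : R), (M%:E < f x)%E -> exists n, (M%:E < f_ n x)%E) ->
  (forall n, \int[nu]_x f_ n x <= w%:E)%E -> (\int[nu]_x f x <= w%:E)%E.
Proof.
move=> mf f0 nd le_f sup_f H.
have cvgk x : f_ n x @[n --> \oo] --> f x.
  have := ereal_nondecreasing_cvgn (nd x).
  rewrite (_ : ereal_sup _ = f x)//; apply/eqP; rewrite eq_le; apply/andP; split.
    by apply: ge_ereal_sup => _ [n _ <-].
  rewrite leNgt; apply/negP => lt_sup.
  move: lt_sup; set S := ereal_sup _ => lt_sup.
  have S_ge n : (f_ n x <= S)%E by apply: ereal_sup_ubound; exists n.
  have S0 : (0 <= S)%E by exact: le_trans (S_ge 0%N).
  move: S S0 S_ge lt_sup => [M| |]//= _ S_ge lt_sup.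
    by have [n] := sup_f _ _ lt_sup; rewrite ltNge S_ge.
  by rewrite ltNge leey in lt_sup.
have := @cvg_monotone_convergence _ _ _ nu _ measurableT f_ mf (fun n x _ => f0 n x) (fun x _ => nd x).
move=> cv.
have E : (\int[nu]_x limn (fun n => f_ n x) = \int[nu]_x f x)%E.
  by apply: eq_integral => x _; apply/cvg_lim => //; exact: cvgk.
rewrite -E -(cvg_lim _ cv)//; apply: lime_le; last exact: nearW.
by apply/cvg_ex; eexists; exact: cv.
Qed.

Lemma logpot_sup B nu z (w : R) : 0 < B -> (forall n, logpot B (dseq n) nu z <= w%:E)%E ->
  (logpot B 0 nu z <= w%:E)%E.
Proof.
move=> B0 H; rewrite logpotE; apply: (@integral_sup_le _ _ nu (fun n => logker B (dseq n) z)).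
- by move=> n; exact: measurable_logkerl.
- by move=> n t; exact: logker_ge0.
- by move=> t m n mn; apply: logker_dec => //; [exact: ltW (dseq_gt0 _)|exact: dseq_dec].
- by move=> n t; apply: logker_dec => //; exact: ltW (dseq_gt0 _).
- by move=> t M; exact: logker_sup.
- by move=> n; rewrite -logpotE.
Qed.

Lemma logpot_energy_le B (sg : @cmeasure R) (w : R) : 0 < B -> (sg setT < +oo)%E ->
  (forall n, \int[sg]_z logpot B (dseq n) sg z <= w%:E)%E ->
  (\int[sg]_z logpot B 0 sg z <= w%:E)%E.
Proof.
move=> B0 sgT; apply: (@integral_sup_le _ _ sg (fun n => logpot B (dseq n) sg)).
- by move=> n; exact: measurable_logpot.
- by move=> n t; exact: logpot_ge0.
- by move=> t m n mn; apply: logpot_dec => //; [exact: ltW (dseq_gt0 _)|exact: dseq_dec].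
- by move=> n t; apply: logpot_dec => //; exact: ltW (dseq_gt0 _).
- move=> t M; apply: contraPP => /forallNP H; apply/negP; rewrite -leNgt.
  by apply: logpot_sup => // n; rewrite leNgt; apply/negP; exact: H.
Qed.

(** Lower semicontinuity at height zero: a supremum of continuous functions has sublevel sets that
    are intersections of closed ones. The compactness of [eqset] and of the exceptional set of the
    sharpness part rests on it. *)
Lemma logpot_le_closed B nu (w : R) : 1 <= B -> (nu setT < +oo)%E ->
  closed [set z | (logpot B 0 nu z <= w%:E)%E].
Proof.
move=> B1 nuT; have B0 := lt_le_trans ltr01 B1.
have dB n : dseq n <= B := le_trans (dseq_le1 n) B1.
have fin n z := logpot_fin_num z (dseq_gt0 n) (dB n) nuT.
rewrite (_ : [set z | _] = \bigcap_n [set z | fine (logpot B (dseq n) nu z) <= w]).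
  apply: closed_bigI => n _.
  exact: closed_ler (logpot_continuous (dseq_gt0 n) (dB n) nuT).
apply/seteqP; split=> z /=.
  move=> zw n _ /=; rewrite -lee_fin fineK//; apply: le_trans zw.
  by apply: logpot_dec => //; exact: ltW (dseq_gt0 _).
by move=> H; apply: logpot_sup => // n; rewrite -(fineK (fin n z)) lee_fin; exact: H.
Qed.

End regularization.

(** * Frostman's variational argument for the minimizer of the energy *)

Section variational.
Context {R : realType}.
Local Notation cpt := (R * R)%type.
Implicit Types (z t w : cpt) (B : R) (nu mu sigma : @cmeasure R).

Definition cmix (a b : {nonneg R}) (m1 m2 : @cmeasure R) : @cmeasure R :=
  measure_add (mscale a m1) (mscale b m2).

Lemma cmixE a b (m1 m2 : @cmeasure R) A :
  cmix a b m1 m2 A = (a%:num%:E * m1 A + b%:num%:E * m2 A)%E.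
Proof. exact: measure_addE. Qed.

Definition srestr (a : {nonneg R}) (m : @cmeasure R) (D : set cpt) (mD : measurable D) :
  @cmeasure R := mscale a (mrestr m mD).

Lemma srestrE a (m : @cmeasure R) (D : set cpt) (mD : measurable D) A :
  srestr a m mD A = (a%:num%:E * m (A `&` D))%E.
Proof. by []. Qed.

Lemma prob_on_lty (E : set cpt) mu : prob_on E mu -> (mu setT < +oo)%E.
Proof. by move=> [-> _]; rewrite ltry. Qed.

Lemma measurable_potential nu : (nu setT < +oo)%E -> measurable_fun setT (potential nu).
Proof.
move=> nuT.
apply: (measurable_integral2 (f := fun x : cpt * cpt => elog (cdist x.1 x.2))) => //.
apply: (measurableT_comp measurable_elog).
rewrite (_ : (fun x => _) = (fun x : cpt * cpt => rho 0 x.1 x.2)); first exact: measurable_rho.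
by apply/funext => x; rewrite rho0.
Qed.

Lemma energyE B (E : set cpt) mu : compact E -> 0 < B ->
  (forall z t, E z -> E t -> cdist z t <= B) -> prob_on E mu ->
  energy mu = (\int[mu]_z logpot B 0 mu z - (ln B)%:E)%E.
Proof.
move=> cE B0 EB pmu; have muT := prob_on_lty pmu; case: pmu => mu1 muE.
have mE := compact_measurable2 cE.
have potE z : E z -> potential mu z = ((ln B)%:E - logpot B 0 mu z)%E.
  by move=> Ez; rewrite (potentialE B0 muT mE muE) ?mu1 ?mule1// => t; exact: EB.
have pot_le : {ae mu, forall z, (potential mu z <= (ln B)%:E)%E}.
  apply: (ae_of_null mE muE) => z Ez; rewrite potE//.
  by rewrite -[leRHS]sube0 leeB// logpot_ge0.
have mp := measurable_potential muT.
have [_ up] := ubi_bnd muT mp pot_le.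
rewrite /energy integralN; last first.
  rewrite fin_num_adde_defr// ge0_fin_numE// integral_ge0//.
rewrite (integral_ubE muT mp pot_le) mu1 mule1.
rewrite oppeB ?fin_num_adde_defr// addeC; congr (_ + _)%E; apply: ae_eq_integral => //.
- by apply: measurable_maxe => //; exact: emeasurable_funB.
- exact: measurable_logpot.
- apply: (ae_of_null mE muE) => z Ez _; rewrite potE// max_r.
    by rewrite oppeB ?fin_num_adde_defr// addeA subee// add0e.
  rewrite oppeB ?fin_num_adde_defr// addeA subee// add0e.
  exact: logpot_ge0.
Qed.

Variables (E : set cpt) (mu : @cmeasure R) (B w : R).
Hypothesis B1 : 1 <= B.
Hypothesis cE : compact E.
Hypothesis pmu : prob_on E mu.
Hypothesis Imu : (\int[mu]_z logpot B 0 mu z)%E = w%:E.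
Hypothesis mumin : forall sigma, prob_on E sigma ->
  (w%:E <= \int[sigma]_z logpot B 0 sigma z)%E.

Let B0 : 0 < B := lt_le_trans ltr01 B1.
Let muT : (mu setT < +oo)%E := prob_on_lty pmu.

(** First variation. The energy of (1 - t) mu + t sigma is quadratic in t with slope 2 (x - w) at 0,
    where x is the mutual energy; if x < w, it would drop below the minimum [w]. The finite energy y
    of [sigma] keeps the coefficient of t^2 finite. *)
Lemma variational sigma : prob_on E sigma ->
  (\int[sigma]_z logpot B 0 sigma z < +oo)%E ->
  (w%:E <= \int[sigma]_z logpot B 0 mu z)%E.
Proof.
move=> ps Is; have sT := prob_on_lty ps.
rewrite leNgt; apply/negP => lt_w.
have : (0 <= \int[sigma]_z logpot B 0 mu z)%E.
  by apply: integral_ge0 => z _; exact: logpot_ge0.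
have : (0 <= \int[sigma]_z logpot B 0 sigma z)%E.
  by apply: integral_ge0 => z _; exact: logpot_ge0.
move: lt_w Is.
case Ex : (integral sigma _ _) => [x| |]//; case Ey : (integral sigma _ _) => [y| |]//.
rewrite lte_fin => lt_w _; rewrite !lee_fin => y0 x0.
(* The energy changes by t (t (w - 2x + y) - 2 (w - x)). The denominator exceeds both w - x and w -
   2x + y, so t < 1 and t (w - 2x + y) <= w - x. *)
pose t := (w - x) / ((w - x) + w + y + 1).
have D0 : 0 < (w - x) + w + y + 1 by lra.
have t0 : 0 <= t by rewrite divr_ge0//; lra.
have t1 : 0 <= 1 - t by rewrite subr_ge0 ler_pdivrMr//; lra.
pose tau := cmix (NngNum t1) (NngNum t0) mu sigma.
have ptau : prob_on E tau.
  case: pmu ps => [mu1 muE] [s1 sE]; split.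
    rewrite cmixE/= mu1 s1 !mule1 -EFinD.
    by congr EFin; rewrite subrK.
  by rewrite cmixE muE sE !mule0 adde0.
have mk := measurable_logkerl B 0.
have E1 z : logpot B 0 tau z =
    ((1 - t)%:E * logpot B 0 mu z + t%:E * logpot B 0 sigma z)%E.
  by rewrite !logpotE integral_madd_ge0// => u; exact: logker_ge0.
have mm := measurable_logpot 0 B0 muT; have ms := measurable_logpot 0 B0 sT.
have := mumin ptau.
under eq_integral do rewrite E1.
have I2 (m : @cmeasure R) : (\int[m]_z ((1 - t)%:E * logpot B 0 mu z + t%:E * logpot B 0 sigma z) =
  (1 - t)%:E * \int[m]_z logpot B 0 mu z + t%:E * \int[m]_z logpot B 0 sigma z)%E.
  rewrite ge0_integralD//.
  - by rewrite !ge0_integralZl// ?lee_fin// => z _; exact: logpot_ge0.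
  - by move=> z _; rewrite mule_ge0 ?lee_fin ?logpot_ge0.
  - exact: measurable_funeM.
  - by move=> z _; rewrite mule_ge0 ?lee_fin ?logpot_ge0.
  - exact: measurable_funeM.
rewrite integral_madd_ge0; first last.
- by move=> z; rewrite adde_ge0// mule_ge0 ?lee_fin ?logpot_ge0.
- by apply: emeasurable_funD; exact: measurable_funeM.
rewrite /= !I2 Imu Ex Ey (logpot_sym 0 B0 sT muT) Ex.
change ((w%:E <= ((1 - t) * ((1 - t) * w + t * x) + t * ((1 - t) * x + t * y))%:E)%E -> False).
rewrite lee_fin; apply/negP; rewrite -ltNge.
have tD : t * ((w - x) + w + y + 1) = w - x by rewrite /t divfK// gt_eqF.
have tt : 0 < t by rewrite divr_gt0//; lra.
nra.
Qed.

(** Normalized, the restriction of [mu] to the complement of the set still has finite energy, so by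
    [variational] the mean of [logpot B 0 mu] there is at least [w]. On the set it is at least
    [w + e]; the total mean [w] then leaves no mass for the set. *)
Lemma logpot_le_ae (e : R) : 0 < e -> mu [set z | ((w + e)%:E <= logpot B 0 mu z)%E] = 0%E.
Proof.
move=> e0; set A := [set z | _].
have mm := measurable_logpot 0 B0 muT.
have lp0 z : (0 <= logpot B 0 mu z)%E by exact: logpot_ge0.
have mA : measurable A by rewrite -[A]setTI; exact: emeasurable_fun_c_infty.
have mCA := measurableC mA.
case: pmu => mu1 muE.
have muA_fin : mu A \is a fin_num by rewrite ge0_fin_numE// (le_lt_trans (le_measure _ _ _ _) muT) ?inE//.
have muCA_fin : mu (~` A) \is a fin_num by rewrite ge0_fin_numE// (le_lt_trans (le_measure _ _ _ _) muT) ?inE//.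
have split1 : (mu A + mu (~` A) = 1)%E.
  by rewrite -measureU// ?setUv// setICr.
have split2 : (\int[mu]_(z in A) logpot B 0 mu z + \int[mu]_(z in ~` A) logpot B 0 mu z = w%:E)%E.
  rewrite -Imu -ge0_integral_setU ?setUv//.
  by rewrite /disj_set setICr.
have geA : ((w + e)%:E * mu A <= \int[mu]_(z in A) logpot B 0 mu z)%E.
  rewrite -integral_cst//; apply: ge0_le_integral => //.
  - move=> z _; rewrite lee_fin addr_ge0 ?(ltW e0)// -lee_fin -Imu.
    exact: integral_ge0.
  - exact: measurable_funTS.
have geC : (w%:E * mu (~` A) <= \int[mu]_(z in ~` A) logpot B 0 mu z)%E.
  have [->|C0] := eqVneq (mu (~` A)) 0%E; first by rewrite mule0 integral_ge0.
  have c0 : 0 < fine (mu (~` A)) by rewrite fine_gt0// lt0e C0 measure_ge0/= -ge0_fin_numE.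
  have ci0 : 0 <= (fine (mu (~` A)))^-1 by rewrite invr_ge0 ltW.
  pose sigma := srestr (NngNum ci0) mu mCA.
  have ps : prob_on E sigma.
    split.
      by rewrite srestrE/= setTI -[X in (_ * X)%E]fineK// -EFinM mulVf// gt_eqF.
    rewrite srestrE (_ : mu (~` E `&` ~` A) = 0%E) ?mule0//.
    apply/eqP; rewrite eq_le measure_ge0 andbT -muE le_measure ?inE//.
      by apply: measurableI => //; apply: measurableC; exact: compact_measurable2.
    by apply: measurableC; exact: compact_measurable2.
  have Is f : measurable_fun setT f -> (forall z, (0 <= f z)%E) ->
      (\int[sigma]_z f z = ((fine (mu (~` A)))^-1)%:E * \int[mu]_(z in ~` A) f z)%E.
    by move=> mf f0; rewrite ge0_integral_mscale// integral_mrestr.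
  have le_pot z : (logpot B 0 sigma z <= ((fine (mu (~` A)))^-1)%:E * logpot B 0 mu z)%E.
    rewrite !logpotE Is; [|exact: measurable_logkerl|by move=> t; exact: logker_ge0].
    rewrite lee_wpmul2l// ?lee_fin//; apply: ge0_subset_integral => //.
      exact: measurable_logkerl.
    by move=> t _; exact: logker_ge0.
  have sT := prob_on_lty ps.
  have fin : (\int[sigma]_z logpot B 0 sigma z < +oo)%E.
    apply: (@le_lt_trans _ _ (\int[sigma]_z (((fine (mu (~` A)))^-1)%:E * logpot B 0 mu z))%E).
      apply: ge0_le_integral => //.
      - by move=> z _; exact: logpot_ge0.
      - exact: measurable_logpot.
      - exact: measurable_funeM.
    rewrite ge0_integralZl// ?lee_fin// lte_mul_pinfty ?lee_fin//.
    rewrite Is// lte_mul_pinfty ?lee_fin//.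
    apply: (@le_lt_trans _ _ w%:E); last by rewrite ltry.
    by rewrite -Imu; exact: ge0_subset_integral.
  have := variational ps fin; rewrite Is//.
  by rewrite muleC -lee_pdivrMr ?invr_gt0// invrK fineK.
apply/eqP; rewrite eq_le measure_ge0 andbT.
have := leeD geA geC; rewrite split2.
move: split1; rewrite -(fineK muA_fin) -(fineK muCA_fin) -EFinD => -[split1].
rewrite -!EFinM -EFinD !lee_fin => H.
have : e * fine (mu A) <= 0 by nra.
by rewrite pmulr_rle0.
Qed.

(* Plays the role of the support of [mu]. *)
Definition eqset : set cpt := E `&` [set z | (logpot B 0 mu z <= w%:E)%E].

Lemma eqset_compact : compact eqset.
Proof. by apply: compact_closedI => //; exact: logpot_le_closed. Qed.

Lemma eqset_null : mu (~` eqset) = 0%E.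
Proof.
case: (pmu) => mu1 muE.
have mC : measurable (~` E) by apply: measurableC; exact: compact_measurable2.
apply/negligibleP; first by apply: measurableC; apply: compact_measurable2; exact: eqset_compact.
apply: (@negligibleS _ _ _ _ (~` E `|` \bigcup_n [set z | ((w + dseq n)%:E <= logpot B 0 mu z)%E])).
  move=> z /= /not_andP[Ez|/negP]; [by left|rewrite -ltNge => lt_w; right].
  have : (0 <= logpot B 0 mu z)%E by exact: logpot_ge0.
  case Ez : (logpot B 0 mu z) lt_w => [y| |]// lt_w _; last by exists 0%N => //=; rewrite Ez leey.
  have [|n nw] := @dseq_small R (y - w); first by rewrite subr_gt0 -lte_fin.
  by exists n => //=; rewrite Ez lee_fin; lra.
apply: negligibleU; first by apply/negligibleP.
apply: negligible_bigcup => n; apply/negligibleP; last exact/logpot_le_ae/dseq_gt0.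
rewrite -[X in measurable X]setTI; apply: emeasurable_fun_c_infty => //.
exact: measurable_logpot.
Qed.

End variational.

(** * Maximum principle *)

Section four_points.
Context {R : realType}.
Local Notation cpt := (R * R)%type.
Implicit Types (z t w : cpt) (d r : R).

(* Four-point sums replace means over circles: since
   [\prod_k |w + r i^k| = |w^4 - r^4|], logarithms are harmonic up to [O(r^4)]. *)
Definition sum4 (f : cpt -> R) z r : R :=
  f (z.1 + r, z.2) + f (z.1 - r, z.2) + f (z.1, z.2 + r) + f (z.1, z.2 - r).

Lemma sum4D (f g : cpt -> R) z r : sum4 (fun x => f x + g x) z r = sum4 f z r + sum4 g z r.
Proof. by rewrite /sum4; ring. Qed.

Lemma ln_prod4 (a b c e : R) : 0 < a -> 0 < b -> 0 < c -> 0 < e ->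
  2 * (ln a + ln b + ln c + ln e) = ln (a ^+ 2 * b ^+ 2 * c ^+ 2 * e ^+ 2).
Proof.
move=> a0 b0 c0 e0; rewrite !lnM ?posrE ?mulr_gt0 ?exprn_gt0//.
by ring.
Qed.

Lemma lnM_ge (x : R) : 0 <= x -> x <= 2^-1 -> - (2 * x) <= ln (1 - x).
Proof.
move=> x0 x1; have h0 : 0 < 1 - x by lra.
rewrite lerNl -lnV ?posrE//.
have -> : (1 - x)^-1 = 1 + x / (1 - x).
  by field; rewrite gt_eqF.
rewrite (le_trans (le_ln1Dx _))//.
  by rewrite (lt_le_trans (ltrN10 _))// divr_ge0// ltW.
rewrite ler_pdivrMr//; nra.
Qed.

(** Subharmonicity of the regularized logarithm. With q the square of [rho d z t], the product of
    the four squared distances exceeds (q^2 - r^4)^2 by a sum of squares. As r <= d / 2 and d^2 <=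
    q, the ratio r^4 / q^2 is small enough for [lnM_ge]. *)
Lemma sum4_rho_ge d z t r : 0 < d -> 0 <= r -> r <= d / 2 ->
  4 * ln (rho d z t) - 2 * (r ^+ 4 / d ^+ 4) <= sum4 (fun x => ln (rho d x t)) z r.
Proof.
move=> d0 r0 rd.
have p0 x : 0 < rho d x t by exact: lt_le_trans (rho_ge _ _ _).
set q := rho d z t ^+ 2.
have dq : d ^+ 2 <= q by rewrite lerXn2r ?nnegrE ?rho_ge0 ?(ltW d0)// rho_ge.
have q0 : 0 < q by rewrite exprn_gt0.
have rq : r ^+ 4 <= q ^+ 2 / 16.
  have -> : r ^+ 4 = (r ^+ 2) ^+ 2 by rewrite -exprM.
  have : r ^+ 2 <= q / 4 by nra.
  have := sqr_ge0 r; move: (r ^+ 2) => y y0 yq; nra.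
have rq0 : 0 < q ^+ 2 - r ^+ 4 by have := exprn_gt0 2 q0; lra.
have key : (q ^+ 2 - r ^+ 4) ^+ 2 <= rho d (z.1 + r, z.2) t ^+ 2 * rho d (z.1 - r, z.2) t ^+ 2
    * rho d (z.1, z.2 + r) t ^+ 2 * rho d (z.1, z.2 - r) t ^+ 2.
  rewrite !rho_sqr/= /q rho_sqr.
  have -> : z.1 + r - t.1 = (z.1 - t.1) + r by ring.
  have -> : z.2 + r - t.2 = (z.2 - t.2) + r by ring.
  have -> : z.1 - r - t.1 = (z.1 - t.1) - r by ring.
  have -> : z.2 - r - t.2 = (z.2 - t.2) - r by ring.
  move: (z.1 - t.1) (z.2 - t.2) => x y.
  rewrite -subr_ge0.
  set p := x ^+ 2 + y ^+ 2 + d ^+ 2.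
  have -> : ((x + r) ^+ 2 + y ^+ 2 + d ^+ 2) * ((x - r) ^+ 2 + y ^+ 2 + d ^+ 2)
     * (x ^+ 2 + (y + r) ^+ 2 + d ^+ 2) * (x ^+ 2 + (y - r) ^+ 2 + d ^+ 2)
     - (p ^+ 2 - r ^+ 4) ^+ 2 =
     16 * (r ^+ 2 * x * y) ^+ 2 + 4 * (r * d * (p + r ^+ 2)) ^+ 2.
    by rewrite /p; ring.
  by rewrite addr_ge0// mulr_ge0// sqr_ge0.
have := ln_prod4 (p0 (z.1 + r, z.2)) (p0 (z.1 - r, z.2)) (p0 (z.1, z.2 + r)) (p0 (z.1, z.2 - r)).
rewrite -/(sum4 (fun x => ln (rho d x t)) z r).
move: key; set P := (X in _ <= X) => key E.
have : ln ((q ^+ 2 - r ^+ 4) ^+ 2) <= ln P.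
  by rewrite ler_ln ?posrE ?exprn_gt0// /P !mulr_gt0// exprn_gt0.
rewrite -E lnXn// -[in leLHS]mulr_natl ler_pM2l//; apply: le_trans.
have -> : q ^+ 2 - r ^+ 4 = q ^+ 2 * (1 - r ^+ 4 / q ^+ 2).
  by rewrite mulrBr mulr1 mulrCA divff ?mulr1// gt_eqF// exprn_gt0.
have x0 : 0 <= r ^+ 4 / q ^+ 2 by rewrite divr_ge0 ?exprn_ge0// ltW.
have x1 : r ^+ 4 / q ^+ 2 <= 2^-1.
  by rewrite ler_pdivrMr ?exprn_gt0//; have := exprn_gt0 2 q0; lra.
rewrite lnM ?posrE ?exprn_gt0//; last by lra.
have -> : ln (q ^+ 2) = 4 * ln (rho d z t) by rewrite /q -exprM lnXn// mulr_natl.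
rewrite lerD2l; apply: le_trans (lnM_ge x0 x1); rewrite lerN2 ler_pM2l//.
rewrite ler_wpM2l ?exprn_ge0// lef_pV2 ?posrE ?exprn_gt0//.
have -> : d ^+ 4 = (d ^+ 2) ^+ 2 by rewrite -exprM.
by rewrite lerXn2r ?nnegrE ?sqr_ge0 ?(ltW q0).
Qed.

(** The opposite estimate, without regularization but at distance at least [D] from the pole: the
    product of the four squared distances falls short of (q^2 + r^4)^2 by 4 (r^2 (x^2 - y^2))^2. *)
Lemma sum4_cdist_le (D : R) z t r : 0 <= r -> r < D -> D <= cdist z t ->
  sum4 (fun x => ln (cdist x t)) z r <= 4 * ln (cdist z t) + r ^+ 4 / D ^+ 4.
Proof.
move=> r0 rD Dz; have D0 : 0 < D by lra.
have c0 := lt_le_trans D0 Dz.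
have p0 x : cdist z x <= r -> 0 < cdist x t.
  by move=> zx; have := cdist_triangle z x t; lra.
have n1 (s : R) : `|s| <= r -> 0 < cdist (z.1 + s, z.2) t.
  move=> sr; apply: p0; rewrite /cdist/= subrr expr0n addr0/= opprD addrA subrr add0r.
  by rewrite sqrtr_sqr normrN.
have n2 (s : R) : `|s| <= r -> 0 < cdist (z.1, z.2 + s) t.
  move=> sr; apply: p0; rewrite /cdist/= subrr expr0n add0r/= opprD addrA subrr add0r.
  by rewrite sqrtr_sqr normrN.
have rr : `|r| <= r by rewrite ger0_norm.
have rNr : `|- r| <= r by rewrite normrN ger0_norm.
set q := cdist z t ^+ 2.
have Dq : D ^+ 2 <= q by rewrite lerXn2r ?nnegrE ?cdist_ge0 ?(ltW D0).
have q0 : 0 < q by rewrite exprn_gt0.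
have key : cdist (z.1 + r, z.2) t ^+ 2 * cdist (z.1 - r, z.2) t ^+ 2
    * cdist (z.1, z.2 + r) t ^+ 2 * cdist (z.1, z.2 - r) t ^+ 2 <= (q ^+ 2 + r ^+ 4) ^+ 2.
  rewrite !cdist_sqr/= /q cdist_sqr.
  have -> : z.1 + r - t.1 = (z.1 - t.1) + r by ring.
  have -> : z.2 + r - t.2 = (z.2 - t.2) + r by ring.
  have -> : z.1 - r - t.1 = (z.1 - t.1) - r by ring.
  have -> : z.2 - r - t.2 = (z.2 - t.2) - r by ring.
  move: (z.1 - t.1) (z.2 - t.2) => x y.
  rewrite -subr_ge0.
  have -> : ((x ^+ 2 + y ^+ 2) ^+ 2 + r ^+ 4) ^+ 2 -
     ((x + r) ^+ 2 + y ^+ 2) * ((x - r) ^+ 2 + y ^+ 2)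
     * (x ^+ 2 + (y + r) ^+ 2) * (x ^+ 2 + (y - r) ^+ 2) =
     4 * (r ^+ 2 * (x ^+ 2 - y ^+ 2)) ^+ 2 by ring.
  by rewrite mulr_ge0// sqr_ge0.
have := ln_prod4 (n1 r rr) (n1 (- r) rNr) (n2 r rr) (n2 (- r) rNr).
rewrite -/(sum4 (fun x => ln (cdist x t)) z r).
move: key; set P := (X in X <= _) => key E.
have qr0 : 0 < q ^+ 2 + r ^+ 4 by rewrite ltr_pwDl ?exprn_gt0 ?exprn_ge0.
have : ln P <= ln ((q ^+ 2 + r ^+ 4) ^+ 2).
  rewrite ler_ln ?posrE ?exprn_gt0//.
  have sq0 (x : R) : 0 < x -> 0 < x ^+ 2 by exact: exprn_gt0.
  apply: mulr_gt0; last exact: (sq0 _ (n2 _ rNr)).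
  apply: mulr_gt0; last exact: (sq0 _ (n2 _ rr)).
  apply: mulr_gt0; last exact: (sq0 _ (n1 _ rNr)).
  exact: (sq0 _ (n1 _ rr)).
rewrite -E lnXn// -[in leRHS]mulr_natl ler_pM2l// => /le_trans; apply.
have -> : 4 * ln (cdist z t) = ln (q ^+ 2) by rewrite /q -exprM lnXn// mulr_natl.
apply: le_trans (ln_addr_le (exprn_gt0 2 q0) (lexx _) (exprn_ge0 4 r0)) _.
rewrite lerD2l ler_wpM2l ?exprn_ge0// lef_pV2 ?posrE ?exprn_gt0//.
have -> : D ^+ 4 = (D ^+ 2) ^+ 2 by rewrite -exprM.
by rewrite lerXn2r ?nnegrE ?sqr_ge0 ?(ltW q0).
Qed.

End four_points.

Lemma off_dist {R : realType} (T : set (R * R)%type) z : compact T -> ~ T z ->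
  exists2 D : R, 0 < D & forall t, T t -> D <= cdist z t.
Proof.
move=> cT nTz; have : nbhs z (~` T).
  apply: open_nbhs_nbhs; split => //; apply: closed_openC.
  by apply: compact_closed cT; exact: cpt_hausdorff.
move=> /nbhs_disk[D D0 DT]; exists D => // t Tt; rewrite leNgt; apply/negP => zt.
exact: DT zt Tt.
Qed.

Section abstract_maximum_principle.
Context {R : realType}.
Local Notation cpt := (R * R)%type.
Implicit Types (z t : cpt) (d r : R).
Variables (T : set cpt) (Rr w : R) (v : cpt -> R).
Local Notation o := ((0, 0) : cpt).
Hypothesis cT : compact T.
Hypothesis vnear : forall z D, (forall t, T t -> D <= cdist z t) ->
  forall z', cdist o z <= Rr -> cdist o z' <= Rr -> cdist z z' <= D / 2 -> 0 < D ->
  `|v z - v z'| <= 2 * cdist z z' / D.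
Hypothesis vbd : forall z (k : R), T z -> 0 < k -> exists2 e, 0 < e &
  forall x, cdist z x < e -> cdist o x <= Rr -> ~ T x -> v x <= w + k.
Hypothesis v4 : forall z D r, cdist o z + r <= Rr -> (forall t, T t -> D <= cdist z t) ->
  0 < r -> r < D -> 4 * v z <= sum4 v z r + r ^+ 4 / D ^+ 4.

(** [v] stands for the singular potential off its carrier [T], and [u] is almost subharmonic. If
    [u + v] exceeded [s], adding a small multiple of |z|^2 would give a function with a maximum at
    an interior point off [T]. There the four-point sum of the added term gains 4 e r^2, which
    errors of order r^4 cannot offset for small r. *)
Lemma abstract_max_principle (u : cpt -> R) (s C r0 R0 : R) :
  continuous u -> 0 < r0 -> R0 < Rr ->
  (forall z r, 0 < r -> r < r0 -> cdist o z <= R0 -> 4 * u z - C * r ^+ 4 <= sum4 u z r) ->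
  (forall z, T z -> u z + w <= s) ->
  (forall z, ~ T z -> R0 <= cdist o z -> cdist o z <= Rr -> u z + v z <= s) ->
  forall z, ~ T z -> cdist o z <= Rr -> u z + v z <= s.
Proof.
move=> cu r0_gt0 R0R umean uT uout z1 nT1 z1R.
rewrite leNgt; apply/negP => lt_s.
pose h z := u z + v z.
pose k := (h z1 - s) / 2.
have k0 : 0 < k by rewrite divr_gt0// subr_gt0.
have h1 : h z1 = s + 2 * k by rewrite /k; lra.
have Rr0 : 0 <= Rr by exact: le_trans (cdist_ge0 _ _) z1R.
(* On the disk of radius [Rr] the perturbation is then at most [k], half of the assumed excess of
   [h z1] over [s]. *)
pose e := k / (Rr ^+ 2 + 1).
have e0 : 0 < e by rewrite divr_gt0// ltr_wpDl ?sqr_ge0.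
pose N z : R := cdist o z ^+ 2.
have N0 z : 0 <= N z by exact: sqr_ge0.
have eN z : cdist o z <= Rr -> e * N z <= k.
  move=> zR; rewrite /e mulrAC ler_pdivrMr ?ltr_wpDl ?sqr_ge0// ler_wpM2l ?(ltW k0)//.
  rewrite (@le_trans _ _ (Rr ^+ 2)) ?lerDl// /N lerXn2r ?nnegrE ?cdist_ge0//.
pose H z := h z + e * N z.
pose g z := u z + e * N z.
have cN : continuous N.
  by move=> x; apply: (@continuousM _ _ (cdist o) (cdist o)); exact: cdist_continuousr.
have cg : continuous g.
  by move=> x; apply: cvgD; [exact: cu|apply: cvgM; [exact: cvg_cst|exact: cN]].
have Hnear z (n : R) : cdist o z <= Rr -> ~ T z -> 0 < n -> exists2 d, 0 < d &
    forall x, cdist z x < d -> cdist o x <= Rr -> ~ T x /\ `|H z - H x| < n.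
  move=> zR nT n0; have [D D0 HD] := off_dist cT nT.
  have n20 : 0 < n / 2 by rewrite divr_gt0.
  have /cvgrPdist_lt/(_ _ n20)/nbhs_disk[d d0 gd] := cg z.
  exists (Num.min d (Num.min (D / 2) (n * D / 4))).
    by rewrite !lt_min d0 !divr_gt0// mulr_gt0.
  move=> x; rewrite !lt_min => /and3P[zx1 zx2 zx3] xR; split.
    by move=> /HD; rewrite leNgt => /negP; apply; rewrite (lt_trans zx2)//; lra.
  have := vnear HD zR xR (ltW zx2) D0; have := gd x zx1.
  rewrite /H /h /g.
  have : 2 * cdist z x / D < n / 2.
    by rewrite ltr_pdivrMr//; lra.
  move: (v z) (v x) (e * N z) (e * N x) => a b c f h3.
  rewrite ltr_norml ler_norml ltr_norml => /andP[h4 h5] /andP[h6 h7].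
  by apply/andP; split; lra.
pose A : set cpt := [set z | [/\ cdist o z <= Rr, ~ T z & H z1 <= H z]].
have HA z : A z -> s + k <= h z.
  case=> zR nT; rewrite /H h1 => h2; have := eN z zR; have := mulr_ge0 (ltW e0) (N0 z1).
  by move: (e * N z) (e * N z1) h2 => a b; lra.
have Ain z : A z -> cdist o z < R0.
  move=> Az; have [zR nT _] := Az; rewrite ltNge; apply/negP => zR0.
  have := uout z nT zR0 zR; have := HA z Az; rewrite /h; move: (u z) (v z) k0; clear; move: k => k' a b; lra.
(* The delicate points are those of [T]: near them the continuity of [u] and [vbd] bound [h] by s +
   k / 2, whereas [h] is at least s + k on [A]. *)
have clA : closed A.
  rewrite -[A]setCK; apply: open_closedC; rewrite openE => z nAz; apply/nbhs_disk.
  have [zR|zR] := leP (cdist o z) Rr; last first.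
    exists (cdist o z - Rr); first by rewrite subr_gt0.
    move=> x zx [xR _ _]; have := cdist_triangle o x z; rewrite (cdistC x z).
    by move: zx; rewrite /disk/=; lra.
  have [Tz|nTz] := pselect (T z).
    have k40 : 0 < k / 4 by rewrite divr_gt0.
    have [d d0 Hd] := vbd Tz k40.
    have /cvgrPdist_lt/(_ _ k40)/nbhs_disk[d' d0' ud] := cu z.
    exists (Num.min d d'); first by rewrite lt_min d0.
    move=> x; rewrite /disk/= lt_min => /andP[zx zx'] Ax.
    have [xR nTx _] := Ax; have := HA x Ax; have := Hd x zx xR nTx.
    rewrite /h.
    have := ud x zx'; rewrite ltr_norml => /andP[? ?]; have := uT z Tz.
    by lra.
  have lt1 : 0 < H z1 - H z.
    by rewrite subr_gt0 ltNge; apply/negP => h2; exact: nAz.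
  have [d d0 Hd] := Hnear z _ zR nTz lt1.
  exists d => // x zx [xR nTx Hx]; have [_] := Hd x zx xR.
  rewrite ltr_norml => /andP[h2 h3].
  by move: (H z1) (H z) (H x) Hx h2 h3 => a b c; lra.
have cA : compact A.
  apply: (@subclosed_compact _ A [set z | cdist o z <= Rr]) => //.
    exact: compact_disk.
  by move=> z [].
have A1 : A z1 by split.
have [|z0 /set_mem Az0 Hmax] := @compact_EVT_max _ R H A (ex_intro _ z1 A1) cA.
  apply/subspace_continuousP => z [zR nTz _]; apply/cvgrPdist_lt => n n0.
  have [d d0 Hd] := Hnear z n zR nTz n0.
  apply/nbhs_disk; exists d => // x zx [xR _ _].
  by have [] := Hd x zx xR.
have [z0R nT0 H10] := Az0; have z0R0 := Ain _ Az0.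
have [D D0 HD] := off_dist cT nT0.
have max z : cdist o z <= Rr -> ~ T z -> H z <= H z0.
  move=> zR nTz; have [h2|h2] := leP (H z1) (H z).
    by apply: Hmax; apply: mem_set; split.
  exact: le_trans (ltW h2) H10.
(* The mean value estimates will give 4 e <= (C + D^-4) r^2. A radius r <= 1 below [Q] violates
   this, because r^2 <= r. *)
pose Q := 4 * e / (`|C| + (D ^+ 4)^-1 + 1).
have Q0 : 0 < Q.
  apply: divr_gt0; first by rewrite mulr_gt0.
  by apply: ltr_wpDl => //; apply: addr_ge0 => //; rewrite invr_ge0 exprn_ge0// ltW.
pose r := Num.min (Num.min (r0 / 2) (D / 2)) (Num.min (Rr - R0) (Num.min 1 (Q / 2))).
have r_gt0 : 0 < r.
  have [? ?] : 0 < r0 / 2 /\ 0 < D / 2 by rewrite !divr_gt0.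
  have [? ?] : 0 < Rr - R0 /\ 0 < Q / 2 by rewrite subr_gt0 divr_gt0.
  by rewrite /r !lt_min ltr01; do !(apply/andP; split).
have [rr0 rD rR r1 rQ] : [/\ r < r0, r < D, r <= Rr - R0, r <= 1 & r < Q].
  split.
  - by apply: (@le_lt_trans _ _ (r0 / 2)); [rewrite !ge_min lexx|lra].
  - by apply: (@le_lt_trans _ _ (D / 2)); [rewrite !ge_min lexx !orbT|lra].
  - by rewrite !ge_min lexx !orbT.
  - by rewrite !ge_min lexx !orbT.
  - by apply: (@le_lt_trans _ _ (Q / 2)); [rewrite !ge_min lexx !orbT|lra].
have p1 (x : R) : `|x| <= r -> cdist z0 (z0.1 + x, z0.2) <= r.
  move=> xr; rewrite /cdist/= subrr expr0n addr0/= opprD addrA subrr add0r.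
  by rewrite sqrtr_sqr normrN.
have p2 (x : R) : `|x| <= r -> cdist z0 (z0.1, z0.2 + x) <= r.
  move=> xr; rewrite /cdist/= subrr expr0n add0r/= opprD addrA subrr add0r.
  by rewrite sqrtr_sqr normrN.
have rr : `|r| <= r by rewrite ger0_norm// ltW.
have rNr : `|- r| <= r by rewrite normrN ger0_norm// ltW.
have pt x : cdist z0 x <= r -> cdist o x <= Rr /\ ~ T x.
  move=> zx; split; first by have := cdist_triangle o z0 x; lra.
  by move=> /HD; lra.
have [q1R q1T] := pt _ (p1 _ rr); have [q2R q2T] := pt _ (p1 _ rNr).
have [q3R q3T] := pt _ (p2 _ rr); have [q4R q4T] := pt _ (p2 _ rNr).
have s4 : sum4 H z0 r <= 4 * H z0.
  rewrite /sum4; have := max _ q1R q1T; have := max _ q2R q2T.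
  have := max _ q3R q3T; have := max _ q4R q4T.
  by move: (H _) (H _) (H _) (H _) (H _) => a b c d f; lra.
have s4N : sum4 N z0 r = 4 * N z0 + 4 * r ^+ 2.
  by rewrite /sum4 /N !cdist_sqr/=; ring.
have s4u := umean z0 r r_gt0 rr0 (ltW z0R0).
have s4W : 4 * v z0 <= sum4 v z0 r + r ^+ 4 / D ^+ 4.
  by apply: v4 => //; lra.
have : 4 * e * r ^+ 2 <= (C + (D ^+ 4)^-1) * r ^+ 4.
  move: s4 s4W s4N s4u; rewrite /H /h !sum4D.
  have -> : sum4 (fun x => e * N x) z0 r = e * sum4 N z0 r by rewrite /sum4; ring.
  move: (v z0) (sum4 v z0 r) (sum4 N z0 r) (sum4 u z0 r) (N z0) (u z0) (r ^+ 4) (r ^+ 2).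
  by move: (D ^+ 4)^-1 => iD a b c d f g' r4 r2 h2 h3 h5 h4; rewrite h5 in h2; nra.
have -> : r ^+ 4 = r ^+ 2 * r ^+ 2 by rewrite -exprD.
rewrite [leRHS]mulrA ler_pM2r ?exprn_gt0// => h2.
have CC : C + (D ^+ 4)^-1 <= `|C| + (D ^+ 4)^-1 + 1.
  by have := ler_norm C; lra.
have D4 : 0 < (D ^+ 4)^-1 by rewrite invr_gt0 exprn_gt0.
have : (`|C| + (D ^+ 4)^-1 + 1) * r < 4 * e.
  by rewrite mulrC -ltr_pdivlMr// ltr_wpDl// addr_ge0// ltW.
have r2 : r ^+ 2 <= r by rewrite expr2 ger_pMr.
have := ler_wpM2r (sqr_ge0 r) CC.
have C0 : 0 <= `|C| + (D ^+ 4)^-1 + 1 by rewrite !addr_ge0// ltW.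
have := ler_wpM2l C0 r2.
by lra.
Qed.

End abstract_maximum_principle.

Section maximum_principle.
Context {R : realType}.
Local Notation cpt := (R * R)%type.
Implicit Types (z t : cpt) (d r : R).
Variables (T : set cpt) (mu : @cmeasure R) (B Rr w : R).
Local Notation o := ((0, 0) : cpt).
Local Notation W := (logpot B 0 mu).
Hypothesis B1 : 1 <= B.
Hypothesis RB : 2 * Rr <= B.
Hypothesis cT : compact T.
Hypothesis TR : forall z, T z -> cdist o z <= Rr.
Hypothesis mu1 : mu setT = 1%E.
Hypothesis muT0 : mu (~` T) = 0%E.
Hypothesis Tw : forall z, T z -> (W z <= w%:E)%E.

Let B0 : 0 < B := lt_le_trans ltr01 B1.
Let muT : (mu setT < +oo)%E. Proof. by rewrite mu1 ltry. Qed.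
Let mT : measurable T := compact_measurable2 cT.

Let dist_le z t : cdist o z <= Rr -> cdist o t <= Rr -> cdist z t <= B.
Proof.
by move=> zR tR; have := cdist_triangle z o t; rewrite (cdistC z o); have := RB; lra.
Qed.

Let kerE z t : cdist o z <= Rr -> T t -> logker B 0 z t = ((ln B)%:E - elog (cdist z t))%E.
Proof.
by move=> zR Tt; rewrite /logker rho0 min_l// dist_le// TR.
Qed.

(** Multiplicative comparison of distances becomes additive comparison of potentials. The exponent
    may depend on [t], so that a bad factor can be confined to a set of small mass. *)
Lemma logpot_compare (b : cpt -> R) z z' : cdist o z <= Rr -> cdist o z' <= Rr ->
  measurable_fun setT b -> (forall t, 0 <= b t) ->
  (forall t, T t -> cdist z' t <= expR (b t) * cdist z t) ->
  (W z <= W z' + \int[mu]_t (b t)%:E)%E.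
Proof.
move=> zR zR' mb b0 H.
have mk := measurable_logkerl B 0.
have k0 x t := logker_ge0 0 x t B0.
rewrite !logpotE -ge0_integralD//; [|by move=> t _; rewrite lee_fin|exact/measurable_EFinP].
apply: ae_ge0_le_integral => //.
- by move=> t _; rewrite adde_ge0// lee_fin.
- by apply: emeasurable_funD => //; exact/measurable_EFinP.
apply: (ae_of_null mT muT0) => t Tt _; rewrite !kerE//.
have := le_elog (cdist_ge0 z' t) (H t Tt).
rewrite elogM ?expR_ge0 ?cdist_ge0// (elogE (expR_gt0 _)) expRK.
case: (elog (cdist z' t)) => [x| |]; case: (elog (cdist z t)) => [y| |]// h;
  rewrite ?addeNy ?addNye ?addey ?addye ?leey ?leNye//.
move: h; rewrite -!EFinN -!EFinD !lee_fin; lra.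
Qed.

Lemma logpot_compare_cst (b : R) z z' : cdist o z <= Rr -> cdist o z' <= Rr -> 0 <= b ->
  (forall t, T t -> cdist z' t <= expR b * cdist z t) -> (W z <= W z' + b%:E)%E.
Proof.
move=> zR zR' b0 H; have := @logpot_compare (fun=> b) z z' zR zR' _ _ H.
by rewrite integral_cst// mu1 mule1; apply.
Qed.

Let W_fin z : cdist o z <= Rr -> ~ T z -> W z \is a fin_num.
Proof.
move=> zR /(off_dist cT)[D D0 HD]; rewrite ge0_fin_numE ?logpot_ge0// logpotE.
apply: (@le_lt_trans _ _ (\int[mu]_t (`|ln B - ln D|)%:E)%E); last by rewrite integral_cst// mu1 mule1 ltry.
apply: ae_ge0_le_integral => //.
- by move=> t _; exact: logker_ge0.
- exact: measurable_logkerl.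
apply: (ae_of_null mT muT0) => t Tt _; rewrite kerE//.
have c0 := lt_le_trans D0 (HD t Tt).
rewrite elogE// -EFinB lee_fin (le_trans _ (ler_norm _))// lerD2l lerN2 ler_ln ?posrE//.
exact: HD.
Qed.

(** The distances from [z] and [z'] to any point of [T] differ by a factor at most 1 + 2 |z - z'| /
    D, in either order. *)
Let W_near z D : (forall t, T t -> D <= cdist z t) -> forall z', cdist o z <= Rr -> cdist o z' <= Rr ->
  cdist z z' <= D / 2 -> 0 < D ->
  `|fine (W z) - fine (W z')| <= 2 * cdist z z' / D.
Proof.
move=> HD z' zR zR' zz' D0.
have HD' t : T t -> D / 2 <= cdist z' t.
  by move=> Tt; have := cdist_triangle z z' t; have := HD t Tt; lra.
have nT : ~ T z by move=> /HD; rewrite cdistxx leNgt D0.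
have nT' : ~ T z' by move=> /HD'; rewrite cdistxx leNgt divr_gt0.
have c0 := cdist_ge0 z z'.
have b0 : 0 <= 2 * cdist z z' / D by rewrite divr_ge0 ?mulr_ge0// ltW.
have ineq x y t : D / 2 <= cdist x t -> cdist x y = cdist z z' ->
    cdist y t <= expR (2 * cdist z z' / D) * cdist x t.
  move=> hx xy; have := cdist_triangle y x t; rewrite (cdistC y x) xy => h.
  have e1 : 1 + 2 * cdist z z' / D <= expR (2 * cdist z z' / D) by exact: expR_ge1Dx.
  have x0 := cdist_ge0 x t.
  apply: le_trans h _; apply: le_trans (ler_wpM2r x0 e1).
  rewrite mulrDl mul1r addrC lerD2l mulrAC ler_pdivlMr//.
  by rewrite mulrAC [leLHS]mulrC ler_wpM2r//; lra.
have h1 : (W z <= W z' + (2 * cdist z z' / D)%:E)%E.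
  by apply: logpot_compare_cst => // t Tt; apply: ineq => //; have := HD t Tt; lra.
have h2 : (W z' <= W z + (2 * cdist z z' / D)%:E)%E.
  by apply: logpot_compare_cst => // t Tt; apply: ineq => //; [exact: HD'|exact: cdistC].
move: h1 h2 (W_fin zR nT) (W_fin zR' nT'); move: (W z) (W z') => [x| |] [y| |]//.
rewrite -!EFinD !lee_fin /= => h1 h2 _ _.
by rewrite ler_norml; apply/andP; split; lra.
Qed.

(** Chebyshev's inequality: the kernel is at least [M] on the disk, while its integral is at most
    [w] because the centre lies in [T]. *)
Let disk_small z (M rr : R) : T z -> 0 < M -> 0 < rr -> rr <= B -> M <= ln B - ln rr ->
  ((M%:E * mu (disk z rr)) <= w%:E)%E.
Proof.
move=> Tz M0 r0 rB Mr; apply: le_trans (Tw Tz); rewrite logpotE.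
have mD : measurable (disk z rr) by apply: open_measurable2; exact: open_disk.
rewrite -integral_cst//.
apply: (@le_trans _ _ (\int[mu]_(t in disk z rr) logker B 0 z t)%E); last first.
  apply: ge0_subset_integral => //; first exact: measurable_logkerl.
  by move=> t _; exact: logker_ge0.
apply: ge0_le_integral => //.
- by move=> t _; rewrite lee_fin ltW.
- by apply: measurable_funTS; exact: measurable_logkerl.
- move=> t /= zt; rewrite /logker rho0 min_l; last by rewrite ltW// (lt_le_trans zt).
  have [c0|] := ltP 0 (cdist z t); last first.
    move=> c0; have -> : cdist z t = 0 by apply/eqP; rewrite eq_le c0 cdist_ge0.
    by rewrite elog0 /= leey.
  rewrite elogE// -EFinB lee_fin (le_trans Mr)// lerD2l lerN2 ler_ln ?posrE//.
  exact: ltW.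
Qed.

(** Continuity principle. Let z' be a point of [T] nearest to x. Then |z' - t| <= 2 |x - t| for all
    t in [T], and the factor 2 improves to nearly 1 when t is outside a fixed disk about [z]. So W x
    exceeds W z' by little more than ln 2 times the mass of that disk, which [disk_small] makes
    small. *)
Let W_boundary z (k : R) : T z -> 0 < k -> exists2 e, 0 < e &
  forall x, cdist z x < e -> cdist o x <= Rr -> ~ T x -> (W x <= (w + k)%:E)%E.
Proof.
move=> Tz k0.
have w0 : 0 <= w by rewrite -lee_fin; apply: le_trans (Tw Tz); exact: logpot_ge0.
have l20 : 0 < ln 2 :> R by rewrite ln_gt0// ltr1n.
(* Makes ln 2 times a mass of at most w / M no larger than k / 2. *)
pose M : R := 2 * ln 2 * (w + 1) / k.
have M0 : 0 < M by rewrite divr_gt0// mulr_gt0 ?mulr_gt0//; lra.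
pose rr : R := B * expR (- M).
have rr0 : 0 < rr by rewrite mulr_gt0// expR_gt0.
have rrB : rr <= B by rewrite ger_pMr// -expR0 ler_expR oppr_le0 ltW.
have Mr : M <= ln B - ln rr.
  by rewrite /rr lnM ?posrE ?expR_gt0// expRK; lra.
have := disk_small Tz M0 rr0 rrB Mr.
have mD : measurable (disk z rr) by apply: open_measurable2; exact: open_disk.
have mDfin : mu (disk z rr) \is a fin_num.
  by rewrite ge0_fin_numE// (le_lt_trans (le_measure _ _ _ _) muT) ?inE.
have m_ge0 : 0 <= fine (mu (disk z rr)) by rewrite fine_ge0.
rewrite -(fineK mDfin) -EFinM lee_fin => Mm.
have mle : ln 2 * fine (mu (disk z rr)) <= k / 2.
  have : M * fine (mu (disk z rr)) <= w + 1 by lra.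
  move: (fine (mu (disk z rr))) m_ge0 => m m_ge0.
  have -> : M = (w + 1) * (2 * ln 2 / k) by rewrite /M; ring.
  rewrite -mulrA ger_pMr; last by lra.
  by rewrite mulrAC ler_pdivrMr// mul1r => ?; lra.
(* The first bound keeps x at distance at least rr / 2 from the points outside the disk; the second
   then makes |x - z'| at most k / 2 times that distance. *)
pose e : R := Num.min (rr / 2) (rr * k / 4).
have e0 : 0 < e by rewrite lt_min !divr_gt0// mulr_gt0.
exists e => // x zx xR nTx.
have [z' Tz' min'] : exists2 z', T z' & forall t, T t -> cdist x z' <= cdist x t.
  have [|c cT' Hc] := @compact_EVT_min _ R (cdist x) T (ex_intro _ z Tz) cT.
    by apply: continuous_subspaceT; exact: cdist_continuousr.
  by exists c; [exact: set_mem|move=> t Tt; apply: Hc; exact: mem_set].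
have xz' : cdist x z' < e by rewrite (le_lt_trans (min' _ Tz))// cdistC.
pose b t : R := k / 2 + ln 2 * \1_(disk z rr) t.
have mb : measurable_fun setT b.
  by apply: measurable_funD => //; apply: measurable_funM => //.
have b0 t : 0 <= b t.
  by apply: addr_ge0; [rewrite divr_ge0// ltW|apply: mulr_ge0 => //; exact: ltW].
have H t : T t -> cdist z' t <= expR (b t) * cdist x t.
  move=> Tt; have xt0 := cdist_ge0 x t.
  have tri := cdist_triangle z' x t; rewrite (cdistC z' x) in tri.
  have k20 : 0 <= k / 2 by rewrite divr_ge0// ltW.
  have [tD|tD] := boolP (t \in disk z rr).
    rewrite /b indicE tD mulr1 expRD lnK ?posrE//.
    have e1 : 1 <= expR (k / 2) by have := expR_ge1Dx (k / 2); lra.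
    have e2 : 2 <= expR (k / 2) * 2 by lra.
    apply: le_trans (ler_wpM2r xt0 e2).
    by have := min' _ Tt; lra.
  rewrite /b indicE (negbTE tD) mulr0 addr0.
  have zt : rr <= cdist z t by rewrite leNgt; apply: contra tD => ?; rewrite inE.
  have xt : rr / 2 <= cdist x t.
    have := cdist_triangle z x t; have : cdist z x < rr / 2.
      by apply: lt_le_trans zx _; rewrite ge_min lexx.
    lra.
  have h1 := expR_ge1Dx (k / 2).
  apply: le_trans tri _; apply: le_trans (ler_wpM2r xt0 h1).
  rewrite mulrDl mul1r addrC lerD2l.
  have : cdist x z' <= rr * k / 4.
    by rewrite ltW// (lt_le_trans xz')// ge_min lexx orbT.
  by move=> /le_trans; apply; nra.
apply: le_trans (logpot_compare xR (TR Tz') mb b0 H) _.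
have -> : (\int[mu]_t (b t)%:E = (k / 2 + ln 2 * fine (mu (disk z rr)))%:E)%E.
  rewrite /b; under eq_integral do rewrite EFinD.
  rewrite ge0_integralD//=; first last.
  - apply/measurable_EFinP; apply: measurable_funM => //; exact: measurable_indic.
  - by move=> t _; rewrite lee_fin mulr_ge0// ltW.
  - by move=> t _; rewrite lee_fin divr_ge0// ltW.
  rewrite integral_cst// mu1 mule1; under eq_integral do rewrite EFinM.
  rewrite ge0_integralZl ?lee_fin ?(ltW l20)//; last by apply/measurable_EFinP; exact: measurable_indic.
  by rewrite [RHS]EFinD; congr (_ + _)%E; rewrite integral_indic// setIT EFinM fineK.
apply: le_trans (leeD2r _ (Tw Tz')) _.
by rewrite -EFinD lee_fin; move: (fine _) mle => m; lra.
Qed.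

Let W4 z0 D r : cdist o z0 + r <= Rr -> (forall t, T t -> D <= cdist z0 t) ->
  0 < r -> r < D -> 4 * fine (W z0) <= sum4 (fun x => fine (W x)) z0 r + r ^+ 4 / D ^+ 4.
Proof.
move=> z0r HD r_gt0 rD; have D0 := lt_trans r_gt0 rD.
have z0R : cdist o z0 <= Rr by lra.
have nT0 : ~ T z0 by move=> /HD; rewrite cdistxx leNgt D0.
have p1 (x : R) : `|x| <= r -> cdist z0 (z0.1 + x, z0.2) <= r.
  move=> xr; rewrite /cdist/= subrr expr0n addr0/= opprD addrA subrr add0r.
  by rewrite sqrtr_sqr normrN.
have p2 (x : R) : `|x| <= r -> cdist z0 (z0.1, z0.2 + x) <= r.
  move=> xr; rewrite /cdist/= subrr expr0n add0r/= opprD addrA subrr add0r.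
  by rewrite sqrtr_sqr normrN.
have rr : `|r| <= r by rewrite ger0_norm// ltW.
have rNr : `|- r| <= r by rewrite normrN ger0_norm// ltW.
have pt x : cdist z0 x <= r -> cdist o x <= Rr /\ ~ T x.
  move=> zx; split; first by have := cdist_triangle o z0 x; lra.
  by move=> /HD; lra.
have [q1R q1T] := pt _ (p1 _ rr); have [q2R q2T] := pt _ (p1 _ rNr).
have [q3R q3T] := pt _ (p2 _ rr); have [q4R q4T] := pt _ (p2 _ rNr).
pose q1 := (z0.1 + r, z0.2); pose q2 := (z0.1 - r, z0.2).
pose q3 := (z0.1, z0.2 + r); pose q4 := (z0.1, z0.2 - r).
suff: (4%:E * W z0 <= W q1 + W q2 + W q3 + W q4 + (r ^+ 4 / D ^+ 4)%:E)%E.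
  rewrite -(fineK (W_fin z0R nT0)) -(fineK (W_fin q1R q1T)) -(fineK (W_fin q2R q2T)).
  by rewrite -(fineK (W_fin q3R q3T)) -(fineK (W_fin q4R q4T)) -EFinM -!EFinD lee_fin.
have mk := measurable_logkerl B 0; have k_ge0 x t := logker_ge0 0 x t B0.
have c_ge0 : 0 <= r ^+ 4 / D ^+ 4 by rewrite divr_ge0 ?exprn_ge0// ltW.
rewrite -[X in (_ <= _ + X)%E](mule1 _) -mu1 -(integral_cst mu measurableT).
rewrite !logpotE -ge0_integralZl ?lee_fin//.
rewrite -ge0_integralD// -ge0_integralD//; first last.
- exact: emeasurable_funD.
- by move=> t _; exact: adde_ge0.
rewrite -ge0_integralD//; first last.
- by apply: emeasurable_funD => //; exact: emeasurable_funD.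
- by move=> t _; apply: adde_ge0 => //; apply: adde_ge0 => //; apply: adde_ge0 => //; apply: adde_ge0.
rewrite -ge0_integralD//; first last.
- by apply: emeasurable_funD => //; apply: emeasurable_funD => //; exact: emeasurable_funD.
- by move=> t _; apply: adde_ge0 => //; apply: adde_ge0 => //; apply: adde_ge0 => //; apply: adde_ge0.
apply: ae_ge0_le_integral => //.
- by move=> t _; rewrite mule_ge0// lee_fin.
- exact: measurable_funeM.
- by move=> t _; apply: adde_ge0 => //; apply: adde_ge0 => //; apply: adde_ge0 => //; apply: adde_ge0.
- apply: emeasurable_funD => //; apply: emeasurable_funD => //.
  by apply: emeasurable_funD => //; exact: emeasurable_funD.
apply: (ae_of_null mT muT0) => t Tt _.
have pos x : cdist z0 x <= r -> 0 < cdist x t.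
  by move=> zx; have := cdist_triangle z0 x t; have := HD t Tt; lra.
rewrite !kerE// !elogE; [|exact: pos (p2 _ rNr)|exact: pos (p2 _ rr)|
  exact: pos (p1 _ rNr)|exact: pos (p1 _ rr)|exact: lt_le_trans (HD t Tt)].
have := sum4_cdist_le (ltW r_gt0) rD (HD t Tt); rewrite /sum4/=.
rewrite -!EFinB -EFinM -!EFinD lee_fin.
by move: (ln (cdist _ _)) (ln (cdist _ _)) (ln (cdist _ _)) (ln (cdist _ _)) (ln (cdist _ _)) => *; lra.
Qed.

Lemma max_principle (u : cpt -> R) (s C r0 R0 : R) : continuous u -> 0 < r0 -> R0 < Rr ->
  (forall z r, 0 < r -> r < r0 -> cdist o z <= R0 -> 4 * u z - C * r ^+ 4 <= sum4 u z r) ->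
  (forall z, T z -> u z + w <= s) ->
  (forall z, R0 <= cdist o z -> cdist o z <= Rr -> ((u z)%:E + W z <= s%:E)%E) ->
  forall z, cdist o z <= Rr -> ((u z)%:E + W z <= s%:E)%E.
Proof.
move=> cu r0_gt0 R0R umean uT uout z1 z1R.
have [T1|nT1] := pselect (T z1).
  by apply: le_trans (leeD2l _ (Tw T1)) _; rewrite -EFinD lee_fin uT.
have WE z : cdist o z <= Rr -> ~ T z -> ((u z)%:E + W z)%E = (u z + fine (W z))%:E.
  by move=> zR nT; rewrite EFinD fineK// W_fin.
rewrite WE// lee_fin.
apply: (abstract_max_principle cT W_near _ W4 cu r0_gt0 R0R umean uT) => //.
  move=> z k Tz k0; have [e e0 He] := W_boundary Tz k0; exists e => // x zx xR nTx.
  by rewrite -lee_fin fineK ?W_fin// He.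
by move=> z nTz zR0 zR; rewrite -lee_fin -WE// uout.
Qed.

End maximum_principle.

(** * Bernstein-Walsh inequality *)

Section regularized_potentials.
Context {R : realType}.
Local Notation cpt := (R * R)%type.
Local Notation o := ((0, 0) : cpt).
Implicit Types (z t : cpt) (d r : R) (nu : @cmeasure R).

(** The integrated form of [sum4_rho_ge]. It makes minus the regularized [logpot] admissible as the
    function [u] of [max_principle], with constant C = 2 / d^4. The condition on [B] keeps the
    truncation inactive at all four points. *)
Lemma logpot_sum4 nu B Rr rn d z r : 1 <= B -> nu setT = 1%E ->
  nu (~` [set t | cdist o t <= rn]) = 0%E -> Rr + rn + 1 <= B -> 0 < d -> d <= 1 ->
  0 < r -> r <= d / 2 -> cdist o z + r <= Rr ->
  sum4 (fun x => fine (logpot B d nu x)) z r <= 4 * fine (logpot B d nu z) + 2 * (r ^+ 4 / d ^+ 4).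
Proof.
move=> B1 nu1 nur RB d0 d1 r0 rd zr; have B0 := lt_le_trans ltr01 B1.
have nuT : (nu setT < +oo)%E by rewrite nu1 ltry.
have dB := le_trans d1 B1.
have fin x := logpot_fin_num x d0 dB nuT.
rewrite -lee_fin /sum4.
have finE x : (fine (logpot B d nu x))%:E = logpot B d nu x by rewrite fineK.
rewrite !EFinD EFinM !finE {finE}.
set q1 := (z.1 + r, z.2); set q2 := (z.1 - r, z.2).
set q3 := (z.1, z.2 + r); set q4 := (z.1, z.2 - r).
have mk := measurable_logkerl B d; have k_ge0 x t := logker_ge0 d x t B0.
have c_ge0 : 0 <= 2 * (r ^+ 4 / d ^+ 4) by rewrite mulr_ge0// divr_ge0 ?exprn_ge0// ltW.
rewrite -[X in (_ <= _ + X)%E](mule1 _) -nu1 -(integral_cst nu measurableT).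
rewrite !logpotE -ge0_integralZl ?lee_fin//.
rewrite -ge0_integralD// -ge0_integralD//; first last.
- exact: emeasurable_funD.
- by move=> t _; exact: adde_ge0.
rewrite -ge0_integralD//; first last.
- by apply: emeasurable_funD => //; exact: emeasurable_funD.
- by move=> t _; apply: adde_ge0 => //; exact: adde_ge0.
rewrite -ge0_integralD//; first last.
- exact: measurable_funeM.
- by move=> t _; rewrite mule_ge0// lee_fin.
have mK : measurable [set t | cdist o t <= rn].
  by apply: closed_measurable2; apply: closed_ler; exact: cdist_continuousr.
apply: ae_ge0_le_integral => //.
- by move=> t _; apply: adde_ge0 => //; apply: adde_ge0 => //; exact: adde_ge0.
- by apply: emeasurable_funD => //; apply: emeasurable_funD => //; exact: emeasurable_funD.
- by move=> t _; apply: adde_ge0; rewrite ?mule_ge0// lee_fin.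
- by apply: emeasurable_funD => //; exact: measurable_funeM.
apply: (ae_of_null mK nur) => t Kt _.
have rhoB x : cdist z x <= r -> rho d x t <= B.
  move=> zx; have := rho_add x t (ltW d0); rewrite rho0.
  have := cdist_triangle x o t; have := cdist_triangle o z x; rewrite (cdistC x o).
  by move: Kt => /=; lra.
have rho_pos x : 0 < rho d x t by exact: lt_le_trans (rho_ge _ _ _).
have rr : `|r| <= r by rewrite ger0_norm// ltW.
have rNr : `|- r| <= r by rewrite normrN ger0_norm// ltW.
have p1 (x : R) : `|x| <= r -> cdist z (z.1 + x, z.2) <= r.
  move=> xr; rewrite /cdist/= subrr expr0n addr0/= opprD addrA subrr add0r.
  by rewrite sqrtr_sqr normrN.
have p2 (x : R) : `|x| <= r -> cdist z (z.1, z.2 + x) <= r.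
  move=> xr; rewrite /cdist/= subrr expr0n add0r/= opprD addrA subrr add0r.
  by rewrite sqrtr_sqr normrN.
rewrite !logkerE//; try by apply: rhoB; rewrite ?p1 ?p2 ?cdistxx ?(ltW r0).
have := sum4_rho_ge z t d0 (ltW r0) rd; rewrite /sum4/= -/q1 -/q2 -/q3 -/q4.
rewrite -EFinM -!EFinD lee_fin.
move: (ln (rho _ q1 _)) (ln (rho _ q2 _)) (ln (rho _ q3 _)) (ln (rho _ q4 _)) (ln (rho _ z _)).
by move: (r ^+ 4 / d ^+ 4) (ln B) => *; lra.
Qed.

Lemma potential_nu nu rn B z : 1 <= B -> nu setT = 1%E ->
  nu (~` [set t | cdist o t <= rn]) = 0%E -> cdist o z + rn <= B ->
  potential nu z = ((ln B)%:E - logpot B 0 nu z)%E.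
Proof.
move=> B1 nu1 nur hB; have B0 := lt_le_trans ltr01 B1.
have mK : measurable [set t | cdist o t <= rn].
  by apply: closed_measurable2; apply: closed_ler; exact: cdist_continuousr.
rewrite (potentialE B0 _ mK nur) ?nu1 ?ltry ?mule1// => t /= Kt.
have := cdist_triangle z o t; rewrite (cdistC z o); lra.
Qed.

(** Dini's argument, one-sided: the regularized functions are continuous and increase to a function
    above [b] on the compact set [K], so one of them is already at least [b] everywhere on it. *)
Lemma logpot_dini nu B (K : set cpt) (a b : R) : 1 <= B -> (nu setT < +oo)%E -> compact K ->
  b < a -> (forall z, K z -> a%:E <= logpot B 0 nu z)%E ->
  exists n, forall z, K z -> b <= fine (logpot B (dseq n) nu z).
Proof.
move=> B1 nuT cK ba H; have B0 := lt_le_trans ltr01 B1.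
have dB n : dseq n <= B := le_trans (dseq_le1 n) B1.
have fin n z := logpot_fin_num z (dseq_gt0 n) (dB n) nuT.
have := (compact_near_coveringP K).1 cK nat \oo (fun n z => b <= fine (logpot B (dseq n) nu z)) _.
case=> [z Kz|N _ HN]; last first.
  by exists N => z Kz; exact: (HN N (leqnn N) z Kz).
have [n0 Hn0] : exists n, b < fine (logpot B (dseq n) nu z).
  apply: contrapT => /forallNP Hn.
  have : (logpot B 0 nu z <= b%:E)%E.
    apply: logpot_sup => // n; rewrite -(fineK (fin n z)) lee_fin leNgt.
    by apply/negP; exact: Hn.
  by rewrite leNgt (lt_le_trans _ (H z Kz))// lte_fin.
have e0 : 0 < fine (logpot B (dseq n0) nu z) - b by rewrite subr_gt0.
have := logpot_continuous (dseq_gt0 n0) (dB n0) nuT.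
move=> /(_ z) /cvgrPdist_lt/(_ _ e0) near_z.
exists ([set x | `|fine (logpot B (dseq n0) nu z) - fine (logpot B (dseq n0) nu x)|
            < fine (logpot B (dseq n0) nu z) - b], [set n | (n0 <= n)%N]).
  by split => //=; exists n0.
move=> [x n] [/= hx hn].
have : fine (logpot B (dseq n0) nu x) <= fine (logpot B (dseq n) nu x).
  by rewrite fine_le// logpot_dec ?dseq_dec// ltW// dseq_gt0.
apply: le_trans; move: hx.
move: (fine (logpot _ _ _ z)) (fine (logpot _ _ _ x)) => p q.
by rewrite ltr_norml => /andP[? ?]; lra.
Qed.

End regularized_potentials.

Section equilibrium.
Context {R : realType}.
Local Notation cpt := (R * R)%type.
Local Notation o := ((0, 0) : cpt).
Implicit Types (z t : cpt) (d r : R) (nu : @cmeasure R).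
Variables (E : set cpt) (mu : @cmeasure R).
Hypothesis cE : compact E.
Hypothesis cap0 : 0 < cap E.
Hypothesis eqmu : equilibrium_measure E mu.

Let pmu : prob_on E mu := eqmu.1.
Let mu1 : mu setT = 1%E := pmu.1.
Let muE : mu (~` E) = 0%E := pmu.2.
Let muT : (mu setT < +oo)%E := prob_on_lty pmu.
Let mE : measurable E := compact_measurable2 cE.

Lemma robinE : robin E = (- ln (cap E))%:E.
Proof.
move: cap0; rewrite /cap; case: (robin E) => [v _| |]; rewrite ?ltxx//.
by rewrite expRK opprK.
Qed.

Variable rE : R.
Hypothesis ErE : forall z, E z -> cdist o z <= rE.

Let rE0 : 0 <= rE.
Proof.
have [z Ez] : E !=set0.
  apply/set0P/eqP => E0; have := muE; rewrite E0 setC0 mu1 => /eqP.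
  by rewrite onee_eq0.
exact: le_trans (cdist_ge0 _ _) (ErE Ez).
Qed.

Let EB B : 2 * rE <= B -> forall z t, E z -> E t -> cdist z t <= B.
Proof.
move=> hB z t Ez Et; have := cdist_triangle z o t; rewrite (cdistC z o).
have := ErE Ez; have := ErE Et; lra.
Qed.

Lemma equilibrium_logpot B : 1 <= B -> 2 * rE <= B ->
  (\int[mu]_z logpot B 0 mu z)%E = (ln B - ln (cap E))%:E.
Proof.
move=> B1 hB; have B0 := lt_le_trans ltr01 B1.
have := energyE cE B0 (EB hB) pmu; rewrite eqmu.2 robinE.
case: (integral _ _ _) => [x| |]//; rewrite -EFinB => -[h]; congr EFin; lra.
Qed.

Lemma equilibrium_min B sigma : 1 <= B -> 2 * rE <= B -> prob_on E sigma ->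
  ((ln B - ln (cap E))%:E <= \int[sigma]_z logpot B 0 sigma z)%E.
Proof.
move=> B1 hB ps; have B0 := lt_le_trans ltr01 B1.
have : (robin E <= energy sigma)%E by apply: ereal_inf_lbound; exists sigma.
rewrite (energyE cE B0 (EB hB) ps) robinE.
case: (integral _ _ _) => [x| |]//; rewrite ?leey// -EFinB !lee_fin; lra.
Qed.

Let T B := eqset E mu B (ln B - ln (cap E)).

Let T_compact B : 1 <= B -> compact (T B).
Proof. by move=> B1; exact: eqset_compact. Qed.

Let T_null B : 1 <= B -> 2 * rE <= B -> mu (~` T B) = 0%E.
Proof.
move=> B1 hB; apply: (eqset_null B1 cE pmu (equilibrium_logpot B1 hB)) => sigma.
exact: equilibrium_min.
Qed.

Lemma potential_mu B z : 1 <= B -> cdist o z + rE <= B ->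
  potential mu z = ((ln B)%:E - logpot B 0 mu z)%E.
Proof.
move=> B1 hB; have B0 := lt_le_trans ltr01 B1.
rewrite (potentialE B0 muT mE muE) ?mu1 ?mule1// => t Et.
have := cdist_triangle z o t; rewrite (cdistC z o); have := ErE Et; lra.
Qed.

(** The half of Frostman's theorem that holds without exceptions. The maximum principle with [u = 0]
    carries the upper bound for [logpot] from the carrier [T B] to a disk containing [z1]. *)
Lemma potential_ge z1 : ((ln (cap E))%:E <= potential mu z1)%E.
Proof.
(* Points of modulus at least rE + cap E are at distance at least cap E from [E], so the outer
   condition of the maximum principle holds by direct estimation of the kernel. *)
pose R0 := Num.max (rE + cap E) (cdist o z1).
have R0E : rE + cap E <= R0 by rewrite le_max lexx.
have R0z : cdist o z1 <= R0 by rewrite le_max lexx orbT.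
pose Rr := R0 + 1; pose B := 2 * Rr + 1.
have B1 : 1 <= B by rewrite /B /Rr; have := rE0; have := cap0; lra.
have hB : 2 * rE <= B by rewrite /B /Rr; have := rE0; have := cap0; lra.
have B0 := lt_le_trans ltr01 B1.
have H z : cdist o z <= Rr -> ((0 : R)%:E + logpot B 0 mu z <= (ln B - ln (cap E))%:E)%E.
  apply: (@max_principle _ (T B) mu B Rr (ln B - ln (cap E)) _ _ _ _ mu1 _ _ (fun=> 0) _ 0 1 R0) => //.
  - by rewrite /B; lra.
  - exact: T_compact.
  - by move=> t [/ErE Et _]; rewrite /Rr; have := cap0; lra.
  - exact: T_null.
  - by move=> t [].
  - by move=> ?; exact: cvg_cst.
  - by rewrite /Rr; lra.
  - by move=> t r _ _ _; rewrite /sum4; lra.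
  - by move=> t _; rewrite add0r.
  - move=> t tR0 tRr; rewrite add0e.
    have hb : 0 <= ln B - ln (cap E).
      by rewrite subr_ge0 ler_ln ?posrE//; move: cap0 rE0; rewrite /B /Rr; lra.
    apply: (@le_trans _ _ (\int[mu]_t (ln B - ln (cap E))%:E)%E); last first.
      by rewrite integral_cst// mu1 mule1.
    rewrite logpotE; apply: ae_ge0_le_integral => //.
    + by move=> x _; exact: logker_ge0.
    + exact: measurable_logkerl.
    + apply: (ae_of_null mE muE) => x Ex _.
      have cx : cap E <= cdist t x.
        have := cdist_triangle o x t; rewrite (cdistC x t); have := ErE Ex; lra.
      rewrite logkerE ?rho0 ?(lt_le_trans cap0)//; last first.
        have := cdist_triangle t o x; rewrite (cdistC t o); have := ErE Ex.
        by move: tRr R0E cap0 rE0; rewrite /B /Rr; lra.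
      by rewrite lee_fin lerD2l lerN2 ler_ln ?posrE// (lt_le_trans cap0).
have := H z1; rewrite (@potential_mu B)//; last by rewrite /B /Rr; move: cap0 rE0; lra.
have z1R : cdist o z1 <= Rr by rewrite /Rr; lra.
rewrite add0e => /(_ z1R).
case: (logpot B 0 mu z1) => [x| |]//; rewrite ?leey// -EFinB !lee_fin; lra.
Qed.

Lemma potential_integral_sym nu r : (nu setT < +oo)%E ->
  nu (~` [set t | cdist o t <= r]) = 0%E ->
  (\int[mu]_z potential nu z = \int[nu]_z potential mu z)%E.
Proof.
move=> nuT nur; pose K := [set t | cdist o t <= r].
have mK : measurable K.
  by apply: closed_measurable2; apply: closed_ler; exact: cdist_continuousr.
pose L := ln (rE + `|r| + 1).
have L0 : 0 < rE + `|r| + 1 by rewrite ltr_wpDl// addr_ge0.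
have mf : measurable_fun setT (fun x : cpt * cpt => elog (cdist x.1 x.2)).
  apply: (measurableT_comp measurable_elog).
  rewrite (_ : (fun x => _) = (fun x : cpt * cpt => rho 0 x.1 x.2)); first exact: measurable_rho.
  by apply/funext => x; rewrite rho0.
have fL x y : E x -> K y -> (elog (cdist x y) <= L%:E)%E.
  move=> Ex Ky; rewrite /L -elogE// le_elog ?cdist_ge0//.
  have := cdist_triangle x o y; rewrite (cdistC x o); have := ErE Ex.
  by move: Ky; rewrite /K/=; have := ler_norm r; lra.
transitivity (\int[nu]_t \int[mu]_z elog (cdist z t))%E.
  exact: (ub_tonelli (f := fun x => elog (cdist x.1 x.2)) mf muT nuT mE mK muE nur fL).
by apply: eq_integral => z _; apply: eq_integral => t _; rewrite cdistC.
Qed.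

(** By symmetry of the kernel, ln cap E <= \int p_mu dnu = \int p_nu dmu <= a. This makes the excess
    s nonnegative, and in the sharpness part it bounds from below the supremum of the corrective
    potential. *)
Lemma sup_potential_ge nu r (a : R) : nu setT = 1%E ->
  nu (~` [set t | cdist o t <= r]) = 0%E ->
  (forall z, E z -> (potential nu z <= a%:E)%E) -> ln (cap E) <= a.
Proof.
move=> nu1 nur H; have nuT : (nu setT < +oo)%E by rewrite nu1 ltry.
rewrite -lee_fin.
apply: (@le_trans _ _ (\int[nu]_z potential mu z)%E).
  rewrite -[leLHS]mule1 -nu1 -integral_cst//; apply: ae_le_integral => //.
    exact: measurable_potential.
  by apply/aeW => z; exact: potential_ge.
rewrite -(@potential_integral_sym nu r)//.
rewrite -[leRHS]mule1 -mu1 -integral_cst//; apply: ae_le_integral => //.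
  exact: measurable_potential.
exact: (ae_of_null mE muE).
Qed.

(** The maximum principle for minus the regularized [logpot] of [nu] against the singular one of
    [mu]. Regularizing [nu] makes [u] continuous, loses at most [k] on the carrier by [logpot_dini],
    and errs in the favourable direction, since it decreases [logpot]. *)
Lemma bernstein_walsh nu rn (s : R) : nu setT = 1%E ->
  nu (~` [set t | cdist o t <= rn]) = 0%E -> 0 <= s ->
  (forall z, E z -> (potential nu z <= (ln (cap E) + s)%:E)%E) ->
  forall z, (potential nu z <= potential mu z + s%:E)%E.
Proof.
move=> nu1 nur s0 H z1; have nuT : (nu setT < +oo)%E by rewrite nu1 ltry.
apply/lee_addgt0Pr => k k0.
pose q : R := `|rn| + rE + 1.
have rn0 : 0 <= `|rn| := normr_ge0 rn.
have q1 : 1 <= q by move: rE0; rewrite /q; lra.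
(* Beyond modulus rE + p, the excess of the potential of [nu] over that of [mu] is at most ln ((|z|
   + q) / (|z| - rE)) <= (q + rE) / p <= k, because rE <= q. *)
pose p : R := 2 * q / k.
have p0 : 0 < p by rewrite divr_gt0//; lra.
have c0 := cdist_ge0 o z1.
pose R0 := rE + p + q + cap E + cdist o z1.
pose Rr := R0 + 1; pose B := 2 * Rr + q.
have rn1 := ler_norm rn.
have [qr qE] : rn + 1 <= q /\ rE + 1 <= q by move: rE0; rewrite /q; split; lra.
have R0p : rE + p + q <= R0 by move: cap0; rewrite /R0; lra.
have B1 : 1 <= B by move: rE0; rewrite /B /Rr; lra.
have B0 := lt_le_trans ltr01 B1.
have BE : 2 * rE <= B by move: rE0; rewrite /B /Rr; lra.
pose w := ln B - ln (cap E).
have Rr0 : 0 <= Rr by move: rE0; rewrite /Rr; lra.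
have RrB : Rr + rn + 1 <= B by move: rE0; rewrite /B; lra.
have RrB' : Rr + rE <= B by move: rE0; rewrite /B; lra.
have Tnu z : T B z -> ((w - s)%:E <= logpot B 0 nu z)%E.
  move=> [Ez _]; have := H z Ez; rewrite (potential_nu B1 nu1 nur); last first.
    by have := ErE Ez; move: rE0; rewrite /B /Rr; lra.
  case: (logpot B 0 nu z) => [y| |]//; rewrite ?leey// -EFinB !lee_fin /w; lra.
have wk : w - s - k < w - s by lra.
have [n Hn] := logpot_dini B1 nuT (T_compact B1) wk Tnu.
pose d : R := dseq n; have d0 : 0 < d := dseq_gt0 n; have d1 : d <= 1 := dseq_le1 n.
have dB := le_trans d1 B1.
have fin z := logpot_fin_num z d0 dB nuT.
pose u z : R := - fine (logpot B d nu z).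
have cu : continuous u by move=> x; apply: cvgN; exact: logpot_continuous.
have d20 : 0 < d / 2 by rewrite divr_gt0.
have R0R : R0 < Rr by rewrite /Rr; lra.
have TR z : T B z -> cdist o z <= Rr by move=> [/ErE Ez _]; move: Ez; rewrite /Rr; lra.
have umean z r : 0 < r -> r < d / 2 -> cdist o z <= R0 ->
    4 * u z - (2 / d ^+ 4) * r ^+ 4 <= sum4 u z r.
  move=> r0 rd zR; have zr : cdist o z + r <= Rr by rewrite /Rr; lra.
  have := logpot_sum4 B1 nu1 nur RrB d0 d1 r0 (ltW rd) zr.
  rewrite /u /sum4 mulrAC -mulrA.
  move: (fine (logpot _ _ _ _)) (fine (logpot _ _ _ _)) (fine (logpot _ _ _ _))
    (fine (logpot _ _ _ _)) (fine (logpot _ _ _ _)) (r ^+ 4 / d ^+ 4) => *; lra.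
have uT z : T B z -> u z + w <= s + k.
  move=> /Hn; rewrite /u -/d; move: (fine _) => y; lra.
have uout z : R0 <= cdist o z -> cdist o z <= Rr ->
    ((u z)%:E + logpot B 0 mu z <= (s + k)%:E)%E.
  move=> zR0 zRr.
  have zE0 : 0 < cdist o z - rE by lra.
  have nu_ge : ln B - ln (cdist o z + q) <= fine (logpot B d nu z).
    have zq0 : 0 < cdist o z + q by rewrite ltr_wpDl ?cdist_ge0//; lra.
    have zqB : cdist o z + q <= B by rewrite /B; lra.
    rewrite -lee_fin fineK// logpotE -[leLHS]mule1 -nu1 -(integral_cst nu measurableT).
    apply: ae_ge0_le_integral => //.
    + by move=> t _; rewrite lee_fin subr_ge0 ler_ln.
    + by move=> t _; exact: logker_ge0.
    + exact: measurable_logkerl.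
    have mK : measurable [set t | cdist o t <= rn].
      by apply: closed_measurable2; apply: closed_ler; exact: cdist_continuousr.
    apply: (ae_of_null mK nur) => t /= Kt _.
    have rho_le : rho d z t <= cdist o z + q.
      have := rho_add z t (ltW d0); rewrite rho0.
      have := cdist_triangle z o t; rewrite (cdistC z o); lra.
    have rho_pos : 0 < rho d z t by exact: lt_le_trans (rho_ge _ _ _).
    rewrite logkerE//; last exact: le_trans zqB.
    by rewrite lee_fin lerD2l lerN2 ler_ln.
  have mu_le : (logpot B 0 mu z <= (ln B - ln (cdist o z - rE))%:E)%E.
    rewrite logpotE -[leRHS]mule1 -mu1 -(integral_cst mu measurableT).
    apply: ae_ge0_le_integral => //.
    + by move=> t _; exact: logker_ge0.
    + exact: measurable_logkerl.
    + move=> t _; rewrite lee_fin subr_ge0 ler_ln ?posrE//.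
      by move: rE0; rewrite /B; lra.
    apply: (ae_of_null mE muE) => t Et _; have := ErE Et => tE.
    have zt : cdist o z - rE <= cdist z t.
      by have := cdist_triangle o t z; rewrite (cdistC t z); lra.
    have zt0 := lt_le_trans zE0 zt.
    rewrite logkerE ?rho0//; last first.
      by have := cdist_triangle z o t; rewrite (cdistC z o); move: RrB'; lra.
    by rewrite lee_fin lerD2l lerN2 ler_ln.
  apply: le_trans (leeD2l _ mu_le) _; rewrite -EFinD lee_fin /u.
  have : ln (cdist o z + q) <= ln (cdist o z - rE) + k.
    have -> : cdist o z + q = (cdist o z - rE) + (q + rE) by ring.
    have qE0 : 0 <= q + rE by move: rE0; lra.
    apply: (le_trans (ln_addr_le zE0 (lexx _) qE0)); rewrite lerD2l ler_pdivrMr//.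
    have pk : k * p = 2 * q by rewrite /p mulrC divfK// gt_eqF.
    have zp : p <= cdist o z - rE by lra.
    by have := ler_wpM2l (ltW k0) zp; rewrite pk; lra.
  move: nu_ge; move: (fine _) (ln (cdist o z + q)) (ln (cdist o z - rE)) => *; lra.
have z1R : cdist o z1 <= Rr by move: cap0 rE0; rewrite /Rr /R0; lra.
have := @max_principle _ (T B) mu B Rr w B1 _ (T_compact B1) TR mu1 (T_null B1 BE) _ u
  (s + k) (2 / d ^+ 4) (d / 2) R0 cu d20 R0R umean uT uout z1 z1R.
have -> : (potential nu z1 = (ln B)%:E - logpot B 0 nu z1)%E.
  by apply: (potential_nu B1 nu1 nur); move: RrB z1R; lra.
have -> : (potential mu z1 = (ln B)%:E - logpot B 0 mu z1)%E.
  by apply: potential_mu => //; move: RrB' z1R; lra.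
have le_nu : ((fine (logpot B d nu z1))%:E <= logpot B 0 nu z1)%E.
  by rewrite fineK// logpot_dec// ltW.
move=> h; have {}h : ((u z1)%:E + logpot B 0 mu z1 <= (s + k)%:E)%E.
  by apply: h => [|t []//]; rewrite /B; lra.
move: h le_nu; rewrite /u.
move: (fine _) => x; have := logpot_ge0 0 mu z1 B0.
case: (logpot B 0 mu z1) => [y| |]// _; case: (logpot B 0 nu z1) => [y'| |]//; last first.
  by move=> _ _; rewrite (_ : ((ln B)%:E - +oo)%E = -oo%E) ?leNye.
by rewrite -!EFinB -!EFinD !lee_fin; lra.
Qed.

End equilibrium.

(** * Maxima of polynomials *)

Section log_average.
Context {R : realType}.

Definition unif : {measure set (measurableTypeR R) -> \bar R} :=
  mrestr (@lebesgue_measure R) (measurable_itv `[0%R, 1%R]).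

Lemma unif_setT : unif setT = 1%E.
Proof.
rewrite /unif /= /mrestr setTI lebesgue_measure_itv/= lte_fin ltr01.
by rewrite oppr0 adde0.
Qed.

Lemma unif_null : unif (~` `[0%R, 1%R]%classic) = 0%E.
Proof. by rewrite /unif/= /mrestr setICl measure0. Qed.

Lemma unif_ball (x e : R) : 0 < e -> (unif (ball x e) <= (2 * e)%:E)%E.
Proof.
move=> e0; rewrite /unif/= /mrestr.
apply: (@le_trans _ _ (lebesgue_measure (ball x e))).
  apply: le_measure; rewrite ?inE.
  - apply: measurableI; last exact: measurable_itv.
    exact: measurable_ball.
  - exact: measurable_ball.
  - exact: subIsetl.
by rewrite lebesgue_measure_ball ?(ltW e0)// mulr_natl.
Qed.

Definition neglog (u : R) : \bar R := (- elog (Num.min 1%R u))%E.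

Lemma neglog_ge0 u : 0 <= u -> (0 <= neglog u)%E.
Proof.
move=> u0; rewrite /neglog leeNr oppe0.
have -> : (0 = elog (1 : R))%E by rewrite elogE ?ltr01// ln1.
rewrite le_elog ?ge_min ?lexx//.
by rewrite le_min ler01.
Qed.

(** The series counts the powers 2^-i above [u]. If n is the least index with 2^-n <= u < 1, then
    -ln u <= n ln 2 <= n. An integral of a logarithm is thus bounded by measures of intervals. *)
Lemma neglog_le_series u : 0 <= u ->
  (neglog u <= \sum_(i <oo) (\1_(`]-oo, (2^-1) ^+ i[%classic) u)%:E)%E.
Proof.
move=> u0; set S := (X in (_ <= X)%E).
have S_ge n : (forall i, (i < n)%N -> u < (2^-1) ^+ i) -> (n%:R%:E <= S)%E.
  move=> H.
  apply: (@le_trans _ _ (\sum_(0 <= i < n) (\1_(`]-oo, (2^-1) ^+ i[%classic) u)%:E)%E); last first.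
    apply: nneseries_lim_ge => i _; by rewrite lee_fin.
  rewrite big_mkord (eq_bigr (fun=> 1%E)); last first.
    move=> i _; rewrite indicE mem_set//= in_itv/=; exact: H.
  by rewrite sumEFin lee_fin big_const card_ord iter_addr_0.
have [u1|u1] := leP 1 u.
  rewrite /neglog min_l// elogE// ln1 oppe0.
  by apply: nneseries_ge0 => i _ _; rewrite lee_fin.
have [u00|] := ltP 0 u; last first.
  move=> u00; have u_eq : u = 0 by apply/eqP; rewrite eq_le u00 u0.
  rewrite [leRHS](_ : _ = +oo%E) ?leey//.
  apply/eqyP => A A0; apply: (@le_trans _ _ (Num.truncn A).+1%:R%:E).
    by rewrite lee_fin ltW// truncnS_gt.
  by apply: S_ge => i _; rewrite u_eq exprn_gt0.
have [n0 hn0] : exists n, (2^-1) ^+ n <= u.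
  exists (Num.truncn u^-1).+1; rewrite exprVn -[leRHS]invrK lef_pV2 ?posrE ?invr_gt0 ?exprn_gt0//.
  rewrite (le_trans (ltW (truncnS_gt _)))// -natrX ler_nat ltnW// ltn_expl//.
have ex : exists n, (2^-1) ^+ n <= u by exists n0.
pose n := ex_minn ex.
have [hn hmin] : (2^-1) ^+ n <= u /\ forall i, (i < n)%N -> u < (2^-1) ^+ i.
  rewrite /n; case: ex_minnP => m hm hmin; split => // i im; rewrite ltNge.
  by apply/negP => /hmin; rewrite leqNgt im.
apply: le_trans (S_ge n hmin).
rewrite /neglog min_r ?(ltW u1)// elogE// -EFinN lee_fin lerNl.
have : ln ((2^-1) ^+ n) <= ln u by rewrite ler_ln ?posrE// exprn_gt0.
apply: le_trans; rewrite lnXn// lnV ?posrE// mulNrn lerN2 -[leLHS]mulr_natl.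
by rewrite ler_piMr//; have := @le_ln1Dx R 1; rewrite (_ : 1 + 1 = 2)//; apply; lra.
Qed.

Lemma measurable_neglog : measurable_fun [set: R] neglog.
Proof.
apply: measurableT_comp => //; apply: (measurableT_comp measurable_elog).
exact: measurable_minr.
Qed.

Definition neglog_dist (x w : R) : \bar R := neglog `|w - x|.

(** The i-th term of [neglog_le_series] is the indicator of an interval of length 2 * 2^-i, and
    these lengths add up to 4, wherever the centre [x] lies. *)
Lemma neglog_integral (x : R) : (\int[unif]_w neglog_dist x w <= 4%:E)%E.
Proof.
have mdist : measurable_fun [set: measurableTypeR R] (fun w : measurableTypeR R => `|(w : R) - x|).
  by apply: measurableT_comp => //; exact: measurable_funB.
pose F i (w : R) : \bar R := (\1_(`]-oo, (2^-1) ^+ i[%classic) `|w - x|)%:E.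
have mF i : measurable_fun [set: measurableTypeR R] (F i).
  apply/measurable_EFinP; apply: (measurableT_comp _ mdist).
  exact: measurable_indic.
have F0 i w : (0 <= F i w)%E by rewrite lee_fin.
apply: (@le_trans _ _ (\int[unif]_w (\sum_(i <oo) F i w))%E).
  apply: ge0_le_integral => //.
  - by move=> w _; exact: neglog_ge0.
  - exact: (measurableT_comp measurable_neglog mdist).
  - by apply: ge0_emeasurable_sum.
  - by move=> w _; exact: neglog_le_series.
rewrite integral_nneseries//.
apply: (@le_trans _ _ (\sum_(i <oo) (4 / (2 ^ i.+1)%:R)%:E)%E); last exact: epsilon_trick0.
apply: lee_nneseries => [i _ _|i _].
  exact: integral_ge0.
pose A : set (measurableTypeR R) := ball x ((2^-1) ^+ i).
have -> : F i = (fun w : measurableTypeR R => (\1_A w)%:E).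
  apply/funext => w; rewrite /F !indicE; congr ((_ : bool)%:R%:E).
  by rewrite !mem_setE/= in_itv/= distrC.
rewrite integral_indic//; last exact: measurable_ball.
rewrite setIT (le_trans (unif_ball _ _)) ?exprn_gt0// lee_fin.
by rewrite natrX exprVn exprS invfM mulrA (_ : 4 / 2 = 2)//; lra.
Qed.

End log_average.

Section polynomial_average.
Context {R : realType}.
Import Normc.
Implicit Types (a b : R[i]).
Local Open Scope complex_scope.

Lemma normc_ge0 a : 0 <= normc a.
Proof. by case: a => x y /=; exact: sqrtr_ge0. Qed.

Lemma normcD_le a b : normc (a + b) <= normc a + normc b.
Proof. exact: (@le_normcD R a b). Qed.

Lemma normc_Re a : `|complex.Re a| <= normc a.
Proof. by case: a => x y /=; rewrite -sqrtr_sqr ler_wsqrtr// lerDl sqr_ge0. Qed.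

Lemma normc_real (x : R) : normc x%:C = `|x|.
Proof. by rewrite /= expr0n addr0 sqrtr_sqr. Qed.

(** If |b| < |a| / 2, the term w b cannot cancel half of a, and any [x] does. Otherwise |a + w b| =
    |b| |w + a / b| is at least |b| |w - x| with x = - Re (a / b). *)
Lemma normc_affine_ge a b : 0 < Num.max (normc a) (normc b) -> exists x : R,
  forall w : R, 0 <= w -> w <= 1 ->
  Num.min 1 `|w - x| / 2 * Num.max (normc a) (normc b) <= normc (a + w%:C * b).
Proof.
move=> m0; have a0 := normc_ge0 a; have b0 := normc_ge0 b.
have [ba|ba] := ltP (normc b) (normc a / 2).
  exists 0 => w w0 w1; rewrite max_l; last by lra.
  have h : normc a <= normc (a + w%:C * b) + normc (w%:C * b).
    rewrite -{1}(addrK (w%:C * b) a) (le_trans (normcD_le _ _))// lerD2l.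
    by rewrite (@normcN R).
  rewrite normcM normc_real ger0_norm// in h.
  have h1 : w * normc b <= normc b by rewrite ler_piMl.
  have h2 : Num.min 1 `|w - 0| <= 1 by rewrite ge_min lexx.
  have := ler_wpM2r a0 h2; move: (Num.min _ _) => p h3; lra.
have bb : 0 < normc b.
  rewrite lt_neqAle b0 andbT; apply/negP => /eqP E; move: m0 ba; rewrite -E.
  by rewrite lt_max ltxx orbF => h1 h2; lra.
have bn0 : b != 0 by apply: contraTneq bb => ->; rewrite normc0 ltxx.
exists (- complex.Re (a / b)) => w w0 w1.
have -> : a + w%:C * b = (a / b + w%:C) * b by rewrite mulrDl divfK.
rewrite normcM; have h1 : Num.max (normc a) (normc b) <= 2 * normc b.
  by rewrite ge_max; apply/andP; split; lra.
have h2 : Num.min 1 `|w - - complex.Re (a / b)| <= normc (a / b + w%:C).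
  rewrite ge_min; apply/orP; right; rewrite opprK addrC.
  have -> : complex.Re (a / b) + w = complex.Re (a / b + w%:C) by case: (a / b).
  exact: normc_Re.
have p0 : 0 <= Num.min 1 `|w - - complex.Re (a / b)| by rewrite le_min ler01/=.
move: (Num.min _ _) p0 h2 => p p0 h2; move: (Num.max _ _) h1 => q h1.
have h3 := ler_wpM2l p0 h1; have h4 := ler_wpM2r b0 h2.
lra.
Qed.

Definition affmod a b (g w : R) : R := Num.max (normc (a + w%:C * b)) g.

Lemma affmod_ge0 a b g w : 0 <= affmod a b g w.
Proof. by rewrite le_max normc_ge0. Qed.

Lemma normc_sqrt (x : R[i]) : normc x = Num.sqrt (complex.Re x ^+ 2 + complex.Im x ^+ 2).
Proof. by case: x. Qed.

Lemma measurable_affmod a b g : measurable_fun [set: measurableTypeR R] (affmod a b g).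
Proof.
apply: measurable_maxr => //.
have -> : (fun w : R => normc (a + w%:C * b)) = fun w => Num.sqrt
   ((complex.Re a + w * complex.Re b) ^+ 2 + (complex.Im a + w * complex.Im b) ^+ 2).
  apply/funext => w; case: a b => [x y] [x' y']; rewrite normc_sqrt/= !mul0r subr0 addr0.
  by [].
apply: measurableT_comp; first by apply: continuous_measurable_fun; exact: sqrt_continuous.
by apply: measurable_funD; apply: measurable_funX; apply: measurable_funD => //; exact: measurable_funM.
Qed.

(** By [normc_affine_ge] the integrand falls below the logarithm of the maximum by at most ln 2 plus
    [neglog_dist x w], of mean at most 4. The loss depends on none of [a], [b], [g]. *)
Lemma log_average a b (g : R) : 0 <= g ->
  (elog (Num.max (Num.max (normc a) (normc b)) g) - (ln 2 + 4 : R)%:E <=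
   \int[unif]_w elog (affmod a b g w))%E.
Proof.
move=> g0.
have mU := measurable_itv `[0 : R, 1].
have mN : measurable_fun [set: measurableTypeR R] (fun w => elog (affmod a b g w)).
  exact: (measurableT_comp measurable_elog (measurable_affmod a b g)).
set m := Num.max (normc a) (normc b).
have uT : (@unif R setT < +oo)%E by rewrite unif_setT ltry.
have l2 : 0 < ln 2 :> R by rewrite ln_gt0// ltr1n.
have [m0|m0] := ltP 0 m; last first.
  have -> : elog (Num.max m g) = (\int[@unif R]_w elog (Num.max m g))%E.
    by rewrite integral_cst// unif_setT mule1.
  apply: (@le_trans _ _ (\int[@unif R]_w elog (Num.max m g))%E).
    by rewrite leeBlDr// leeDl// lee_fin; lra.
  apply: ae_le_integral => //; apply/aeW => w; apply: le_elog.
    by rewrite le_max g0 orbT.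
  by rewrite ge_max !le_max lexx (le_trans m0) ?orbT// normc_ge0.
have [x Hx] := normc_affine_ge m0.
have mg0 : 0 < Num.max m g by rewrite lt_max m0.
have mD : measurable_fun [set: measurableTypeR R] (neglog_dist x).
  apply: (measurableT_comp measurable_neglog); apply: measurableT_comp => //.
  exact: measurable_funB.
have n0 w : (0 <= neglog_dist x w)%E by exact: neglog_ge0.
apply: (@le_trans _ _ (\int[@unif R]_w ((ln (Num.max m g) - ln 2)%:E + - neglog_dist x w))%E); last first.
  apply: ae_le_integral => //.
    by apply: emeasurable_funD => //; exact: measurableT_comp.
  apply: (@ae_of_null _ _ _ (@unif R) `[0%R, 1%R]%classic).
  - exact: measurable_itv.
  - exact: unif_null.
  move=> w /=; rewrite in_itv/= => /andP[w0 w1].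
  rewrite /neglog_dist /neglog oppeK.
  set p := Num.min 1 `|w - x|.
  have p0 : 0 <= p by rewrite le_min ler01/=.
  have p1 : p <= 1 by rewrite ge_min lexx.
  have -> : ((ln (Num.max m g) - ln 2)%:E + elog p = elog (p / 2 * Num.max m g))%E.
    have h2 : 0 < 2^-1 :> R by rewrite invr_gt0.
    rewrite !elogM ?(ltW mg0) ?divr_ge0 ?(ltW h2)// (elogE h2) (elogE mg0) lnV ?posrE//.
    by rewrite -addeA -EFinD addeC [(- ln 2 + _)%R]addrC.
  apply: le_elog; first by rewrite mulr_ge0 ?(ltW mg0)// divr_ge0.
  rewrite /affmod le_max; have [gm|mg] := leP g m.
    by rewrite Hx.
  by apply/orP; right; rewrite ler_piMl//; lra.
rewrite integralD_ub; first last.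
- apply: (@ubi_bnd _ _ _ _ 0) => //; first exact: measurableT_comp.
  by apply/aeW => w; rewrite oppe_le0.
- exact: ubi_cst.
rewrite integral_cst// unif_setT mule1 integral_ge0N// (elogE mg0) -EFinB.
have := neglog_integral x; have : (0 <= \int[unif]_w neglog_dist x w)%E by exact: integral_ge0.
by case: (integral _ _ _) => [y| |]// _; rewrite lee_fin => y4; rewrite -EFinB lee_fin; lra.
Qed.

End polynomial_average.

Section polynomials.
Context {R : realType}.
Local Notation cpt := (R * R)%type.
Local Notation o := ((0, 0) : cpt).
Import Normc.
Local Open Scope complex_scope.
Implicit Types (P : {poly R[i]}) (Ps : seq {poly R[i]}) (z : cpt) (m : @cmeasure R).

Definition toC z : R[i] := z.1 +i* z.2.
Definition ofC (a : R[i]) : cpt := (complex.Re a, complex.Im a).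

Lemma normc_sub z a : normc (toC z - a) = cdist z (ofC a).
Proof. by case: a => x y; rewrite normc_sqrt. Qed.

Definition pmod P z : R := normc P.[toC z].

Lemma pmod_ge0 P z : 0 <= pmod P z. Proof. exact: normc_ge0. Qed.

Lemma measurable_horner P :
  measurable_fun setT (fun z => complex.Re P.[toC z]) /\
  measurable_fun setT (fun z => complex.Im P.[toC z]).
Proof.
elim/poly_ind: P => [|P c [IHr IHi]].
  rewrite (_ : (fun z => _) = cst 0); last by apply/funext => z; rewrite horner0.
  rewrite (_ : (fun z => _) = cst 0); last by apply/funext => z; rewrite horner0.
  by split.
rewrite (_ : (fun z => _) = (fun z => complex.Re P.[toC z] * z.1 - complex.Im P.[toC z] * z.2 + complex.Re c)); last first.
  by apply/funext => z; rewrite hornerMXaddC; case: (P.[_]) c => ? ? [].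
rewrite [X in _ /\ measurable_fun _ X](_ : _ = (fun z => complex.Re P.[toC z] * z.2 + complex.Im P.[toC z] * z.1 + complex.Im c)); last first.
  by apply/funext => z; rewrite hornerMXaddC; case: (P.[_]) c => ? ? [].
by split; apply: measurable_funD => //;
  [apply: measurable_funB|apply: measurable_funD]; apply: measurable_funM.
Qed.

Lemma measurable_pmod P : measurable_fun setT (pmod P).
Proof.
have [mr mi] := measurable_horner P.
rewrite (_ : pmod P = fun z => Num.sqrt (complex.Re P.[toC z] ^+ 2 + complex.Im P.[toC z] ^+ 2)).
  apply: measurableT_comp; first by apply: continuous_measurable_fun; exact: sqrt_continuous.
  by apply: measurable_funD; apply: measurable_funX.
by apply/funext => z; rewrite /pmod normc_sqrt.
Qed.

Lemma pmod_bound P (r : R) : exists2 L, 0 <= L & forall z, cdist o z <= r -> pmod P z <= L.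
Proof.
elim/poly_ind: P => [|P c [L L0 HL]].
  by exists 0 => // z _; rewrite /pmod horner0 normc0.
exists (L * `|r| + normc c); first by rewrite addr_ge0 ?mulr_ge0 ?normc_ge0.
move=> z zr; rewrite /pmod hornerMXaddC (le_trans (normcD_le _ _))// lerD2r normcM.
apply: ler_pM; rewrite ?normc_ge0//; first exact: HL.
by rewrite -[toC z]subr0 normc_sub cdistC (le_trans zr)// ler_norm.
Qed.

Fixpoint gmax Ps z : R := if Ps is P :: Ps' then Num.max (pmod P z) (gmax Ps' z) else 0.

Lemma gmax_ge0 Ps z : 0 <= gmax Ps z.
Proof. by elim: Ps => //= P Ps IH; rewrite le_max IH orbT. Qed.

Lemma measurable_gmax Ps : measurable_fun setT (gmax Ps).
Proof. by elim: Ps => //= P Ps IH; apply: measurable_maxr => //; exact: measurable_pmod. Qed.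

Lemma gmax_bound Ps (r : R) : exists2 L, 0 < L & forall z, cdist o z <= r -> gmax Ps z <= L.
Proof.
elim: Ps => [|P Ps [L L0 HL]]; first by exists 1.
have [L' L0' HL'] := pmod_bound P r.
exists (L + L'); first by rewrite ltr_pwDl.
move=> z zr /=; rewrite ge_max; have := HL z zr; have := HL' z zr => h1 h2.
by apply/andP; split; lra.
Qed.

Lemma measurable_elog_gmax Ps : measurable_fun setT (fun z => elog (gmax Ps z)).
Proof. exact: (measurableT_comp measurable_elog (measurable_gmax Ps)). Qed.

Definition in_disk (r : R) m := m (~` [set t | cdist o t <= r]) = 0%E.

Lemma measurable_cdisk (r : R) : measurable [set t : cpt | cdist o t <= r].
Proof. by apply: closed_measurable2; apply: closed_ler; exact: cdist_continuousr. Qed.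

Lemma ubi_elog m r (G : cpt -> R) (L : R) : m setT = 1%E -> in_disk r m ->
  measurable_fun setT G -> 0 < L -> (forall z, 0 <= G z) ->
  (forall z, cdist o z <= r -> G z <= L) -> ubi m (fun z => elog (G z)).
Proof.
move=> m1 mr mG L0 G0 GL; apply: (@ubi_bnd _ _ _ _ (ln L)).
- by rewrite m1 ltry.
- exact: (measurableT_comp measurable_elog mG).
- by apply: (ae_of_null (measurable_cdisk r) mr) => z /GL h; rewrite -elogE// le_elog.
Qed.

Lemma ubi_gmax m r Ps : m setT = 1%E -> in_disk r m -> ubi m (fun z => elog (gmax Ps z)).
Proof.
move=> m1 mr; have [L L0 HL] := gmax_bound Ps r.
by apply: (ubi_elog m1 mr (measurable_gmax Ps) L0) => // z; exact: gmax_ge0.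
Qed.

Definition rootprod (s : seq R[i]) z : R := \prod_(a <- s) cdist z (ofC a).

Lemma rootprod_ge0 s z : 0 <= rootprod s z.
Proof. by apply: prodr_ge0 => a _; exact: cdist_ge0. Qed.

Lemma ubi_cdist m r (a : cpt) : m setT = 1%E -> in_disk r m ->
  ubi m (fun z => elog (cdist z a)).
Proof.
move=> m1 mr; apply: (@ubi_elog m r _ (`|r| + cdist o a + 1)) => //.
- rewrite (_ : cdist ^~ a = cdist a); last by apply/funext => z; rewrite cdistC.
  by apply: continuous_measurable2; exact: cdist_continuousr.
- by rewrite ltr_wpDl// addr_ge0// cdist_ge0.
- by move=> z; exact: cdist_ge0.
- move=> z zr; have := cdist_triangle z o a; rewrite (cdistC z o).
  by have := ler_norm r; lra.
Qed.

Lemma potentialC m a : potential m a = (\int[m]_z elog (cdist z a))%E.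
Proof. by apply: eq_integral => z _; rewrite cdistC. Qed.

Lemma integral_rootprod m r s : m setT = 1%E -> in_disk r m ->
  ubi m (fun z => elog (rootprod s z)) /\
  (\int[m]_z elog (rootprod s z) = \sum_(a <- s) potential m (ofC a))%E.
Proof.
move=> m1 mr; elim: s => [|a s [IH1 IH2]].
  have E : (fun z => elog (rootprod [::] z)) = cst 0%E.
    by apply/funext => z; rewrite /rootprod big_nil elogE// ln1.
  rewrite E big_nil integral_cst// mul0e; split=> //.
  by apply: (@ubi_cst _ _ _ _ 0); rewrite m1 ltry.
have E : (fun z => elog (rootprod (a :: s) z)) =
    (fun z => elog (cdist z (ofC a)) + elog (rootprod s z))%E.
  apply/funext => z; rewrite /rootprod big_cons elogM ?cdist_ge0//.
  exact: rootprod_ge0.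
have ua := ubi_cdist (ofC a) m1 mr.
rewrite E; split; first exact: ubiD.
by rewrite integralD_ub// IH2 big_cons potentialC.
Qed.

Lemma pmod_rootprod P : exists2 s : seq R[i], size P = (size s).+1 \/ P = 0 &
  forall z, pmod P z = normc (lead_coef P) * rootprod s z.
Proof.
have [s E] := closed_field_poly_normal P; exists s.
  have [->|P0] := eqVneq P 0; [by right|left].
  by rewrite E size_scale ?lead_coef_eq0// size_prod_XsubC.
move=> z; rewrite /pmod {1}E hornerZ normcM; congr (_ * _).
rewrite /rootprod horner_prod; elim: (s) => [|a s' IH].
  by rewrite !big_nil normc1.
by rewrite !big_cons normcM IH hornerXsubC normc_sub.
Qed.

Variables (mu nu : @cmeasure R) (r s : R) (n : nat).
Hypotheses (mu1 : mu setT = 1%E) (nu1 : nu setT = 1%E).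
Hypotheses (mur : in_disk r mu) (nur : in_disk r nu).
Hypothesis s0 : 0 <= s.
Hypothesis domin : forall a, (potential nu a <= potential mu a + s%:E)%E.

Let muT : (mu setT < +oo)%E. Proof. by rewrite mu1 ltry. Qed.
Let nuT : (nu setT < +oo)%E. Proof. by rewrite nu1 ltry. Qed.

(** Up to a common constant, the integral of log |P| is the sum of the potentials at the roots. The
    domination hypothesis is used once per root, and as [s] is nonnegative at most n roots cost at
    most n s. *)
Lemma log_poly_le P : (size P <= n.+1)%N ->
  (\int[nu]_z elog (pmod P z) <= \int[mu]_z elog (pmod P z) + (n%:R * s)%:E)%E.
Proof.
move=> Pn; have [rs srs Prs] := pmod_rootprod P.
have [P0|P0] := eqVneq P 0.
  rewrite (eq_integral (fun=> -oo%E)); last first.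
    by move=> z _; rewrite Prs P0 lead_coef0 normc0 mul0r elog0.
  by rewrite integral_cst// nu1 mule1 leNye.
have {}srs : size P = (size rs).+1 by case: srs => // E; rewrite E eqxx in P0.
have c0 : 0 < normc (lead_coef P).
  rewrite lt_neqAle normc_ge0 andbT eq_sym; apply/negP => /eqP/eq0_normc/eqP.
  by rewrite lead_coef_eq0 (negbTE P0).
have E (m : @cmeasure R) : m setT = 1%E -> in_disk r m ->
    (\int[m]_z elog (pmod P z) =
     (ln (normc (lead_coef P)))%:E + \sum_(a <- rs) potential m (ofC a))%E.
  move=> m1 mr; have [u <-] := integral_rootprod rs m1 mr.
  rewrite (eq_integral (fun z => (ln (normc (lead_coef P)))%:E + elog (rootprod rs z)))%E.
    rewrite integralD_ub//; last by apply: ubi_cst; rewrite m1 ltry.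
    by rewrite integral_cst// m1 mule1.
  by move=> z _; rewrite Prs elogM ?(ltW c0) ?rootprod_ge0// (elogE c0).
rewrite !E// -addeA leeD2l//.
have {}srs : (size rs <= n)%N by rewrite srs ltnS in Pn.
apply: (@le_trans _ _ (\sum_(a <- rs) potential mu (ofC a) + ((size rs)%:R * s)%:E)%E); last first.
  by rewrite leeD2l// lee_fin ler_wpM2r// ler_nat.
elim: (rs) => [|a rs' IH]; first by rewrite !big_nil mul0r adde0.
rewrite !big_cons; apply: le_trans (leeD (domin _) IH) _.
by rewrite addeACA -EFinD /= -[(size rs').+1%:R]natr1 mulrDl mul1r [(s + _)%R]addrC.
Qed.

(* For the induction step, [P] and [Q] are replaced by [P + w Q]; averaging over [w]
   costs a constant that does not depend on the degree [n]. *)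
Lemma log_gmax_le k : forall P Ps, size Ps = k -> (size P <= n.+1)%N ->
  all (fun Q : {poly R[i]} => size Q <= n.+1)%N Ps ->
  (\int[nu]_z elog (gmax (P :: Ps) z) <=
   \int[mu]_z elog (gmax (P :: Ps) z) + (n%:R * s + k%:R * (2 * ln 2 + 4))%:E)%E.
Proof.
elim: k => [|k IH] P Ps.
  move=> /size0nil -> Pn _; rewrite mul0r addr0 /=.
  have E z : Num.max (pmod P z) 0 = pmod P z by rewrite max_l// pmod_ge0.
  under eq_integral do rewrite E; under [X in (_ <= X + _)%E]eq_integral do rewrite E.
  exact: log_poly_le.
case: Ps => // Q Ps [sk] Pn /= /andP[Qn Psn].
pose f (x : cpt * R) := elog (affmod P.[toC x.1] Q.[toC x.1] (gmax Ps x.1) x.2).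
have fE z w : f (z, w) = elog (gmax ((P + w%:C *: Q) :: Ps) z).
  by rewrite /f /affmod /= /pmod hornerD hornerZ.
have [mPr mPi] := measurable_horner P; have [mQr mQi] := measurable_horner Q.
have mf : measurable_fun setT (f : cpt * measurableTypeR R -> \bar R).
  apply: (measurableT_comp measurable_elog); apply: measurable_maxr; last first.
    exact: (measurableT_comp (measurable_gmax Ps) measurable_fst).
  rewrite (_ : (fun x => _) = fun x : cpt * measurableTypeR R => Num.sqrt
   ((complex.Re P.[toC x.1] + (x.2 : R) * complex.Re Q.[toC x.1]) ^+ 2 +
    (complex.Im P.[toC x.1] + (x.2 : R) * complex.Im Q.[toC x.1]) ^+ 2)); last first.
    apply/funext => x; case: (P.[_]) (Q.[_]) => [a b] [a' b'].
    by rewrite normc_sqrt/= !mul0r subr0 addr0.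
  apply: measurableT_comp; first by apply: continuous_measurable_fun; exact: sqrt_continuous.
  by apply: measurable_funD; apply: measurable_funX; apply: measurable_funD;
    [exact: (measurableT_comp mPr measurable_fst)
    |apply: measurable_funM; [exact: measurable_snd|exact: (measurableT_comp mQr measurable_fst)]
    |exact: (measurableT_comp mPi measurable_fst)
    |apply: measurable_funM; [exact: measurable_snd|exact: (measurableT_comp mQi measurable_fst)]].
set G := gmax (P :: Q :: Ps).
have G0 z : 0 <= G z by exact: gmax_ge0.
have aff_le z w : 0 <= w -> w <= 1 -> affmod P.[toC z] Q.[toC z] (gmax Ps z) w <= 2 * G z.
  move=> w0 w1; have PG : pmod P z <= G z by rewrite /G/= le_max lexx.
  have QG : pmod Q z <= G z by rewrite /G/= !le_max lexx orbT.
  have gG : gmax Ps z <= G z by rewrite /G/= !le_max lexx !orbT.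
  rewrite /affmod ge_max; apply/andP; split; last by have := G0 z; lra.
  apply: (le_trans (normcD_le _ _)); rewrite normcM normc_real ger0_norm//.
  have : w * normc Q.[toC z] <= normc Q.[toC z] by rewrite ler_piMl// normc_ge0.
  by move: PG QG; rewrite /pmod; lra.
set c := (n%:R * s + k%:R * (2 * ln 2 + 4))%R.
(* This ln 2 comes from |P + w Q| <= 2 G on the side of [mu]; [log_average] adds ln 2 + 4 on the
   side of [nu]. Hence the increment [2 * ln 2 + 4] of the statement. *)
pose X := (\int[mu]_z elog (G z) + (ln 2 + c)%:E)%E.
have G2 z : (elog (2 * G z) = (ln 2)%:E + elog (G z))%E.
  by rewrite elogM//; congr (_ + _)%E; rewrite elogE// ltr0n.
have uG (m : @cmeasure R) : m setT = 1%E -> in_disk r m -> ubi m (fun z => elog (G z)).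
  by move=> m1 mr; exact: (ubi_gmax (P :: Q :: Ps) m1 mr).
have A w : 0 <= w -> w <= 1 -> (\int[nu]_z f (z, w) <= X)%E.
  move=> w0 w1; under eq_integral do rewrite fE.
  have PQn : (size (P + w%:C *: Q)%R <= n.+1)%N.
    by rewrite (leq_trans (size_polyD _ _))// geq_max Pn (leq_trans (size_scale_leq _ _)).
  apply: le_trans (IH _ _ sk PQn Psn) _.
  rewrite /X -/c (EFinD (ln 2) c) addeA leeD2r//.
  rewrite [leRHS](_ : _ = \int[mu]_z ((ln 2)%:E + elog (G z)))%E; last first.
    rewrite integralD_ub//; [|exact: ubi_cst|exact: uG].
    by rewrite integral_cst// mu1 mule1 addeC.
  have [mG _] := uG _ mu1 mur.
  apply: ae_le_integral.
  - exact: measurable_elog_gmax.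
  - exact: emeasurable_funD.
  - apply/aeW => z; rewrite -G2 -fE; apply: le_elog; first exact: affmod_ge0.
    exact: aff_le.
have mU : measurable (`[0%R, 1%R]%classic : set (measurableTypeR R)) by exact: measurable_itv.
have uT : (@unif R setT < +oo)%E by rewrite unif_setT ltry.
have [L L0 HL] := gmax_bound (P :: Q :: Ps) r.
have fL z w : [set t : cpt | cdist o t <= r] z -> (`[0%R, 1%R]%classic : set (measurableTypeR R)) w ->
    (f (z, w) <= (ln (2 * L))%:E)%E.
  move=> /= zr; rewrite in_itv/= => /andP[w0 w1].
  rewrite -elogE ?mulr_gt0// le_elog ?affmod_ge0// (le_trans (aff_le _ _ _ _))// ler_pM2l//.
  exact: HL.
have ton := ub_tonelli mf nuT uT (measurable_cdisk r) mU nur (@unif_null R) fL.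
have le1 : (\int[unif]_w \int[nu]_z f (z, w) <= X)%E.
  rewrite -[leRHS]mule1 -(@unif_setT R) -integral_cst//; apply: ae_le_integral => //.
    apply: (measurable_integral2 (f := fun x : measurableTypeR R * cpt => f (x.2, x.1))) => //.
    by apply: (measurableT_comp mf); exact: measurable_swap.
  apply: (@ae_of_null _ _ _ (@unif R) `[0%R, 1%R]%classic) => //; first exact: unif_null.
  by move=> w /=; rewrite in_itv/= => /andP[]; exact: A.
have le2 : (\int[nu]_z elog (G z) - (ln 2 + 4)%:E <= \int[nu]_z \int[unif]_w f (z, w))%E.
  rewrite -EFinN -[X in (_ + X <= _)%E]mule1 -nu1 -(integral_cst nu measurableT).
  have [mG _] := uG _ nu1 nur.
  rewrite -integralD_ub//; [|exact: uG|exact: ubi_cst].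
  apply: ae_le_integral.
  - exact: emeasurable_funD.
  - exact: measurable_integral2.
  - apply/aeW => z; rewrite EFinN.
    have := log_average P.[toC z] Q.[toC z] (gmax_ge0 Ps z).
    by rewrite /G/= maxA.
rewrite -[X in (X <= _)%E]/(\int[nu]_z elog (G z))%E -[X in (_ <= X + _)%E]/(\int[mu]_z elog (G z))%E.
have := le_trans le2; rewrite ton => /(_ _ le1); rewrite /X leeBlDr//.
move=> /le_trans; apply; rewrite -addeA -EFinD leeD2l// lee_fin.
by rewrite /c -natr1; lra.
Qed.

End polynomials.

(** * Upper bound *)

Section farthest_distance.
Context {R : realType}.
Local Notation cpt := (R * R)%type.
Local Notation o := ((0, 0) : cpt).
Implicit Types (z t : cpt).

Lemma finite_net (K : set cpt) (e : R) : compact K -> 0 < e ->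
  exists2 ts : seq cpt, (forall t, t \in ts -> K t) &
    forall z, K z -> exists2 t, t \in ts & cdist t z < e.
Proof.
move=> cK e0; pose T : ptopologicalType := HB.pack cpt (isPointed.Build cpt o).
have : @cover_compact T K by rewrite -(@compact_cover T).
move=> /(_ _ K (fun t => disk t e)); case=> [t _|z Kz|D' D'K KD'].
- exact: open_disk.
- by exists z => //; rewrite /disk/= cdistxx.
- exists (finmap.enum_fset D').
    by move=> t tD'; apply: set_mem; apply: D'K.
  by move=> z /KD'[t /= tD' zt]; exists t.
Qed.

Variable E : set cpt.
Variable rE : R.
Hypothesis ErE : forall z, E z -> cdist o z <= rE.
Hypothesis E0 : E !=set0.

Lemma has_sup_cdist z : has_sup [set cdist z t | t in E].
Proof.
split; first by have [t Et] := E0; exists (cdist z t), t.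
exists (cdist o z + rE) => _ [t Et <-].
by have := cdist_triangle z o t; rewrite (cdistC z o); have := ErE Et; lra.
Qed.

Lemma le_dE z t : E t -> cdist z t <= dE E z.
Proof. by move=> Et; apply: sup_upper_bound; [exact: has_sup_cdist|exists t]. Qed.

Lemma dE_le z (a : R) : (forall t, E t -> cdist z t <= a) -> dE E z <= a.
Proof.
move=> H; apply: sup_le_ub; first by have [] := has_sup_cdist z.
by move=> _ [t Et <-]; exact: H.
Qed.

Lemma dE_ge0 z : 0 <= dE E z.
Proof. by have [t Et] := E0; exact: le_trans (cdist_ge0 _ _) (le_dE z Et). Qed.

Lemma dE_lip z w : dE E w <= dE E z + cdist z w.
Proof.
apply: dE_le => t Et; have := cdist_triangle w z t; have := le_dE z Et.
by rewrite (cdistC w z); lra.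
Qed.

Lemma measurable_dE : measurable_fun setT (dE E).
Proof.
apply: continuous_measurable2; apply: (@lip_continuous _ _ 1) => z w.
by rewrite mul1r dE_lip.
Qed.

Lemma measurable_log_dE : measurable_fun setT (fun z => elog (dE E z)).
Proof. exact: (measurableT_comp measurable_elog measurable_dE). Qed.

Lemma dE_ge (a b : cpt) z : E a -> E b -> cdist a b / 2 <= dE E z.
Proof.
move=> Ea Eb; have := le_dE z Ea; have := le_dE z Eb; have := cdist_triangle a z b.
by rewrite (cdistC a z); lra.
Qed.

Lemma dE_bound z : dE E z <= cdist o z + rE.
Proof.
apply: dE_le => t Et; have := cdist_triangle z o t; rewrite (cdistC z o).
by have := ErE Et; lra.
Qed.

End farthest_distance.

Section net_distance.
Context {R : realType}.
Local Notation cpt := (R * R)%type.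
Local Notation o := ((0, 0) : cpt).
Import Normc.
Local Open Scope complex_scope.

Definition netdist (ts : seq cpt) (z : cpt) : R := foldr (fun t m => Num.max (cdist z t) m) 0 ts.

Lemma netdist_ge0 ts z : 0 <= netdist ts z.
Proof. by elim: ts => //= t ts IH; rewrite le_max IH orbT. Qed.

Lemma le_netdist ts z t : t \in ts -> cdist z t <= netdist ts z.
Proof.
elim: ts => //= u ts IH; rewrite inE => /predU1P[->|/IH h]; first by rewrite le_max lexx.
by rewrite le_max h orbT.
Qed.

Lemma netdist_le ts z (a : R) : 0 <= a -> (forall t, t \in ts -> cdist z t <= a) -> netdist ts z <= a.
Proof.
move=> a0; elim: ts => //= u ts IH H; rewrite ge_max H ?mem_head//=.
by apply: IH => t tts; apply: H; rewrite inE tts orbT.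
Qed.

Lemma measurable_netdist ts : measurable_fun setT (netdist ts).
Proof.
elim: ts => [|t ts IH] /=; first exact: measurable_cst.
rewrite (_ : netdist _ = fun z => Num.max (cdist t z) (netdist ts z)); last first.
  by apply/funext => z; rewrite cdistC.
by apply: measurable_maxr => //; apply: continuous_measurable2; exact: cdist_continuousr.
Qed.

(** With powers, the maximum of the moduli over the net is exactly the n-th power of [netdist], so
    the degree can be divided out. *)
Definition netpoly (n : nat) (t : cpt) : {poly R[i]} := ('X - (toC t)%:P) ^+ n.

Lemma size_netpoly n t : size (netpoly n t) = n.+1.
Proof. by rewrite size_exp_XsubC. Qed.

Lemma pmod_netpoly n t z : pmod (netpoly n t) z = cdist z t ^+ n.
Proof.
rewrite /pmod /netpoly hornerE; elim: n => [|n IH]; first by rewrite !expr0 normc1.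
by rewrite !exprS normcM IH !hornerE normc_sub; case: (t).
Qed.

Lemma gmax_netpoly n ts z : (0 < n)%N -> gmax [seq netpoly n t | t <- ts] z = netdist ts z ^+ n.
Proof.
move=> n0; elim: ts => [|t ts IH] /=; first by rewrite expr0n eqn0Ngt n0.
rewrite IH pmod_netpoly; have h0 := netdist_ge0 ts z; have c0 := cdist_ge0 z t.
have [h|h] := leP (cdist z t) (netdist ts z).
  by rewrite max_r// lerXn2r.
by rewrite max_l// lerXn2r// ltW.
Qed.

Variables (mu nu : @cmeasure R) (r s : R).
Hypotheses (mu1 : mu setT = 1%E) (nu1 : nu setT = 1%E).
Hypotheses (mur : in_disk r mu) (nur : in_disk r nu).
Hypothesis s0 : 0 <= s.
Hypothesis domin : forall a, (potential nu a <= potential mu a + s%:E)%E.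

(** For n-th powers [log_gmax_le] reads n x <= n y + n s + c, with c depending only on the number of
    points; a large n then gives x <= y + s. The lower bound [d] keeps the integrals x and y
    finite. *)
Lemma log_netdist_le (ts : seq cpt) (d : R) : 0 < d -> (forall z, d <= netdist ts z) ->
  (\int[nu]_z elog (netdist ts z) <= \int[mu]_z elog (netdist ts z) + s%:E)%E.
Proof.
move=> d0 dts.
have p0 z : 0 < netdist ts z := lt_le_trans d0 (dts z).
case: ts dts p0 => [|t ts] dts p0; first by have := p0 o; rewrite /= ltxx.
set D := netdist (t :: ts); rewrite -/D in dts p0 *.
have logE z n : (0 < n)%N -> elog (gmax [seq netpoly n t | t <- t :: ts] z) = (n%:R%:E * elog (D z))%E.
  move=> n0; rewrite gmax_netpoly// -/D !elogE ?exprn_gt0//.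
  by rewrite lnXn// -EFinM mulr_natl.
have mD : measurable_fun setT (fun z => elog (D z)).
  have := measurable_elog_gmax [seq netpoly 1 t | t <- t :: ts].
  rewrite (_ : (fun z => _) = (fun z => elog (D z)))//.
  by apply/funext => z; rewrite logE// mul1e.
have [L L0 HL] : exists2 L, 0 < L & forall z, cdist o z <= r -> D z <= L.
  have [L L0 HL] := gmax_bound [seq netpoly 1 t | t <- t :: ts] r.
  by exists L => // z zr; have := HL z zr; rewrite gmax_netpoly.
have fin (m : @cmeasure R) : m setT = 1%E -> in_disk r m -> (\int[m]_z elog (D z))%E \is a fin_num.
  move=> m1 mr.
  have lo : ((ln d)%:E <= \int[m]_z elog (D z))%E.
    rewrite -[leLHS]mule1 -m1 -(integral_cst m measurableT); apply: ae_le_integral => //.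
    by apply/aeW => z; rewrite -elogE// le_elog// ltW.
  have hi : (\int[m]_z elog (D z) <= (ln L)%:E)%E.
    rewrite -[leRHS]mule1 -m1 -(integral_cst m measurableT); apply: ae_le_integral => //.
    apply: (ae_of_null (measurable_cdisk r) mr) => z zr; rewrite -elogE// le_elog ?(ltW (p0 _))//.
    exact: HL.
  by rewrite fin_numElt (lt_le_trans _ lo) ?ltNyr// (le_lt_trans hi)// ltry.
have Zint (m : @cmeasure R) n : m setT = 1%E -> in_disk r m ->
   (\int[m]_z (n%:R%:E * elog (D z)) = n%:R%:E * \int[m]_z elog (D z))%E.
  move=> m1 mr; have ub : ubi m (fun z => elog (D z)).
    apply: (@ubi_bnd _ _ _ _ (ln L)) => //; first by rewrite m1 ltry.
    apply: (ae_of_null (measurable_cdisk r) mr) => z zr; rewrite -elogE// le_elog ?(ltW (p0 _))//.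
    exact: HL.
  have nE k (x : \bar R) : (k.+1%:R%:E * x = x + k%:R%:E * x)%E.
    by rewrite -natr1 EFinD ge0_muleDl ?lee_fin// mul1e addeC.
  suff [] : ubi m (fun z => n%:R%:E * elog (D z))%E /\
    (\int[m]_z (n%:R%:E * elog (D z)) = n%:R%:E * \int[m]_z elog (D z))%E by [].
  elim: n => [|n [IH1 IH2]].
    under eq_fun do rewrite mul0e; split; first by apply: (@ubi_cst _ _ _ _ 0); rewrite m1 ltry.
    by rewrite integral0 mul0e.
  under eq_fun do rewrite nE; split; first exact: ubiD.
  by rewrite integralD_ub// IH2 nE.
pose x := fine (\int[nu]_z elog (D z)); pose y := fine (\int[mu]_z elog (D z)).
rewrite -(fineK (fin _ nu1 nur)) -(fineK (fin _ mu1 mur)) -/x -/y -EFinD lee_fin.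
set c : R := (size ts)%:R * (2 * ln 2 + 4).
have H n : (0 < n)%N -> n%:R * x <= n%:R * y + (n%:R * s + c).
  move=> n0; have := @log_gmax_le _ mu nu r s n mu1 nu1 mur nur s0 domin (size ts)
    (netpoly n t) [seq netpoly n t | t <- ts].
  rewrite size_map size_netpoly => /(_ erefl (leqnn _)).
  have -> : all (fun Q : {poly R[i]} => size Q <= n.+1)%N [seq netpoly n t | t <- ts].
    by rewrite all_map; apply/allP => u _ /=; rewrite size_netpoly.
  move=> /(_ isT).
  under eq_integral do rewrite logE//; under [X in (_ <= X + _)%E -> _]eq_integral do rewrite logE//.
  by rewrite !Zint// -(fineK (fin _ nu1 nur)) -(fineK (fin _ mu1 mur)) -!EFinM -EFinD lee_fin.
rewrite leNgt; apply/negP => xy.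
have e0 : 0 < x - y - s by lra.
have c0 : 0 <= c by rewrite mulr_ge0// addr_ge0// mulr_ge0// ln_ge0// ler1n.
have := archi_boundP (divr_ge0 c0 (ltW e0)); set n := Num.bound _.
rewrite ltr_pdivrMr// => hn.
have n0 : (0 < n)%N by rewrite lt0n; apply/eqP => n0; move: hn; rewrite n0 mul0r; lra.
have := H n n0; rewrite !mulrBr in hn; lra.
Qed.
End net_distance.

Section upper_bound.
Context {R : realType}.
Local Notation cpt := (R * R)%type.
Local Notation o := ((0, 0) : cpt).

Lemma in_diskW (r r' : R) (m : @cmeasure R) : r <= r' -> in_disk r m -> in_disk r' m.
Proof.
move=> rr h; apply: (subset_measure0 _ _ _ h).
- by apply: measurableC; exact: measurable_cdisk.
- by apply: measurableC; exact: measurable_cdisk.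
- by apply: subsetC => z /= zr; exact: le_trans rr.
Qed.

Lemma family_disk m (nu : 'I_m -> @cmeasure R) : (forall j, compactly_supported (nu j)) ->
  exists2 r, 0 < r & forall j, in_disk r (nu j).
Proof.
move=> H; have /choice[r rP] : forall j, exists r, in_disk r (nu j).
  move=> j; have [K [cK K0]] := H j; have [r r0 Kr] := compact_bounded_disk cK.
  exists r; apply: (subset_measure0 _ _ _ K0).
  - by apply: measurableC; exact: measurable_cdisk.
  - by apply: measurableC; exact: compact_measurable2.
  - exact: subsetC.
exists (1 + \sum_j `|r j|); first by rewrite ltr_wpDr// sumr_ge0.
move=> j; apply: in_diskW (rP j); rewrite (bigD1 j)//=.
have : 0 <= \sum_(i < m | i != j) `|r i| by rewrite sumr_ge0.
by have := ler_norm (r j); lra.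
Qed.

(** [msum] takes a sequence indexed by all natural numbers, so the family is extended by the zero
    measure. *)
Definition fsum m (nu : 'I_m -> @cmeasure R) : @cmeasure R :=
  msum (fun k => if insub k is Some i then nu i else (mzero : @cmeasure R)) m.

Lemma fsumE m (nu : 'I_m -> @cmeasure R) A : (fsum nu A = \sum_(j < m) nu j A)%E.
Proof.
rewrite /fsum /msum; apply: eq_bigr => j _.
by rewrite valK.
Qed.

Lemma integral_fsum m (nu : 'I_m -> @cmeasure R) f :
  measurable_fun setT f -> (forall j, ubi (nu j) f) ->
  (\int[fsum nu]_x f x = \sum_(j < m) \int[nu j]_x f x)%E.
Proof.
move=> mf H.
have [|_ ->] := @integral_msum_ub _ _ _ (fun k => if insub k is Some i then nu i else mzero) m f mf.
  by move=> k km; rewrite (insubT (fun k => k < m)%N km); exact: H.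
by apply: eq_bigr => j _; rewrite valK.
Qed.

Variables (E : set cpt) (mu : @cmeasure R).
Hypothesis cE : compact E.
Hypothesis cap0 : 0 < cap E.
Hypothesis eqmu : equilibrium_measure E mu.
Variable rE : R.
Hypothesis ErE : forall z, E z -> cdist o z <= rE.

Let pmu : prob_on E mu := eqmu.1.
Let mu1 : mu setT = 1%E := pmu.1.
Let muE : mu (~` E) = 0%E := pmu.2.
Let mE : measurable E := compact_measurable2 cE.

Lemma equilibrium_neq0 : E !=set0.
Proof.
apply/set0P/eqP => E0; have := muE; rewrite E0 setC0 mu1 => /eqP.
by rewrite onee_eq0.
Qed.

(** Positive capacity excludes a one-point set: [mu] would be concentrated there and its potential
    would be [-oo] at that point, against [potential_ge]. Given two points of [E], every z is at
    distance at least half of theirs from one of them. *)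
Lemma dE_pos : exists2 d, 0 < d & forall z, d <= dE E z.
Proof.
have [a Ea] := equilibrium_neq0.
have [[b Eb ab]|H] := pselect (exists2 b, E b & b != a).
  exists (cdist a b / 2); last by move=> z; exact: (dE_ge ErE equilibrium_neq0).
  rewrite divr_gt0// lt_neqAle cdist_ge0 andbT eq_sym; apply/eqP => /cdist_eq0.
  by move=> /esym/eqP; exact/negP.
exfalso; have := potential_ge cE cap0 eqmu ErE a.
rewrite /potential leNgt => /negP; apply.
apply: (@le_lt_trans _ _ (\int[mu]_t -oo)%E); last by rewrite integral_cst// mu1 mule1 ltNyr.
apply: ae_le_integral => //; first exact: measurable_log_cdist.
apply: (ae_of_null mE muE) => t Et; have -> : t = a.
  by apply/eqP/negPn/negP => ta; apply: H; exists t.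
by rewrite cdistxx elog0.
Qed.

Lemma mu_disk : in_disk rE mu.
Proof.
apply: (subset_measure0 _ _ _ muE).
- by apply: measurableC; exact: measurable_cdisk.
- exact: measurableC.
- exact: subsetC.
Qed.

Lemma log_dE_fin (m : @cmeasure R) r : m setT = 1%E -> in_disk r m ->
  (\int[m]_z elog (dE E z))%E \is a fin_num.
Proof.
move=> m1 mr; have [d d0 dd] := dE_pos; have mdE := measurable_log_dE ErE equilibrium_neq0.
have lo : ((ln d)%:E <= \int[m]_z elog (dE E z))%E.
  rewrite -[leLHS]mule1 -m1 -(integral_cst m measurableT); apply: ae_le_integral => //.
  by apply/aeW => z; rewrite -elogE// le_elog// ltW.
have L0 z : cdist o z <= r -> 0 < r + rE.
  by move=> zr; have := lt_le_trans d0 (le_trans (dd z) (dE_bound ErE equilibrium_neq0 z)); lra.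
have hi : (\int[m]_z elog (dE E z) <= (ln (r + rE))%:E)%E.
  rewrite -[leRHS]mule1 -m1 -(integral_cst m measurableT); apply: ae_le_integral => //.
  apply: (ae_of_null (measurable_cdisk r) mr) => z zr; rewrite -elogE ?(L0 z)//.
  apply: le_elog; first exact: (dE_ge0 ErE equilibrium_neq0).
  by apply: le_trans (dE_bound ErE equilibrium_neq0 z) _; rewrite lerD2r.
by rewrite fin_numElt (lt_le_trans _ lo) ?ltNyr// (le_lt_trans hi)// ltry.
Qed.

Lemma log_dE_le (nu : @cmeasure R) r s : nu setT = 1%E -> in_disk r nu -> 0 <= s ->
  (forall a, (potential nu a <= potential mu a + s%:E)%E) ->
  (\int[nu]_z elog (dE E z) <= \int[mu]_z elog (dE E z) + s%:E)%E.
Proof.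
move=> nu1 nur s0 domin; apply/lee_addgt0Pr => e e0.
have [d d0 dd] := dE_pos; have E0 := equilibrium_neq0.
(* The first bound keeps [netdist] at least d / 2; the second gives ln (netdist + k) <= ln netdist +
   e. *)
pose k := Num.min (d / 2) (e * (d / 2)).
have k0 : 0 < k by rewrite lt_min divr_gt0//= mulr_gt0// divr_gt0.
have [kd ke] : k <= d / 2 /\ k <= e * (d / 2).
  by split; rewrite /k ge_min lexx ?orbT.
have [ts tsE tsn] := finite_net cE k0.
have le_net z : netdist ts z <= dE E z.
  apply: netdist_le; first exact: (dE_ge0 ErE E0).
  by move=> t /tsE; exact: (le_dE ErE E0).
have net_le z : dE E z <= netdist ts z + k.
  apply: (dE_le ErE E0) => t /tsn[u uts ut].
  by have := le_netdist z uts; have := cdist_triangle z u t; lra.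
have netd z : d / 2 <= netdist ts z by have := net_le z; have := dd z; lra.
have d20 : 0 < d / 2 by rewrite divr_gt0.
pose r1 := Num.max r rE.
have nur1 : in_disk r1 nu by apply: in_diskW nur; rewrite le_max lexx.
have mur1 : in_disk r1 mu by apply: in_diskW mu_disk; rewrite le_max lexx orbT.
have N := log_netdist_le mu1 nu1 mur1 nur1 s0 domin d20 netd.
have mdE := measurable_log_dE ErE E0.
have mnet : measurable_fun setT (fun z => elog (netdist ts z)).
  exact: (measurableT_comp measurable_elog (measurable_netdist ts)).
have pnet z : 0 < netdist ts z := lt_le_trans d20 (netd z).
have A : (\int[nu]_z elog (dE E z) <= \int[nu]_z elog (netdist ts z) + e%:E)%E.
  rewrite -[X in (_ <= _ + X)%E]mule1 -nu1 -(integral_cst nu measurableT).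
  rewrite -integralD_ub; last 2 first.
  - apply: ubi_le mnet (_ : ubi nu (fun z => elog (dE E z))) _; last first.
      by apply/aeW => z; apply: le_elog => //; exact: netdist_ge0.
    apply: (@ubi_elog _ nu r _ (`|r| + `|rE| + 1)) => //.
    + exact: (measurable_dE ErE E0).
    + exact: (dE_ge0 ErE E0).
    + move=> z zr; have := dE_bound ErE E0 z.
      by have := ler_norm r; have := ler_norm rE; lra.
  - by apply: ubi_cst; rewrite nu1 ltry.
  apply: ae_le_integral => //; first exact: emeasurable_funD.
  apply/aeW => z; rewrite !elogE//; last exact: lt_le_trans (le_net z).
  rewrite -EFinD lee_fin; apply: (@le_trans _ _ (ln (netdist ts z + k))).
    rewrite ler_ln ?posrE//; first exact: lt_le_trans (le_net z).
    by rewrite addr_gt0.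
  apply: le_trans (ln_addr_le d20 (netd z) (ltW k0)) _.
  by rewrite lerD2l ler_pdivrMr.
apply: le_trans A _; rewrite leeD2r//; apply: le_trans N _; rewrite leeD2r//.
apply: ae_le_integral => //; apply/aeW => z; apply: le_elog => //; exact: netdist_ge0.
Qed.

Lemma sup_ineq_CE m (nu : 'I_m -> cmeasure) : admissible_family nu -> sup_ineq E (CE E mu) nu.
Proof.
move=> [supp mass1]; have [r r0 nur] := family_disk supp.
have E0 := equilibrium_neq0.
have mdE := measurable_log_dE ErE E0.
pose sg := fsum nu.
have sg1 : sg setT = 1%E by rewrite /sg fsumE mass1.
have sgr : in_disk r sg by rewrite /in_disk /sg fsumE big1// => j _; exact: nur.
have nuT j : (nu j setT < +oo)%E.
  apply: (@le_lt_trans _ _ 1%E); last by rewrite ltry.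
  by rewrite -mass1 (bigD1 j)//= leeDl// sume_ge0.
have dEub z : cdist o z <= r -> (elog (dE E z) <= (ln (r + `|rE| + 1))%:E)%E.
  move=> zr; rewrite -elogE; last by have := normr_ge0 rE; lra.
  apply: le_elog; first exact: (dE_ge0 ErE E0).
  by have := dE_bound ErE E0 z; have := ler_norm rE; lra.
have udE j : ubi (nu j) (fun z => elog (dE E z)).
  apply: (ubi_bnd (nuT j) mdE (L := ln (r + `|rE| + 1))).
  exact: ae_of_null (measurable_cdisk r) (nur j) dEub.
have uc z j : ubi (nu j) (fun t => elog (cdist z t)).
  apply: (ubi_bnd (nuT j) (measurable_log_cdist z) (L := ln (r + cdist o z + 1))).
  apply: ae_of_null (measurable_cdisk r) (nur j) _ => t tr.
  rewrite -elogE; last by have := cdist_ge0 o z; lra.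
  apply: le_elog; first exact: cdist_ge0.
  by move: tr => /=; have := cdist_triangle z o t; rewrite (cdistC z o); lra.
have psg z : potential sg z = (\sum_(j < m) potential (nu j) z)%E.
  by rewrite /potential /sg integral_fsum//; exact: measurable_log_cdist.
rewrite /sup_ineq.
have L1 : (\sum_(j < m) supE E (potential (nu j)) <= \int[sg]_z elog (dE E z))%E.
  rewrite /sg integral_fsum//; apply: lee_sum => j _.
  apply: ge_ereal_sup => _ [z Ez <-]; apply: ae_le_integral => //.
    exact: measurable_log_cdist.
  apply/aeW => t; apply: le_elog; first exact: cdist_ge0.
  by rewrite cdistC; exact: (le_dE ErE E0).
apply: le_trans L1 _.
have muf := log_dE_fin mu1 mu_disk.
have CEf : CE E mu \is a fin_num by rewrite /CE fin_numB muf.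
set S := supE E _.
have leS z : E z -> (potential sg z <= S)%E.
  by move=> Ez; rewrite psg; apply: ereal_sup_ubound; exists z.
case: S leS => [S| |] leS.
- pose s := S - ln (cap E).
  have s0 : 0 <= s.
    by rewrite subr_ge0; exact: (sup_potential_ge cE cap0 eqmu ErE sg1 sgr leS).
  have H : forall z, (potential sg z <= potential mu z + s%:E)%E.
    apply: (bernstein_walsh cE cap0 eqmu ErE sg1 sgr s0) => z Ez.
    by rewrite /s addrC subrK; exact: leS.
  apply: le_trans (log_dE_le sg1 sgr s0 H) _.
  rewrite /CE; move: muf; case: (integral _ _ _) => [x| |]// _.
  by rewrite -EFinN -!EFinD lee_fin /s; lra.
- by rewrite -(fineK CEf) leey.
(* [-oo] as the supremum would put the potential of [sg] below ln cap E - 1 on all of [E]. *)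
- have [z Ez] := E0; exfalso.
  have : forall z, E z -> (potential sg z <= (ln (cap E) - 1)%:E)%E.
    by move=> w Ew; apply: le_trans (leS w Ew) _; exact: leNye.
  by move/(sup_potential_ge cE cap0 eqmu ErE sg1 sgr); lra.
Qed.

End upper_bound.

(** * Limits of empirical measures *)

Section empirical_limit.
Context {R : realType}.

(** Along an ultrafilter all the sequences of frequencies converge at once, which takes the place of
    a diagonal extraction. *)
Lemma ultralimit : exists2 G : set_system nat, ProperFilter G /\ \oo `<=` G &
  forall u : nat -> R, (forall n, 0 <= u n <= 1) -> exists l : R, u @ G --> l.
Proof.
have [G [GU ooG]] := @ultraFilterLemma nat \oo _.
exists G; first by split=> //; exact: ultra_proper.
move=> u u01; have GP : ProperFilter G by exact: ultra_proper.
have := @segment_compact R 0 1 (u @ G) _; case.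
  by apply: (@filterS _ G _ setT _ _ filterT) => n _ /=; rewrite in_itv/=; exact: u01.
move=> p [_ clp]; exists p => A pA.
have [//|nA] := in_ultra_setVsetC (u @^-1` A) GU.
by have [y []] := clp (~` A) A nA pA.
Qed.

Lemma cvg_sumr (I : Type) (r : seq I) (X : set_system nat) (FX : Filter X)
    (f : I -> nat -> R) (l : I -> R) : (forall i, f i @ X --> l i) ->
  (fun n => \sum_(i <- r) f i n) @ X --> \sum_(i <- r) l i.
Proof.
move=> H; elim: r => [|i r IH].
  by under eq_fun do rewrite big_nil; rewrite big_nil; exact: cvg_cst.
by under eq_fun do rewrite big_cons; rewrite big_cons; apply: cvgD.
Qed.

Variables (T : eqType) (L : nat -> seq T) (N q : nat -> nat) (c : nat -> T -> nat).
Hypothesis sizeL : forall n, size (L n) = n.+1.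
Hypothesis cN : forall k n w, w \in L n -> (c k w < N k)%N.
Hypothesis cS : forall k w n, w \in L n -> (c k.+1 w %/ q k = c k w)%N.
Hypothesis q0 : forall k, (0 < q k)%N.
Variable G : set_system nat.
Hypothesis GP : ProperFilter G.
Hypothesis ooG : \oo `<=` G.
Variable F : nat -> nat -> R.

Lemma limG_unique (u : nat -> R) (l l' : R) : u @ G --> l -> u @ G --> l' -> l = l'.
Proof. by move=> h h'; exact: (@cvg_unique _ (@Rhausdorff R) (u @ G) _ l l' h h'). Qed.

Lemma limG_le (u v : nat -> R) (l l' : R) : (forall n, u n <= v n) ->
  u @ G --> l -> v @ G --> l' -> l <= l'.
Proof.
by move=> uv h h'; apply: (@ler_cvg_to nat G GP R u v l l' h h'); exact: nearW.
Qed.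

Definition emp k i n : R := (count (fun w => c k w < i)%N (L n))%:R / n.+1%:R.

Lemma emp_itv k i n : 0 <= emp k i n <= 1.
Proof.
rewrite /emp divr_ge0//= ler_pdivrMr// mul1r ler_nat -(sizeL n).
exact: count_size.
Qed.

Hypothesis cvF : forall k i, emp k i @ G --> F k i.

Lemma empF_eq k i k' i' : emp k i = emp k' i' -> F k i = F k' i'.
Proof. by move=> E; apply: (limG_unique (@cvF k i)); rewrite E. Qed.

Lemma F0 k : F k 0 = 0.
Proof.
apply: (limG_unique (@cvF k 0)); rewrite (_ : emp k 0 = cst 0); first exact: cvg_cst.
by apply/funext => n; rewrite /emp (eq_count (a2 := pred0)) ?count_pred0 ?mul0r.
Qed.

Lemma FN k : F k (N k) = 1.
Proof.
apply: (limG_unique (@cvF k _)); rewrite (_ : emp k _ = cst 1); first exact: cvg_cst.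
apply/funext => n; rewrite /emp /cst (_ : count _ _ = n.+1) ?divff//.
by rewrite -(sizeL n); apply/eqP; rewrite -all_count; apply/allP => w; exact: cN.
Qed.

Lemma le_F k i j : (i <= j)%N -> F k i <= F k j.
Proof.
move=> ij; apply: (limG_le _ (@cvF k i) (@cvF k j)) => n.
rewrite /emp ler_pM2r ?invr_gt0// ler_nat; apply: sub_count => w /= wi.
exact: leq_trans ij.
Qed.

(** A code of level [k.+1] is below [i * q k] exactly when its quotient by [q k], the code of level
    [k], is below [i]. The breakpoints of one level thus recur at the next, and the cells are
    nested. *)
Lemma FS k i : F k.+1 (i * q k)%N = F k i.
Proof.
apply: empF_eq; apply/funext => n; rewrite /emp; congr (_%:R / _).
apply: eq_in_count => w wL.
by rewrite -ltn_divLR// (cS k wL).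
Qed.

Lemma F_cell k i : F k i < F k i.+1 -> exists n, exists2 w, w \in L n & c k w = i.
Proof.
move=> Fi; apply: contrapT => H.
suff : F k i.+1 = F k i by move=> E; rewrite E ltxx in Fi.
apply: empF_eq; apply/funext => n; rewrite /emp; congr (_%:R / _).
apply: eq_in_count => w wL; rewrite ltnS leq_eqVlt.
suff /negbTE -> : c k w != i by [].
by apply/eqP => E; apply: H; exists n, w.
Qed.

Definition mass k i : R := F k i.+1 - F k i.

Lemma cvg_mass k i :
  (fun n => (count (fun w => c k w == i) (L n))%:R / n.+1%:R) @ G --> mass k i.
Proof.
rewrite (_ : (fun n => _) = emp k i.+1 \- emp k i).
  by apply: cvgB; exact: cvF.
apply/funext => n /=; rewrite /emp -mulrBl; congr (_ / _).
rewrite (_ : count (fun w => c k w < i.+1)%N (L n) =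
   count (fun w => c k w == i) (L n) + count (fun w => c k w < i)%N (L n))%N.
  by rewrite natrD addrK.
rewrite -count_predUI [X in (_ + X)%N](_ : _ = 0%N); last first.
  by apply/eqP; rewrite -leqn0 leqNgt -has_count; apply/hasPn => w _ /=; case: ltngtP.
by rewrite addn0; apply: eq_count => w /=; rewrite ltnS leq_eqVlt.
Qed.

Lemma sum_code k n (h : nat -> R) :
  \sum_(w <- L n) h (c k w) = \sum_(i < N k) h i * (count (fun w => c k w == i) (L n))%:R.
Proof.
rewrite big_seq (eq_bigr (fun w => \sum_(i < N k) h i * (c k w == i)%:R)); last first.
  move=> w wL; rewrite (bigD1 (Ordinal (cN k wL)))//= eqxx mulr1 big1 ?addr0// => i /eqP ne.
  case: eqP => [E|]; rewrite ?mulr0//; exfalso; apply: ne; exact/val_inj.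
rewrite -big_seq exchange_big/=; apply: eq_bigr => i _.
by rewrite -mulr_sumr -natr_sum -sum1_count [in RHS]big_mkcond/=; congr (_ * _%:R).
Qed.

(** Grouped by codes and divided by (n+1)^2, the double sum over points is a finite quadratic form
    in the empirical frequencies, and passes to the limit. The term linear in n disappears, which
    will remove the diagonal of the energy. *)
Lemma mass_energy k (h : nat -> nat -> R) (C D : R) :
  (forall n, \sum_(w <- L n) \sum_(w' <- L n) h (c k w) (c k w') <=
     C * n.+1%:R ^+ 2 + D * n.+1%:R) ->
  \sum_(i < N k) \sum_(j < N k) h i j * mass k j * mass k i <= C.
Proof.
move=> H.
pose e i n : R := (count (fun w => c k w == i) (L n))%:R / n.+1%:R.
have c1 : (fun n => \sum_(i < N k) \sum_(j < N k) h i j * e j n * e i n) @ G -->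
    \sum_(i < N k) \sum_(j < N k) h i j * mass k j * mass k i.
  apply: cvg_sumr => i; apply: cvg_sumr => j; apply: cvgM; last exact: cvg_mass.
  by apply: cvgM; [exact: cvg_cst|exact: cvg_mass].
have c2 : (fun n => C + D * n.+1%:R^-1 : R) @ G --> C + D * 0.
  apply: cvgD; first exact: cvg_cst.
  apply: cvgM; first exact: cvg_cst.
  apply: cvg_trans (@cvg_harmonic R).
  by move=> A /= hA; exact: ooG.
rewrite -[leRHS]addr0 -[X in _ <= _ + X](mulr0 D); apply: (limG_le _ c1 c2) => n.
have n0 : 0 < n.+1%:R :> R by [].
rewrite -(ler_pM2r (exprn_gt0 2 n0)) mulrDl (_ : D / n.+1%:R * n.+1%:R ^+ 2 = D * n.+1%:R); last first.
  by rewrite expr2 mulrA divfK// gt_eqF.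
apply: le_trans (H n); rewrite le_eqVlt; apply/orP; left; apply/eqP.
rewrite (sum_code k n (fun i => \sum_(w' <- L n) h i (c k w'))) mulr_suml.
apply: eq_bigr => i _; rewrite sum_code !mulr_suml; apply: eq_bigr => j _.
rewrite /e; move: (count _ _) (count _ _) => a b; field.
by rewrite -natr1 in n0 *; rewrite addrC gt_eqF.
Qed.

(* [F k i] is the limit frequency of the codes below [i], so the length of [cell k i] is
   the limit frequency of the code [i]. *)
Definition cell k i : set (measurableTypeR R) := `[F k i, F k i.+1[%classic.

Lemma cellP k i (x : R) : cell k i x <-> F k i <= x < F k i.+1.
Proof. by rewrite /cell /= in_itv. Qed.

Lemma measurable_cell k i : measurable (cell k i).
Proof. exact: measurable_itv. Qed.

Lemma cell_exists k (x : R) : 0 <= x < 1 -> exists2 i, (i < N k)%N & cell k i x.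
Proof.
move=> /andP[x0]; rewrite -(FN k).
suff : forall n, (n <= N k)%N -> x < F k n -> exists2 i, (i < N k)%N & cell k i x by apply.
elim=> [|n IH] nN; first by rewrite F0; lra.
move=> xn; have [h|h] := ltP x (F k n).
  by have [i ni ci] := IH (ltnW nN) h; exists i.
by exists n => //; apply/cellP; rewrite h xn.
Qed.

Lemma cell_unique k i j (x : R) : cell k i x -> cell k j x -> i = j.
Proof.
move=> /cellP/andP[i1 i2] /cellP/andP[j1 j2].
have [ij|ij|//] := ltngtP i j.
- by exfalso; have := le_F k ij; lra.
- by exfalso; have := le_F k ij; lra.
Qed.

Lemma cell_down k j (x : R) : cell k.+1 j x -> cell k (j %/ q k)%N x.
Proof.
move=> /cellP/andP[j1 j2]; apply/cellP; apply/andP; split.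
  by rewrite -FS; apply: le_trans j1; apply: le_F; exact: leq_trunc_div.
by rewrite -FS; apply: lt_le_trans j2 _; apply: le_F; exact: ltn_ceil.
Qed.

Definition step k (h : nat -> R) (x : R) : R := \sum_(i < N k) h i * \1_(cell k i) x.

Lemma stepE k h i x : (i < N k)%N -> cell k i x -> step k h x = h i.
Proof.
move=> iN ci; rewrite /step (bigD1 (Ordinal iN))//= indicE mem_set// mulr1 big1 ?addr0//.
move=> j /eqP ne; rewrite indicE memNset ?mulr0// => cj.
by apply: ne; apply/val_inj; exact: cell_unique cj ci.
Qed.

Lemma measurable_step k h : measurable_fun setT (step k h : measurableTypeR R -> R).
Proof.
apply: measurable_sum => i; apply: measurable_funM => //.
by apply: measurable_indic; exact: measurable_cell.
Qed.

Lemma F_le1 k i : (i <= N k)%N -> F k i <= 1.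
Proof. by move=> iN; rewrite -(FN k) le_F. Qed.

Lemma F_ge0 k i : 0 <= F k i.
Proof. by rewrite -(F0 k) le_F. Qed.

Lemma unif_cell k i : (i < N k)%N -> unif (cell k i) = (mass k i)%:E.
Proof.
move=> iN; rewrite /unif/= /mrestr setIidl; last first.
  move=> x /cellP/andP[x1 x2] /=; rewrite in_itv/=.
  have := F_ge0 k i; have := F_le1 iN => h1 h2.
  by apply/andP; split; lra.
rewrite /cell lebesgue_measure_itv/= lte_fin; case: ltP => [//|h].
by rewrite /mass (_ : F k i.+1 = F k i) ?subrr//; apply/eqP; rewrite eq_le h le_F.
Qed.

Lemma integral_step k h : (forall i, 0 <= h i) ->
  (\int[unif]_x (step k h x)%:E = (\sum_(i < N k) h i * mass k i)%:E)%E.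
Proof.
move=> h0; rewrite /step.
under eq_integral do rewrite -sumEFin.
rewrite ge0_integral_sum//; last 2 first.
- move=> i; apply/measurable_EFinP; apply: measurable_funM => //.
  by apply: measurable_indic; exact: measurable_cell.
- by move=> i x _; rewrite lee_fin mulr_ge0.
rewrite -sumEFin; apply: eq_bigr => i _.
under eq_integral do rewrite EFinM.
rewrite ge0_integralZl_EFin//; last first.
  by apply/measurable_EFinP; apply: measurable_indic; exact: measurable_cell.
rewrite integral_indic//; last exact: measurable_cell.
by rewrite setIT unif_cell// EFinM.
Qed.

End empirical_limit.

(** * Nested codes of points, built from finer and finer nets *)

Section net_codes.
Context {R : realType}.
Local Notation cpt := (R * R)%type.
Local Notation o := ((0, 0) : cpt).
Implicit Types (z w : cpt).

(** The intervals of radius [2 * dseq k] about [a k.+1] meet pairwise, and the supremum of their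
    left ends lies in all of them. *)
Lemma geometric_seq_lim (a : nat -> R) :
  (forall k k', (k < k')%N -> `|a k' - a k.+1| <= 2 * dseq k) ->
  exists l, forall k, `|a k.+1 - l| <= 2 * dseq k.
Proof.
move=> H.
have le_ab j k : a j.+1 - 2 * dseq j <= a k.+1 + 2 * dseq k.
  pose m := (maxn j k).+1.
  have /H : (j < m)%N by rewrite ltnS leq_maxl.
  have /H : (k < m)%N by rewrite ltnS leq_maxr.
  by rewrite !ler_norml => /andP[? ?] /andP[? ?]; lra.
pose A := [set a j.+1 - 2 * dseq j | j in [set: nat]].
have A0 : A !=set0 by exists (a 1%N - 2 * dseq 0), 0%N.
have Ak k : ubound A (a k.+1 + 2 * dseq k) by move=> _ [j _ <-]; exact: le_ab.
exists (sup A) => k; rewrite ler_distlC; apply/andP; split.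
- by apply: ub_le_sup; [exists (a k.+1 + 2 * dseq k); exact: Ak|exists k].
- exact: ge_sup.
Qed.

Lemma dist_dseq_cvg (a : nat -> R) (l C : R) : 0 < C ->
  (forall k, `|a k.+1 - l| <= C * dseq k) -> a k.+1 @[k --> \oo] --> l.
Proof.
move=> C0 H; apply/cvgrPdist_le => e e0.
have [n ne] := @dseq_small R (e / C) (divr_gt0 e0 C0).
exists n => // k /= nk; rewrite distrC; apply: le_trans (H k) _.
rewrite mulrC -ler_pdivlMr//; apply: le_trans (ltW ne); exact: dseq_dec.
Qed.

Variable (net : nat -> seq cpt).

Definition netidx k z := find (fun t => cdist t z < dseq k) (net k).

(* The code of level [k.+1] determines that of level [k], in an order-preserving way. *)
Fixpoint netcode k z : nat :=
  if k is k'.+1 then (netcode k' z * size (net k') + netidx k' z)%N else 0%N.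

Fixpoint ncode k : nat := if k is k'.+1 then (ncode k' * size (net k'))%N else 1%N.

Variables (K : set cpt).
Hypothesis netP : forall k z, K z -> exists2 t, t \in net k & cdist t z < dseq k.

Lemma netidx_lt k z : K z -> (netidx k z < size (net k))%N.
Proof. by move=> /(netP k)[t tn tz]; rewrite -has_find; apply/hasP; exists t. Qed.

Lemma code_div k z : K z -> (netcode k.+1 z %/ size (net k))%N = netcode k z.
Proof.
move=> Kz; have h := netidx_lt k Kz.
by rewrite /= divnMDl ?(leq_ltn_trans _ h)// divn_small// addn0.
Qed.

Lemma code_lt k z : K z -> (netcode k z < ncode k)%N.
Proof.
move=> Kz; elim: k => //= k IH.
have h := netidx_lt k Kz; apply: (@leq_trans ((netcode k z).+1 * size (net k))).
  by rewrite mulSn addnC ltn_add2r.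
by rewrite leq_mul2r IH orbT.
Qed.

(** Equal codes have equal last digits, that is, a common point of [net k] within [dseq k] of both.
    The index shifts because level [k.+1] is the first to use [net k]. *)
Lemma code_close k z w : K z -> K w -> netcode k.+1 z = netcode k.+1 w -> cdist z w <= 2 * dseq k.
Proof.
move=> Kz Kw E.
have {}E : netidx k z = netidx k w.
  have := congr1 (fun x => x %% size (net k))%N E.
  by rewrite /= !modnMDl !modn_small ?netidx_lt.
have near v : K v -> cdist (nth o (net k) (netidx k v)) v < dseq k.
  move=> Kv; apply: (nth_find o (a := fun t => cdist t v < dseq k)).
  by rewrite has_find; exact: netidx_lt.
have := near z Kz; have := near w Kw; rewrite E.
set t := nth _ _ _ => h1 h2; have := cdist_triangle z t w; rewrite (cdistC z t); lra.
Qed.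

End net_codes.

(** * The limit measure as an image of Lebesgue measure *)

Section limit_measure.
Context {R : realType}.
Local Notation cpt := (R * R)%type.
Local Notation o := ((0, 0) : cpt).
Implicit Types (z w : cpt).

Variables (K : set cpt) (net : nat -> seq cpt).
Hypothesis cK : compact K.
Hypothesis netP : forall k z, K z -> exists2 t, t \in net k & cdist t z < dseq k.
Variable L : nat -> seq cpt.
Hypothesis LK : forall n w, w \in L n -> K w.
Hypothesis sizeL : forall n, size (L n) = n.+1.
Variable G : set_system nat.
Hypothesis GP : ProperFilter G.
Hypothesis ooG : \oo `<=` G.
Variable F : nat -> nat -> R.
Hypothesis cvF : forall k i, emp L (netcode net) k i @ G --> F k i.
Variable rep : nat -> nat -> cpt.
Hypothesis repP : forall k i, (exists2 w, K w & netcode net k w = i) ->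
  K (rep k i) /\ netcode net k (rep k i) = i.

Local Notation N := (ncode net).
Let q k := size (net k).
Let c := netcode net.

Let cN k n w : w \in L n -> (c k w < N k)%N.
Proof. by move=> /LK; exact: (code_lt netP). Qed.

Let cS k w n : w \in L n -> (c k.+1 w %/ q k)%N = c k w.
Proof. by move=> /LK; exact: (code_div netP). Qed.

Let q0 k : (0 < q k)%N.
Proof.
have : head o (L 0) \in L 0 by have := sizeL 0; case: (L 0) => //= a l _; rewrite mem_head.
by move=> /LK/(netidx_lt netP k); exact: leq_ltn_trans.
Qed.

Let cellx k (x : R) : 0 <= x < 1 -> exists2 i, (i < N k)%N & cell F k i x.
Proof. exact: (cell_exists sizeL cN GP cvF). Qed.

Let cellu k i j (x : R) : cell F k i x -> cell F k j x -> i = j.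
Proof. exact: (cell_unique GP cvF). Qed.

Let celld k j (x : R) : cell F k.+1 j x -> cell F k (j %/ q k)%N x.
Proof. exact: (cell_down cS q0 GP cvF). Qed.

Lemma rep_cell k i x : cell F k i x -> K (rep k i) /\ c k (rep k i) = i.
Proof.
move=> /cellP/andP[h1 h2]; apply: repP.
have [n [w wL E]] := F_cell GP cvF (le_lt_trans h1 h2).
by exists w => //; exact: LK wL.
Qed.

Lemma code_cell m : forall k i j x z, K z -> cell F k i x -> cell F (m + k)%N j x ->
  c (m + k)%N z = j -> c k z = i.
Proof.
elim: m => [|m IH] k i j x z Kz ci cj cz; first by rewrite -(cellu ci cj) in cz.
apply: (IH k i (j %/ q (m + k))%N x z) => //; first exact: celld.
by rewrite -cz; apply/esym; exact: (code_div netP).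
Qed.

(** A cell of level [k] is sent to a representative of its code. Off [0, 1) there are no cells, and
    the sums give the origin as default value. *)
Definition phik k (x : R) : cpt :=
  (step N F k (fun i => (rep k i).1) x, step N F k (fun i => (rep k i).2) x).

Lemma phik_rep k i x : (i < N k)%N -> cell F k i x -> phik k x = rep k i.
Proof.
move=> iN ci; rewrite /phik !(stepE GP cvF _ iN ci).
by case: (rep k i).
Qed.

Lemma phik_out k x : ~ (0 <= x < 1) -> phik k x = o.
Proof.
move=> nx; suff E h : step N F k h x = 0 by rewrite /phik !E.
rewrite /step big1// => i _; rewrite indicE memNset ?mulr0// => /cellP/andP[h1 h2].
apply: nx; have := F_ge0 GP cvF k i; have := F_le1 sizeL cN GP cvF (ltn_ord i) => h3 h4.
by apply/andP; split; lra.
Qed.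

(** Cells are nested, so the representative chosen at the finer level has the same code of level
    [k.+1] as the coarser one, and [code_close] applies. *)
Lemma phik_close x k k' : (k < k')%N -> cdist (phik k' x) (phik k.+1 x) <= 2 * dseq k.
Proof.
move=> kk; have [x01|nx] := pselect (0 <= x < 1); last first.
  by rewrite !phik_out// cdistxx mulr_ge0// ltW// dseq_gt0.
have [i iN ci] := cellx k.+1 x01; have [j jN cj] := cellx k' x01.
rewrite (phik_rep iN ci) (phik_rep jN cj).
have [Ki Ei] := rep_cell ci; have [Kj Ej] := rep_cell cj.
apply: (code_close netP) => //; rewrite -/c Ei.
have := @code_cell (k' - k.+1)%N k.+1 i j x _ Kj ci.
by rewrite subnK//; apply.
Qed.

Lemma phi_exists : exists phi : R -> cpt, forall x k, cdist (phik k.+1 x) (phi x) <= 4 * dseq k.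
Proof.
have H (x : R) : exists z : cpt, forall k, cdist (phik k.+1 x) z <= 4 * dseq k.
  have [|l1 h1] := @geometric_seq_lim R (fun k => (phik k x).1).
    move=> k k' kk; apply: le_trans (phik_close x kk); exact: cdist_ge_abs1.
  have [|l2 h2] := @geometric_seq_lim R (fun k => (phik k x).2).
    move=> k k' kk; apply: le_trans (phik_close x kk); exact: cdist_ge_abs2.
  exists (l1, l2) => k; apply: le_trans (cdist_le_abs _ _) _ => /=.
  by have := h1 k; have := h2 k; lra.
by have [phi Hp] := choice H; exists phi.
Qed.

Variable phi : measurableTypeR R -> cpt.
Hypothesis phiP : forall x k, cdist (phik k.+1 x) (phi x) <= 4 * dseq k.

Lemma measurable_phi : measurable_fun setT phi.
Proof.
have four : 0 < 4 :> R by [].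
apply/measurable_fun_pairP; split.
- apply: (measurable_fun_cvg (h := fun k x => (phik k.+1 x).1)).
    by move=> m; exact: measurable_step.
  move=> x _; apply: (@dist_dseq_cvg R (fun k => (phik k x).1) _ 4) => // k.
  by apply: le_trans (phiP x k); exact: cdist_ge_abs1.
- apply: (measurable_fun_cvg (h := fun k x => (phik k.+1 x).2)).
    by move=> m; exact: measurable_step.
  move=> x _; apply: (@dist_dseq_cvg R (fun k => (phik k x).2) _ 4) => // k.
  by apply: le_trans (phiP x k); exact: cdist_ge_abs2.
Qed.

Lemma phi_in x : 0 <= x < 1 -> K (phi x).
Proof.
move=> x01; apply: contrapT => nK.
have oK : open (~` K) by apply: closed_openC; apply: compact_closed cK; exact: cpt_hausdorff.
have /nbhs_disk[r r0 rK] : nbhs (phi x) (~` K) by exact: open_nbhs_nbhs.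
have [|n nr] := @dseq_small R (r / 4); first by rewrite divr_gt0.
have [i iN ci] := cellx n.+1 x01; have [Ki _] := rep_cell ci.
apply: (rK (phik n.+1 x)); last by rewrite (phik_rep iN ci).
by rewrite /disk/= cdistC; have := phiP x n; lra.
Qed.

(** The measure structure depends on the proof that [phi] is measurable; the existential hides it
    and keeps only the equality of set functions. *)
Lemma limm_exists : exists sg : @cmeasure R, sg = pushforward (@unif R) phi :> (set cpt -> \bar R).
Proof.
unshelve refine (ex_intro _ (pushforward (@unif R) phi : @cmeasure R) _).
- exact: measurable_phi.
- by [].
Qed.


Lemma unif_Ico : @unif R (~` `[0%R, 1%R[%classic) = 0%E.
Proof.
rewrite /unif/= /mrestr (_ : _ `&` _ = [set 1 : R]); first exact: lebesgue_measure_set1.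
apply/seteqP; split=> x /=; rewrite !in_itv/=.
  move=> [nx /andP[x0 x1]]; apply/eqP; rewrite eq_le x1 leNgt; apply/negP => h.
  by apply: nx; rewrite x0 h.
by move=> ->; rewrite ltxx ler01 lexx andbF.
Qed.

Let mass_ge0 k i : 0 <= mass F k i.
Proof. by rewrite subr_ge0 (le_F GP cvF). Qed.

Lemma integral_cells_le k (f : measurableTypeR R -> \bar R) (h : nat -> R) (e : R) :
  measurable_fun setT f -> (forall i, 0 <= h i) ->
  (forall x i, (i < N k)%N -> cell F k i x -> (f x <= (h i + e)%:E)%E) ->
  (\int[unif]_x f x <= (\sum_(i < N k) h i * mass F k i + e)%:E)%E.
Proof.
move=> mf h0 H.
have uT : (@unif R setT < +oo)%E by rewrite unif_setT ltry.
have ms : measurable_fun setT (fun x : measurableTypeR R => (step N F k h x)%:E).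
  by apply/measurable_EFinP; exact: measurable_step.
rewrite EFinD -(integral_step sizeL cN GP cvF k h0) -[X in (_ <= _ + X)%E]mule1.
rewrite -(@unif_setT R) -(integral_cst unif measurableT) -integralD_ub; last 2 first.
- apply: (@ubi_bnd _ _ _ _ (\sum_(i < N k) h i)) => //; apply/aeW => x.
  by rewrite lee_fin; apply: ler_sum => i _; rewrite ler_piMr// indicE.
- exact: ubi_cst.
apply: ae_le_integral => //; first by apply: emeasurable_funD.
have mI : measurable (`[0%R, 1%R[%classic : set (measurableTypeR R)) by exact: measurable_itv.
apply: (ae_of_null mI unif_Ico) => x /=; rewrite in_itv/= => x01.
have [i iN ci] := cellx k x01.
by rewrite (stepE GP cvF h iN ci) -EFinD; exact: H.
Qed.

Variables (B d M D : R).
Hypotheses (d0 : 0 < d) (dB : d <= B).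
Hypothesis LM : forall n, \sum_(w <- L n) \sum_(w' <- L n) fine (logker B d w w') <=
  M * n.+1%:R ^+ 2 + D * n.+1%:R.

Let B0 : 0 < B := lt_le_trans d0 dB.
Let g z w : R := fine (logker B d z w).

Let gE z w : logker B d z w = (g z w)%:E.
Proof. by rewrite /g logker_fin. Qed.

Let g0 z w : 0 <= g z w.
Proof. by rewrite -lee_fin -gE logker_ge0. Qed.

Let g_lip z w z' w' : g z w <= g z' w' + (cdist z' z + cdist w' w) / d.
Proof.
have := @logker_lip _ B d z' z w d0 dB; have := @logker_lip _ B d w' w z' d0 dB.
rewrite (logkerC B d w z') (logkerC B d w' z') !gE -!EFinD !lee_fin mulrDl; lra.
Qed.

(** Replacing each point by the representative of its code moves it by at most [2 * dseq k], which
    changes the regularized kernel of a pair by at most 4 dseq k / d. *)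
Lemma rep_energy k : \sum_(i < N k.+1) \sum_(j < N k.+1)
    g (rep k.+1 i) (rep k.+1 j) * mass F k.+1 j * mass F k.+1 i <= M + 4 * dseq k / d.
Proof.
apply: (mass_energy cN GP ooG cvF (h := fun i j => g (rep k.+1 i) (rep k.+1 j)) (D := D)) => n.
have H w w' : w \in L n -> w' \in L n ->
    g (rep k.+1 (netcode net k.+1 w)) (rep k.+1 (netcode net k.+1 w')) <= g w w' + 4 * dseq k / d.
  have cl v : v \in L n -> cdist v (rep k.+1 (netcode net k.+1 v)) <= 2 * dseq k.
    move=> /LK Kv; have [|Kr Er] := repP (k := k.+1) (i := netcode net k.+1 v); first by exists v.
    by apply: (code_close netP) => //; rewrite Er.
  move=> /cl h1 /cl h2; apply: le_trans (g_lip _ _ w w') _.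
  by rewrite lerD2l ler_pM2r ?invr_gt0//; lra.
apply: (@le_trans _ _ (\sum_(w <- L n) \sum_(w' <- L n) (g w w' + 4 * dseq k / d))).
  rewrite big_seq [leRHS]big_seq; apply: ler_sum => w wL.
  by rewrite big_seq [leRHS]big_seq; apply: ler_sum => w' w'L; exact: H.
have SE (a : R) : \sum_(w <- L n) a = a * n.+1%:R.
  by rewrite big_const_seq count_predT iter_addr_0 sizeL mulr_natr.
under eq_bigr do rewrite big_split/= SE.
rewrite big_split/= SE [leRHS](_ : _ = M * n.+1%:R ^+ 2 + D * n.+1%:R +
  4 * dseq k / d * n.+1%:R * n.+1%:R); last by rewrite mulrDl expr2 !mulrA addrAC.
by rewrite lerD2r; exact: LM.
Qed.

Lemma limm_energy (sg : @cmeasure R) : sg = pushforward (@unif R) phi :> (set cpt -> \bar R) ->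
  (\int[sg]_z logpot B d sg z <= M%:E)%E.
Proof.
move=> sgE.
have sgT : (sg setT < +oo)%E by rewrite sgE /pushforward preimage_setT unif_setT ltry.
have mphi := measurable_phi.
have I f : measurable_fun setT f -> (forall z, 0 <= f z)%E ->
    (\int[sg]_z f z = \int[unif]_x f (phi x))%E.
  move=> mf f0; rewrite sgE ge0_integral_pushforward ?preimage_setT//.
rewrite I; last 2 first.
- exact: measurable_logpot.
- by move=> z; exact: logpot_ge0.
have Ix z : logpot B d sg z = (\int[unif]_y (logker B d z (phi y)))%E.
  rewrite logpotE I//; first exact: measurable_logkerl.
  by move=> t; exact: logker_ge0.
apply/lee_addgt0Pr => e e0.
(* The total error is 12 dseq k / d: 8 for moving both arguments from values of [phi] to
   representatives, 4 from [rep_energy]. *)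
have [|k ke] := @dseq_small R (e * d / 12); first by rewrite divr_gt0// mulr_gt0.
have kd : dseq k / d < e / 12.
  by rewrite ltr_pdivrMr// mulrAC.
pose h i := \sum_(j < N k.+1) g (rep k.+1 i) (rep k.+1 j) * mass F k.+1 j.
have h0 i : 0 <= h i by apply: sumr_ge0 => j _; rewrite mulr_ge0.
apply: (@le_trans _ _ (\sum_(i < N k.+1) h i * mass F k.+1 i + 8 * (dseq k / d))%:E).
  apply: integral_cells_le => //.
    by apply: (measurableT_comp (measurable_logpot d B0 sgT) mphi).
  move=> x i iN ci; rewrite Ix.
  apply: (integral_cells_le (h := fun j => g (rep k.+1 i) (rep k.+1 j))) => //.
    by apply: (measurableT_comp (measurable_logkerl B d _) mphi).
  move=> y j jN cj; rewrite gE lee_fin; apply: le_trans (g_lip _ _ (rep k.+1 i) (rep k.+1 j)) _.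
  rewrite lerD2l mulrA ler_pM2r ?invr_gt0//.
  have := phiP x k; rewrite (phik_rep iN ci); have := phiP y k; rewrite (phik_rep jN cj); lra.
rewrite -EFinD lee_fin; have := rep_energy k.
rewrite (_ : \sum_(i < N k.+1) \sum_(j < N k.+1) _ = \sum_(i < N k.+1) h i * mass F k.+1 i).
  by rewrite -mulrA; lra.
by apply: eq_bigr => i _; rewrite /h mulr_suml.
Qed.

End limit_measure.

(** * Sharpness *)

Section polar_sets.
Context {R : realType}.
Local Notation cpt := (R * R)%type.
Local Notation o := ((0, 0) : cpt).
Implicit Types (z w : cpt).

Lemma sum_sym_cons (T : Type) (g : T -> T -> R) a (s : seq T) : (forall x y, g x y = g y x) ->
  \sum_(x <- a :: s) \sum_(y <- a :: s) g x y =
  g a a + 2 * \sum_(y <- s) g a y + \sum_(x <- s) \sum_(y <- s) g x y.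
Proof.
move=> gC; rewrite !big_cons.
under [X in _ + X]eq_bigr do rewrite big_cons.
rewrite big_split/= [X in _ + (X + _)](eq_bigr (g a)); last by move=> x _; exact: gC.
by ring.
Qed.

Lemma finite_energy_measure (K : set cpt) (B M : R) : compact K -> 1 <= B -> 0 <= M ->
  (forall ws : seq cpt, (forall w, w \in ws -> K w) ->
     exists2 z, K z & (\sum_(w <- ws) logker B 0 z w <= (M * (size ws)%:R)%:E)%E) ->
  exists2 sg : @cmeasure R, prob_on K sg & (\int[sg]_z logpot B 0 sg z <= M%:E)%E.
Proof.
move=> cK B1 M0 H; have B0 := lt_le_trans ltr01 B1.
have [z0 Kz0 _] := H [::] (fun w h => False_ind _ (notF h)).
have /choice[f fP] : forall ws : seq cpt, exists z, K z /\ ((forall w, w \in ws -> K w) ->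
    (\sum_(w <- ws) logker B 0 z w <= (M * (size ws)%:R)%:E)%E).
  move=> ws; have [hK|nK] := pselect (forall w, w \in ws -> K w); last by exists z0.
  by have [z Kz hz] := H ws hK; exists z.
pose lj n := iter n (fun s => f s :: s) [::].
have ljK n w : w \in lj n -> K w.
  elim: n => //= n IH; rewrite inE => /predU1P[->|]; [by have [] := fP (lj n)|exact: IH].
have ljs n : size (lj n) = n by elim: n => //= n ->.
pose L n := lj n.+1.
have LK n w : w \in L n -> K w by exact: ljK.
have sizeL n : size (L n) = n.+1 by exact: ljs.
(* Each diagonal term, infinite at height 0, is at most ln B - ln d at height d, so the diagonal is
   only linear in n. The leading constant [M] does not depend on d, which lets the height tend to 0
   in the end. *)
have lj_energy d n : 0 < d -> d <= B ->
    \sum_(w <- lj n) \sum_(w' <- lj n) fine (logker B d w w') <=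
    M * n%:R ^+ 2 + (ln B - ln d) * n%:R.
  move=> d0 dB.
  pose g z w := fine (logker B d z w).
  have gE z w : logker B d z w = (g z w)%:E by rewrite /g logker_fin.
  have gC z w : g z w = g w z by rewrite /g logkerC.
  elim: n => [|n IH]; first by rewrite big_nil mulr0 expr0n mulr0 addr0.
  set z := f (lj n).
  have h1 : g z z <= ln B - ln d by rewrite -lee_fin -gE logker_le.
  have h2 : \sum_(w <- lj n) g z w <= M * n%:R.
    have [_ /(_ (ljK n))] := fP (lj n); rewrite ljs -/z => hz.
    rewrite -lee_fin -sumEFin; apply: le_trans hz; apply: lee_sum => w _.
    by rewrite -gE; apply: logker_dec => //; exact: ltW.
  rewrite [lj n.+1]/= -/z (sum_sym_cons _ _ gC).
  move: IH h1 h2; rewrite -[n.+1%:R]natr1.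
  move: (\sum_(w <- lj n) g z w) (g z z) (\sum_(w <- lj n) _) => a b e.
  move: (n%:R : R) => x IH h1 h2; rewrite (sqrrD x 1) expr1n mulr1; nra.
have [G [GP ooG] Glim] := @ultralimit R.
have /choice[net netP] : forall k : nat, exists ts : seq cpt,
    forall z, K z -> exists2 t, t \in ts & cdist t z < dseq k.
  by move=> k; have [ts _ h] := finite_net cK (@dseq_gt0 R k); exists ts.
have /choice[F2 cvF2] : forall ki : nat * nat, exists l : R,
    emp L (netcode net) ki.1 ki.2 @ G --> l.
  by move=> ki; apply: Glim => n; exact: emp_itv.
pose F k i := F2 (k, i).
have cvF k i : emp L (netcode net) k i @ G --> F k i by exact: (cvF2 (k, i)).
have /choice[rep2 repP2] : forall ki : nat * nat, exists z : cpt,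
    (exists2 w, K w & netcode net ki.1 w = ki.2) -> K z /\ netcode net ki.1 z = ki.2.
  move=> [k i]; have [[w Kw cw]|nw] := pselect (exists2 w, K w & netcode net k w = i).
    by exists w.
  by exists o => h; exfalso; exact: nw.
pose rep k i := rep2 (k, i).
have repP k i : (exists2 w, K w & netcode net k w = i) -> K (rep k i) /\ netcode net k (rep k i) = i.
  exact: (repP2 (k, i)).
have [phi phiP] := phi_exists netP LK sizeL GP cvF repP.
have [sg sgE] := limm_exists phiP.
have psg : prob_on K sg.
  split; first by rewrite sgE /pushforward preimage_setT unif_setT.
  rewrite sgE /pushforward.
  have mK := compact_measurable2 cK; have mphi := measurable_phi phiP.
  apply: (subset_measure0 _ _ _ (@unif_Ico R)).
  - by rewrite -[X in measurable X]setTI; apply: mphi => //; exact: measurableC.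
  - by apply: measurableC; exact: measurable_itv.
  - move=> x /= nK; rewrite in_itv/= => x01; apply: nK.
    exact: (phi_in cK netP LK sizeL GP cvF repP phiP).
exists sg => //; apply: logpot_energy_le => //; first exact: prob_on_lty psg.
move=> n; apply: (limm_energy netP LK sizeL GP ooG cvF repP phiP (D := ln B - ln (dseq n)) _ _ _ sgE).
- exact: dseq_gt0.
- by apply: le_trans B1; exact: dseq_le1.
- move=> m; apply: lj_energy; first exact: dseq_gt0.
  by apply: le_trans B1; exact: dseq_le1.
Qed.

Definition avg_dirac (ws : seq cpt) : @cmeasure R :=
  mscale ((size ws)%:R^-1)%:nng
    (msum (fun k => dirac (nth o ws k) : @cmeasure R) (size ws)).

Lemma integral_avg_dirac ws f : measurable_fun setT f -> (forall z, 0 <= f z)%E ->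
  (\int[avg_dirac ws]_z f z = ((size ws)%:R^-1)%:E * \sum_(w <- ws) f w)%E.
Proof.
move=> mf f0; rewrite ge0_integral_mscale// ge0_integral_measure_sum//=; congr (_ * _)%E.
rewrite (big_nth o) big_mkord; apply: eq_bigr => i _.
by rewrite integral_dirac// diracT mul1e.
Qed.

(** The measure is a plain average of Dirac masses. If no finite family of points worked, each would
    leave a point of [K] where its kernel sum is small, and [finite_energy_measure] would contradict
    the hypothesis. *)
Lemma polar_measure (K : set cpt) (B M : R) : compact K -> K !=set0 -> 1 <= B -> 0 <= M ->
  (forall sg : @cmeasure R, prob_on K sg -> (\int[sg]_z logpot B 0 sg z = +oo)%E) ->
  exists2 la : @cmeasure R, prob_on K la & forall z, K z -> (M%:E <= logpot B 0 la z)%E.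
Proof.
move=> cK [z0 Kz0] B1 M0 H; have B0 := lt_le_trans ltr01 B1.
have [ws [wsK wsM]] : exists ws : seq cpt, (forall w, w \in ws -> K w) /\
    forall z, K z -> ((M * (size ws)%:R)%:E < \sum_(w <- ws) logker B 0 z w)%E.
  apply: contrapT => /forallNP nws.
  have [|sg psg] := finite_energy_measure cK B1 M0.
    move=> ws wsK; apply: contrapT => nz; apply: (nws ws); split=> // z Kz.
    by rewrite ltNge; apply/negP => h; apply: nz; exists z.
  by rewrite H// leye_eq.
have n0 : (0 < size ws)%N.
  by case: ws wsK wsM => // _ /(_ z0 Kz0); rewrite big_nil mulr0 ltxx.
have n0' : (size ws)%:R != 0 :> R by rewrite pnatr_eq0 -lt0n.
exists (avg_dirac ws).
  have I A : measurable A -> avg_dirac ws A = (((size ws)%:R^-1)%:E * \sum_(w <- ws) \d_w A)%E.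
    move=> mA; rewrite /avg_dirac /= /mscale /= /msum/=; congr (_ * _)%E.
    by rewrite (big_nth o) big_mkord.
  split.
    rewrite I// (eq_bigr (fun=> 1%E)); last by move=> w _; rewrite diracT.
    by rewrite sumEFin big_const_seq count_predT iter_addr_0 -EFinM mulVf.
  rewrite I; last by apply: measurableC; exact: compact_measurable2.
  rewrite big_seq big1 ?mule0// => w /wsK Kw; rewrite diracE memNset//=.

move=> z Kz; rewrite logpotE integral_avg_dirac; last 2 first.
- exact: measurable_logkerl.
- by move=> t; exact: logker_ge0.
rewrite muleC -lee_pdivrMr ?invr_gt0 ?ltr0n// invrK -EFinM.
exact/ltW/wsM.
Qed.

End polar_sets.

Section partition.
Context {R : realType}.
Local Notation cpt := (R * R)%type.
Local Notation o := ((0, 0) : cpt).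

Lemma finite_partition (K : set cpt) (e : R) : compact K -> 0 < e ->
  exists n (ts : nat -> cpt) (cl : nat -> set cpt),
  [/\ forall k, measurable (cl k), trivIset setT cl, forall k z, cl k z -> cdist (ts k) z < e &
      K `<=` \big[setU/set0]_(k < n) cl k].
Proof.
move=> cK e0; have [ts _ tsn] := finite_net cK e0.
pose F k := if (k < size ts)%N then disk (nth o ts k) e else set0.
have mF k : measurable (F k).
  by rewrite /F; case: ifP => // _; apply: open_measurable2; exact: open_disk.
exists (size ts), (nth o ts), (seqDU F); split.
- by move=> k; apply: measurableD => //; exact: bigsetU_measurable.
- exact: trivIset_seqDU.
- by move=> k z [+ _]; rewrite /F; case: ifP.
- move=> z /tsn[t tts tz].
  have : (\bigcup_k seqDU F k) z.
    rewrite -seqDU_bigcup_eq; exists (index t ts) => //.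
    by rewrite /F index_mem tts /disk/= nth_index.
  move=> [k _ kz]; rewrite -bigcup_mkord; exists k => //=.
  by case: kz => + _; rewrite /F; case: ifP.
Qed.

Lemma measure_partition (mu : @cmeasure R) (K : set cpt) n (cl : nat -> set cpt) A :
  measurable K -> mu (~` K) = 0%E -> (forall k, measurable (cl k)) -> trivIset setT cl ->
  K `<=` \big[setU/set0]_(k < n) cl k -> measurable A ->
  (\sum_(j < n) mu (A `&` cl j) = mu A)%E.
Proof.
move=> mK muK mcl tcl Kcl mA.
have mAc k : measurable (A `&` cl k) by exact: measurableI.
rewrite -(@measure_bigsetU_ord _ _ _ mu n xpredT (fun j : 'I_n => A `&` cl j))//; last first.
  apply/trivIsetP => i j _ _ ij; have := trivIsetP.1 tcl i j I I.
  by rewrite -(inj_eq val_inj) in ij => /(_ ij); rewrite setIACA setIid => ->; rewrite setI0.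
rewrite -big_distrr/=; set U := \big[setU/set0]_(_ < _) _.
have mU : measurable U by apply: bigsetU_measurable.
apply/eqP; rewrite eq_le; apply/andP; split.
  by apply: le_measure; rewrite ?inE//; exact: measurableI.
rewrite -[leRHS]adde0 -muK; apply: le_trans (measureU2 _ _ _) => //; last 2 first.
- exact: measurableI.
- exact: measurableC.
apply: le_measure; rewrite ?inE//.
  by apply: measurableU; [exact: measurableI|exact: measurableC].
by move=> z Az; have [Kz|nK] := pselect (K z); [left; split=> //; exact: Kcl|right].
Qed.

End partition.

Section sharpness.
Context {R : realType}.
Local Notation cpt := (R * R)%type.
Local Notation o := ((0, 0) : cpt).

Variables (E : set cpt) (mu : @cmeasure R).
Hypothesis cE : compact E.
Hypothesis cap0 : 0 < cap E.
Hypothesis eqmu : equilibrium_measure E mu.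
Variable rE : R.
Hypothesis ErE : forall z, E z -> cdist o z <= rE.

Let pmu : prob_on E mu := eqmu.1.
Let mu1 : mu setT = 1%E := pmu.1.
Let muE : mu (~` E) = 0%E := pmu.2.
Let muT : (mu setT < +oo)%E := prob_on_lty pmu.
Let mE : measurable E := compact_measurable2 cE.
Let lc := ln (cap E).

Let EB B z t : 2 * rE <= B -> E z -> E t -> cdist z t <= B.
Proof.
move=> hB Ez Et; have := cdist_triangle z o t; rewrite (cdistC z o).
by have := ErE Ez; have := ErE Et; lra.
Qed.

Lemma polar_correction B (e M : R) : 1 <= B -> 2 * rE <= B -> 0 < e -> 0 <= M ->
  exists2 la : @cmeasure R, prob_on E la & forall z, E z ->
    ((ln B - lc - e)%:E < logpot B 0 mu z)%E \/ (M%:E <= logpot B 0 la z)%E.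
Proof.
move=> B1 hB e0 M0; have B0 := lt_le_trans ltr01 B1.
(* The points of [E] where the potential of [mu] is at least lc + e. A measure of finite energy on
   [K] would give [logpot B 0 mu] a mean at most w - e, with w = ln B - lc, against
   [variational]. *)
pose K := E `&` [set z | (logpot B 0 mu z <= (ln B - lc - e)%:E)%E].
have cK : compact K by apply: compact_closedI => //; exact: logpot_le_closed.
have mK := compact_measurable2 cK.
have subE (sg : @cmeasure R) : prob_on K sg -> prob_on E sg.
  move=> [s1 sK]; split=> //; apply: (subset_measure0 _ _ _ sK); try exact: measurableC.
  by apply: subsetC; exact: subIsetl.
have [K0|/set0P K0] := eqVneq K set0.
  exists mu => // z Ez; left; rewrite ltNge; apply/negP => h.
  by have : K z by []; rewrite K0.
have [|la /subE pla H] := polar_measure cK K0 B1 M0; last first.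
  exists la => // z Ez; have [h|h] := ltP (ln B - lc - e)%:E (logpot B 0 mu z); first by left.
  by right; apply: H.
move=> sg psg; apply/eqP; rewrite eq_le leey/= leNgt; apply/negP => fin.
have := variational B1 pmu (equilibrium_logpot cE cap0 eqmu ErE B1 hB)
  (fun s ps => equilibrium_min cE cap0 ErE B1 hB ps) (subE _ psg) fin.
apply/negP; rewrite -ltNge; apply: (@le_lt_trans _ _ (ln B - lc - e)%:E); last first.
  by rewrite lte_fin ltrBlDr ltrDl.
rewrite -[leRHS]mule1 -psg.1 -(integral_cst sg measurableT); apply: ae_le_integral => //.
  exact: measurable_logpot.
by apply: (ae_of_null mK psg.2) => z [].
Qed.

Let D := fine (\int[mu]_z elog (dE E z))%E.

Let DE : (\int[mu]_z elog (dE E z) = D%:E)%E.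
Proof. by rewrite /D fineK// (log_dE_fin cE cap0 eqmu ErE mu1 (mu_disk cE eqmu ErE)). Qed.

Lemma far_point (t : cpt) (del : R) : 0 < del -> exists2 s, E s & dE E t - del <= cdist t s.
Proof.
move=> d0; have E0 := equilibrium_neq0 eqmu.
apply: contrapT => H; have : dE E t <= dE E t - del.
  apply: (dE_le ErE E0) => s Es; rewrite leNgt; apply/negP => h.
  by apply: H; exists s => //; exact: ltW.
lra.
Qed.

Lemma sharp_family B (eta e : R) : 1 <= B -> 2 * rE <= B -> 0 < eta -> eta < 1 -> 0 < e ->
  exists m (nu : 'I_m -> @cmeasure R), [/\ admissible_family nu,
    ((eta * lc + (1 - eta) * (D - e))%:E <= \sum_(j < m) supE E (potential (nu j)))%E &
    (supE E (fun z => \sum_(j < m) potential (nu j) z) <=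
       (lc + eta * (ln B - lc) + e)%:E)%E].
Proof.
move=> B1 hB eta0 eta1 e0; have B0 := lt_le_trans ltr01 B1.
have E0 := equilibrium_neq0 eqmu.
(* So that eta M = |ln B - lc|: where the potential of [mu] is not controlled, [eta * la] pays for
   the crude bound by ln B. *)
pose M := `|ln B - lc| / eta.
have M0 : 0 <= M by rewrite divr_ge0// ltW.
have [la pla laH] := polar_correction B1 hB e0 M0.
have [la1 laE] := pla; have laT := prob_on_lty pla.
have [d d0 dd] := dE_pos cE cap0 eqmu ErE.
(* On a piece, distances to a nearly farthest point fall short of [dE] by at most 3 del. This is at
   most d / 2, which leaves them at least d / 2, and costs at most 6 del / d <= e in the
   logarithm. *)
pose del := Num.min (d / 6) (e * d / 6).
have del0 : 0 < del by rewrite lt_min !divr_gt0// mulr_gt0.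
have [deld dele] : del <= d / 6 /\ del <= e * d / 6 by split; rewrite ge_min lexx ?orbT.
have [n [ts [cl [mcl tcl clts Ecl]]]] := finite_partition cE del0.
have eta1' : 0 <= 1 - eta by rewrite subr_ge0 ltW.
pose a := NngNum (ltW eta0); pose b := NngNum eta1'.
pose pj (j : 'I_n) : @cmeasure R := srestr b mu (mcl j).
pose nu (i : 'I_n.+1) : @cmeasure R := if unlift ord0 i is Some j then pj j else mscale a la.
have nu0 : nu ord0 = mscale a la by rewrite /nu unlift_none.
have nuS j : nu (lift ord0 j) = pj j by rewrite /nu liftK.
have fsumpj A : measurable A -> (fsum pj A = (1 - eta)%:E * mu A)%E.
  move=> mA; rewrite fsumE; under eq_bigr do rewrite srestrE.
  rewrite -ge0_sume_distrr//; congr (_ * _)%E.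
  exact: (measure_partition mE muE).
have pjT j : (pj j setT < +oo)%E.
  rewrite srestrE lte_mul_pinfty ?lee_fin//.
  by apply: le_lt_trans muT; apply: le_measure; rewrite ?inE//; exact: measurableI.
have pjE j : pj j (~` (E `&` cl j)) = 0%E.
  rewrite srestrE (_ : mu _ = 0%E) ?mule0//; apply: (subset_measure0 _ _ _ muE).
  - by apply: measurableI => //; apply: measurableC; exact: measurableI.
  - exact: measurableC.
  - by move=> z [/= h cz] Ez; apply: h.
have pjE' j : pj j (~` E) = 0%E.
  apply: (subset_measure0 _ _ _ (pjE j)).
  - exact: measurableC.
  - by apply: measurableC; exact: measurableI.
  - by apply: subsetC; exact: subIsetl.
have Ipj f : measurable_fun setT f -> (forall j, ubi (pj j) f) ->
    (\sum_(j < n) \int[pj j]_z f z = (1 - eta)%:E * \int[mu]_z f z)%E.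
  move=> mf uf; rewrite -integral_fsum//.
  rewrite -[X in (X%:E * _)%E]/(b%:num) -integral_mscale_gen//.
  by apply: eq_measure_integral => A mA _; exact: fsumpj.
have ucd z j : E z -> ubi (pj j) (fun t => elog (cdist z t)).
  move=> Ez; apply: (ubi_bnd (pjT j) (measurable_log_cdist z) (L := ln B)).
  apply: (ae_of_null mE (pjE' j)) => t Et; rewrite -elogE//; apply: le_elog.
    exact: cdist_ge0.
  exact: (EB hB).
have mdE := measurable_log_dE ErE E0.
have dEp z : 0 < dE E z := lt_le_trans d0 (dd z).
have udE j : ubi (pj j) (fun t => elog (dE E t) + (- e)%:E)%E.
  apply: ubiD; last exact: ubi_cst.
  apply: (ubi_bnd (pjT j) mdE (L := ln B)).
  apply: (ae_of_null mE (pjE' j)) => t Et; rewrite -elogE//; apply: le_elog.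
    exact: ltW.
  by apply: (dE_le ErE E0) => s Es; exact: (EB hB).
exists n.+1, nu; split.
- split=> [j|].
    exists E; split=> //; rewrite /nu; case: unliftP => [i _|_]; first exact: pjE'.
    by rewrite /= /mscale laE mule0.
  rewrite big_ord_recl nu0; under eq_bigr do rewrite nuS.
  rewrite -fsumE fsumpj// mu1 mule1 /= /mscale/= la1 mule1 -EFinD.
  by rewrite addrC subrK.
- rewrite big_ord_recl nu0; under eq_bigr do rewrite nuS.
  rewrite EFinD; apply: leeD.
    (* However negative the potential of [la] is on the exceptional set, its supremum over [E] is at
       least lc; the correction therefore costs the left side little. *)
    rewrite leNgt; apply/negP => hlt.
    have [x xlt Sx] : exists2 x : R, x < eta * lc & (supE E (potential (mscale a la)) <= x%:E)%E.
      case: (supE _ _) hlt => [x| |]//; first by rewrite lte_fin => ?; exists x.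
      by move=> _; exists (eta * lc - 1); [rewrite ltrBlDr ltrDl|exact: leNye].
    have : lc <= x / eta.
      apply: (sup_potential_ge cE cap0 eqmu ErE la1 (r := rE)).
        apply: (subset_measure0 _ _ _ laE); [|exact: measurableC|exact: subsetC].
        by apply: measurableC; exact: measurable_cdisk.
      move=> z Ez; have : (eta%:E * potential la z <= x%:E)%E.
        apply: le_trans Sx; rewrite -[X in (X%:E * _)%E]/(a%:num) -integral_mscale_gen.
          by apply: ereal_sup_ubound; exists z.
        exact: measurable_log_cdist.
      case: (potential la z) => [y| |]; rewrite ?leNye//.
        by rewrite -EFinM !lee_fin ler_pdivlMr// mulrC.
      by rewrite gt0_muley// lte_fin.
    by rewrite ler_pdivlMr// mulrC leNgt xlt.
  rewrite (_ : ((1 - eta) * (D - e))%:E = \sum_(j < n) \int[pj j]_t (elog (dE E t) + (- e)%:E)%E)%E; last first.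
    rewrite Ipj//; last by apply: emeasurable_funD.
    have umu : ubi mu (fun t => elog (dE E t)).
      apply: (ubi_bnd muT mdE (L := ln B)).
      apply: (ae_of_null mE muE) => t Et; rewrite -elogE//; apply: le_elog; first exact: ltW.
      by apply: (dE_le ErE E0) => s Es; exact: (EB hB).
    rewrite integralD_ub//; last exact: ubi_cst.
    by rewrite DE integral_cst// mu1 mule1 -EFinD -EFinM.
  apply: lee_sum => j _.
  have [s Es hs] := far_point (ts j) del0.
  apply: (@le_trans _ _ (potential (pj j) s)); last by apply: ereal_sup_ubound; exists s.
  apply: ae_le_integral.
  + exact: (udE j).1.
  + exact: measurable_log_cdist.
  + apply: (ae_of_null _ (pjE j)); first exact: measurableI.
    move=> t [Et ct]; have h1 := clts _ _ ct.
    have h2 : dE E t - 3 * del <= cdist s t.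
      have := dE_lip ErE E0 (ts j) t; have := cdist_triangle (ts j) t s.
      by rewrite (cdistC t s); lra.
    have h3 : d / 2 <= cdist s t by have := dd t; lra.
    have d20 : 0 < d / 2 by rewrite divr_gt0.
    rewrite !elogE ?(lt_le_trans d20 h3)// -EFinD lee_fin lerBlDr.
    apply: (@le_trans _ _ (ln (cdist s t + 3 * del))).
      rewrite ler_ln ?posrE//; first lra.
      by rewrite addr_gt0 ?mulr_gt0// (lt_le_trans d20 h3).
    have del30 : 0 <= 3 * del by rewrite mulr_ge0// ltW.
    apply: le_trans (ln_addr_le d20 h3 del30) _.
    by rewrite lerD2l ler_pdivrMr//; lra.
- apply: ge_ereal_sup => _ [z Ez <-].
  rewrite big_ord_recl nu0; under eq_bigr do rewrite nuS.
  rewrite Ipj; [|exact: measurable_log_cdist|by move=> j; exact: ucd].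
  rewrite {1}/potential integral_mscale_gen; last exact: measurable_log_cdist.
  rewrite -!/(potential _ z) (potentialE B0 laT mE laE (fun t Et => EB hB Ez Et)) la1 mule1.
  rewrite (potentialE B0 muT mE muE (fun t Et => EB hB Ez Et)) mu1 mule1 /=.
  (* Either p_mu < lc + e and p_la <= ln B, or p_la <= ln B - M and p_mu <= ln B. The weights eta
     and 1 - eta give the bound in both cases. *)
  have := laH z Ez.
  have := logpot_ge0 0 la z B0; have := logpot_ge0 0 mu z B0.
  have le1 : 0 < 1 - eta by rewrite subr_gt0.
  case: (logpot B 0 la z) => [x| |]// ; case: (logpot B 0 mu z) => [y| |]// y0 x0 h;
    rewrite ?gt0_muleNy ?lte_fin ?leNye ?adde0//=.
  rewrite -!EFinB -!EFinM -!EFinD lee_fin.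
  rewrite !lee_fin lte_fin in y0 x0 h.
  have Mx : M * eta = `|ln B - lc| by rewrite /M divfK// gt_eqF.
  have := ler_norm (ln B - lc); have := normr_ge0 (ln B - lc); rewrite -Mx => h1 h2.
  case: h => h; nra.
Qed.

Lemma CE_sharp (C : R) : (C%:E < CE E mu)%E ->
  exists m (nu : 'I_m -> cmeasure), admissible_family nu /\ ~ sup_ineq E C%:E nu.
Proof.
rewrite /CE DE -/lc -EFinB lte_fin => CC.
pose B := Num.max 1 (2 * rE).
have B1 : 1 <= B by rewrite le_max lexx.
have hB : 2 * rE <= B by rewrite le_max lexx orbT.
pose gam := D - lc - C; have gam0 : 0 < gam by rewrite subr_gt0.
pose q := `|ln B - lc| + `|D - lc| + 1.
have q0 : 0 < q by rewrite ltr_wpDl// addr_ge0.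
(* With e = gam / 4, the two bounds of [sharp_family] would force gam <= eta q + 2 e <= 3 gam /
   4. *)
pose eta := Num.min (2^-1) (gam / (4 * q)).
have eta0 : 0 < eta by rewrite lt_min invr_gt0 ltr0n/= divr_gt0// mulr_gt0.
have etah : eta <= 2^-1 by rewrite ge_min lexx.
have etaq : eta * q <= gam / 4.
  have : eta <= gam / (4 * q) by rewrite ge_min lexx orbT.
  by rewrite invfM mulrA ler_pdivlMr.
have eta1 : eta < 1 by lra.
have e0 : 0 < gam / 4 by rewrite divr_gt0.
have [m [nu [anu lo hi]]] := sharp_family B1 hB eta0 eta1 e0.
exists m, nu; split=> // ineq.
have := le_trans lo (le_trans ineq (leeD2l C%:E hi)).
rewrite -EFinD lee_fin; apply/negP; rewrite -ltNge.
have := ler_norm (ln B - lc); have := ler_norm (D - lc) => h1 h2.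
have : eta * (ln B - lc + (D - lc)) <= eta * q.
  by rewrite ler_pM2l// /q; lra.
rewrite /gam in etaq e0 *; nra.
Qed.

End sharpness.

Theorem theorem2p1 (R : realType) (E : set (R * R)%type) (muE : @cmeasure R) :
  compact E -> 0 < cap E -> equilibrium_measure E muE ->
  (forall (m : nat) (nu : 'I_m -> cmeasure),
      admissible_family nu -> sup_ineq E (CE E muE) nu) /\
  (forall C : R, (C%:E < CE E muE)%E ->
      exists (m : nat) (nu : 'I_m -> cmeasure),
        admissible_family nu /\ ~ sup_ineq E C%:E nu).
Proof.
move=> cE cap0 eqmu; have [rE _ ErE] := compact_bounded_disk cE; split=> [m nu|C].
- exact: (sup_ineq_CE cE cap0 eqmu ErE).
- exact: (CE_sharp cE cap0 eqmu ErE).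
Qed.
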